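(* Let $q_{\mathrm{ad}}\in(q^\dagger,q^u)$ and consider the modified system $$\dot R_i=K_i-f_i(p(q))R_i-\alpha_{\mathrm{ad}}\Big(\sum_{k=1}^nR_k,q\Big)\frac{R_i}{\sum_{k=1}^nR_k}\quad(i=1,\dots,n),\qquad \dot q=\alpha_{\mathrm{ad}}\Big(\sum_{k=1}^nR_k,q\Big)-\mu(q).$$ Then $x^s=(R^s,q^s)$ is a locally asymptotically stable fixed point of this system, and for every initial condition $x=(R,q)\in X_{\mathrm{ad}}:=[0,\infty)^n\times[0,q_{\mathrm{ad}}]$ the trajectory $\varphi(\cdot;x)$ of this system satisfies $$\lim_{t\to\infty}\operatorname{dist}\big(\varphi(t;x),C(q^\dagger)\big)=0 .$$
   Context: Write $\mathbb{R}_+=[0,\infty)$. Let $n\ge1$ be an integer and fix constants $K_1,\dots,K_n,\mu^*,q_c,\beta,q_m,q_{\max}>0$ with $q_{\max}\ge2q_m$. Price function: $p(q)=\beta q$ for $0\le q\le q_m$, $p(q)=\beta(2q_m-q)$ for $q_m\le q\le2q_m$, $p(q)=0$ for $q>2q_m$. Service rate: $\mu(q)=\frac{\mu^*}{q_c}q$ for $0\le q\le q_c$, $\mu(q)=\mu^*$ for $q\ge q_c$. Admission rate: $\alpha:\mathbb{R}_+\to[0,\infty)$ is continuously differentiable, positive and strictly decreasing on $[0,q_{\max})$, and zero on $[q_{\max},\infty)$. Price responses: $f_i:\mathbb{R}_+\to\mathbb{R}_+$, $i=1,\dots,n$, are nondecreasing and continuously differentiable, and at least one of them has strictly positive derivative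 (some may be identically $0$). Let $g(q)=\sum_{i=1}^n\frac{K_i}{f_i(p(q))+\alpha(q)}-\frac{\mu(q)}{\alpha(q)}$ for $q\in[0,q_{\max})$. Assume $g$ has exactly two zeros $q^s,q^u$, with $0<q^s<q_m<q^u<2q_m$, that $g$ changes sign at each of them, that $g$ is differentiable at $q^u$ with $g'(q^u)>0$, and that $\mu(q^s)=\mu(q^u)=\mu^*$. Put $R_i^s=\frac{K_i}{f_i(p(q^s))+\alpha(q^s)}$ and $R^s=(R_1^s,\dots,R_n^s)$. Assume also that for every $i$, $f_i(p(q^u))+\alpha(q^u)=\min_{q\in[0,q^u]}\big(f_i(p(q))+\alpha(q)\big)$. Let $q^\dagger$ be the minimal value in $[q_m,q^u]$ such that for all $\hat q\in[q^\dagger,q^u]$ and all $i$, $f_i(p(\hat q))+\alpha(\hat q)=\min_{q\in[0,\hat q]}\big(f_i(p(q))+\alpha(q)\big)$. For $\hat q\in[q^\dagger,q^u]$ put $R_i(\hat q)=\frac{K_i}{f_i(p(\hat q))+\alpha(\hat q)}$ and $B(\hat q)=\{(R,q)\in\mathbb{R}_+^{n+1}:0\le q\le\hat q,\ 0\le R_i\le R_i(\hat q),\ i=1,\dots,n\}$. Let $\varphi_0$ be the flow of the unmodified system $\dot R_i=K_i-f_i(p(q))R_i-\alpha(q)R_i$, $\dot q=\alpha(q)\sum_{i=1}^nR_i-\mu(q)$ (for which $B(\hat q)$ is forward invariant), and let $C(\hat q)=\bigcap_{t\ge0}\varphi_0(t,B(\hat q))$, a compact invariant set. The modified admission rate is $\alpha_{\mathrm{ad}}(S,q)=\alpha(q)S$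 if $0\le q<q_{\mathrm{ad}}$ and $\alpha_{\mathrm{ad}}(S,q)=\min\{\alpha(q)S,\mu^*\}$ if $q\ge q_{\mathrm{ad}}$. When $\sum_kR_k=0$, the term $\alpha_{\mathrm{ad}}(\sum_kR_k,q)\,R_i/\sum_kR_k$ is read as $0$. Because the right-hand side is discontinuous, trajectories of the modified system are Carathéodory solutions (absolutely continuous functions satisfying the equation almost everywhere), considered in forward time from points of $X_{\mathrm{ad}}$. $\operatorname{dist}(x,C)$ is Euclidean distance from a point to a set. *)

(* Defs.v *)
From HB Require Import structures.
From mathcomp Require Import all_boot all_order all_algebra.
From mathcomp Require Import all_classical all_reals all_analysis.
Import Order.TTheory GRing.Theory Num.Theory.
Import numFieldNormedType.Exports.

Set Implicit Arguments.
Unset Strict Implicit.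
Unset Printing Implicit Defensive.

Local Open Scope classical_set_scope.
Local Open Scope ring_scope.

(** * Calculus on the half-line [0, +oo)

A function on R_+ is represented by a function R -> R of which only the values
on [0, +oo) are used; derivatives are taken within [0, +oo), hence are
one-sided at 0. *)

Section HalfLine.
Variable R : realType.

Definition diffquo_ge0 (f : R -> R) (x : R) :=
  (f y - f x) / (y - x) @[y --> within [set y : R | 0 <= y] x^'].

Definition has_derivative_ge0 (f : R -> R) (x d : R) := diffquo_ge0 f x --> d.

Definition derivative_ge0 (f : R -> R) (x : R) : R := lim (diffquo_ge0 f x).

Definition continuously_differentiable_ge0 (f : R -> R) :=
  (forall x : R, 0 <= x -> cvg (diffquo_ge0 f x)) /\
  {within [set x : R | 0 <= x], continuous (derivative_ge0 f)}.

Definition absolutely_continuous (a b : R) (f : R -> R) :=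
  forall e : R, 0 < e -> exists2 d : R, 0 < d &
    forall (m : nat) (u v : 'I_m -> R),
      (forall k, a <= u k /\ u k <= v k /\ v k <= b) ->
      (forall k l, k != l -> v k <= u l \/ v l <= u k) ->
      \sum_(k < m) (v k - u k) < d ->
      \sum_(k < m) `|f (v k) - f (u k)| < e.

Definition changes_sign_at (g : R -> R) (q : R) :=
  exists2 e : R, 0 < e &
    forall x y : R, q - e < x < q -> q < y < q + e -> g x * g y < 0.

Definition minimal_at_right_end (h : R -> R) (b : R) :=
  forall q : R, 0 <= q <= b -> h b <= h q.

End HalfLine.

(** * States and solutions *)

Section Solutions.
Variables (R : realType) (n : nat).

(* A state x = (R_1, ..., R_n, q) is the pair of the row vector of the R_i
   and of q. *)
Definition state : Type := ('rV[R]_n * R)%type.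

(* The library's norms on 'rV[R]_n and on products are sup norms. *)
Definition euclidean_dist (x y : state) : R :=
  Num.sqrt (\sum_(i < n) (x.1 0 i - y.1 0 i) ^+ 2 + (x.2 - y.2) ^+ 2).

(* Extended-real valued, so that the distance to the empty set is +oo. *)
Definition dist_to_set (x : state) (C : set state) : \bar R :=
  ereal_inf [set (euclidean_dist x c)%:E | c in C].

Definition orthant : set state :=
  [set x : state | (forall i, 0 <= x.1 0 i) /\ 0 <= x.2].

Definition classical_solution (F : state -> state) (x : R -> state) :=
  forall t : R, 0 <= t ->
    [/\ orthant (x t),
        forall i, has_derivative_ge0 (fun s => (x s).1 0 i) t ((F (x t)).1 0 i)
      & has_derivative_ge0 (fun s => (x s).2) t (F (x t)).2].

Definition caratheodory_solution (F : state -> state) (x : R -> state) :=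
  [/\ forall t : R, 0 <= t -> orthant (x t),
      forall T : R, 0 <= T ->
        (forall i, absolutely_continuous 0 T (fun t => (x t).1 0 i)) /\
        absolutely_continuous 0 T (fun t => (x t).2)
    & {ae (@lebesgue_measure R), forall t : R, 0 < t ->
        (forall i, is_derive t 1 (fun s : R => (x s).1 0 i) ((F (x t)).1 0 i)) /\
        is_derive t 1 (fun s : R => (x s).2) (F (x t)).2}].

(* The image of A at time t under the forward flow of the vector field F,
   given as the set of values at time t of the solutions starting in A. *)
Definition flow_image (F : state -> state) (t : R) (A : set state)
    : set state :=
  [set y | exists x, [/\ classical_solution F x, A (x 0) & x t = y]].

Definition fixed_point (F : state -> state) (xs : state) := F xs = 0.

(* Here and below, X is the set of admissible initial conditions. *)
Definition lyapunov_stable (F : state -> state) (X : set state) (xs : state) :=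
  forall e : R, 0 < e -> exists2 d : R, 0 < d &
    forall x, caratheodory_solution F x -> X (x 0) ->
      euclidean_dist (x 0) xs < d ->
      forall t : R, 0 <= t -> euclidean_dist (x t) xs < e.

Definition locally_attractive (F : state -> state) (X : set state)
    (xs : state) :=
  exists2 d : R, 0 < d &
    forall x, caratheodory_solution F x -> X (x 0) ->
      euclidean_dist (x 0) xs < d ->
      euclidean_dist (x t) xs @[t --> +oo] --> 0.

Definition locally_asymptotically_stable (F : state -> state) (X : set state)
    (xs : state) :=
  lyapunov_stable F X xs /\ locally_attractive F X xs.

End Solutions.

(** * The model *)

(* mumax is the saturated service rate mu^*. *)
Record model (R : realType) (n : nat) := Model {
  K : 'I_n -> R;
  mumax : R;
  qc : R;
  beta : R;
  qm : R;
  qmax : R;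
  alpha : R -> R;
  f : 'I_n -> R -> R
}.

Section Model.
Variables (R : realType) (n : nat) (M : model R n).

Definition price (q : R) : R :=
  if q <= qm M then beta M * q
  else if q <= 2 * qm M then beta M * (2 * qm M - q)
  else 0.

Definition mu (q : R) : R :=
  if q <= qc M then mumax M / qc M * q else mumax M.

Definition exit_rate (i : 'I_n) (q : R) : R := f M i (price q) + alpha M q.

Definition g (q : R) : R :=
  \sum_(i < n) K M i / exit_rate i q - mu q / alpha M q.

Definition Rhat (q : R) : 'rV[R]_n := \row_i (K M i / exit_rate i q).

Definition box (qhat : R) : set (state R n) :=
  [set x : state R n | 0 <= x.2 <= qhat /\ forall i, 0 <= x.1 0 i <= Rhat qhat 0 i].

Definition field0 (x : state R n) : state R n :=
  let q := x.2 in
  (\row_i (K M i - f M i (price q) * x.1 0 i - alpha M q * x.1 0 i),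
   alpha M q * (\sum_(k < n) x.1 0 k) - mu q).

Definition core (qhat : R) : set (state R n) :=
  \bigcap_(t in [set t : R | 0 <= t]) flow_image field0 t (box qhat).

Definition alpha_ad (qad S q : R) : R :=
  if q < qad then alpha M q * S else Num.min (alpha M q * S) (mumax M).

(* Since 0^-1 = 0, the last term of the first component is 0 when
   R_1 + ... + R_n = 0. *)
Definition field_ad (qad : R) (x : state R n) : state R n :=
  let q := x.2 in
  let S := \sum_(k < n) x.1 0 k in
  (\row_i (K M i - f M i (price q) * x.1 0 i
           - alpha_ad qad S q * (x.1 0 i / S)),
   alpha_ad qad S q - mu q).

Definition X_ad (qad : R) : set (state R n) :=
  [set x : state R n | (forall i, 0 <= x.1 0 i) /\ 0 <= x.2 <= qad].

Definition minimal_on_upto (qu q : R) :=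
  forall qhat : R, q <= qhat <= qu ->
    forall i, minimal_at_right_end (exit_rate i) qhat.

End Model.

(* Main.v *)
(** Invariance of X_ad and attraction.  Above q_ad the queue cannot grow, so q <= q_ad
for all times.  While admissions are being rejected, q = q_ad and the inequality
g(q_ad) < 0 forces the largest ratio R_i / R_i(q_ad) to decrease at a positive rate
as long as it exceeds 1; without rejection it decreases because
f_i(p(q)) + alpha(q) is minimal at q_ad on [0, q_ad].  Hence this ratio is eventually
close to 1, so alpha(q_ad) (R_1 + ... + R_n) < mu^* and rejections stop.  From then on
the trajectory solves the unmodified system, and its limits along an ultrafilter
are bounded entire solutions.  If the supremum Q of q along such a solution were in
[qdag, q_ad], then R_i <= R_i(Q) everywhere (otherwise R_i would be unbounded
backwards in time), so g(Q) < 0 would make q decrease at a fixed rate near the level Q,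
a contradiction; therefore the entire solution lies in B(qdag), hence in C(qdag).

Existence.  Euler steps with q truncated at q_ad converge along an ultrafilter.  Where
no truncation takes place the limit solves the unmodified system.  The combination
S(w) R_i + w_i q, with w the current state and S(w) = w_1 + ... + w_n, does not see
the admission rate and is therefore differentiable at every time, while at the
Lebesgue density points of { q = q_ad } the derivative of q is 0.

Local stability.  With u = q - q^s, rho_i = R_i - R_i^s, a = - alpha'(q^s) and
phi_i = (f_i o p)'(q^s), the form u^2 / 2 + sum c_i rho_i^2 / 2 with
c_i = alpha(q^s) / ((a + phi_i) R_i^s) decreases strictly for the linearized system
if a > 0; if a = 0, large c_i are taken where phi_i = 0 and a small multiple of
u rho_i is added for one index with phi_i > 0. *)

Require Import Defs.
From HB Require Import structures.
From mathcomp Require Import all_boot all_order all_algebra.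
From mathcomp Require Import all_classical all_reals all_analysis.
From mathcomp Require Import lra ring.
Import Order.TTheory GRing.Theory Num.Theory.
Import numFieldNormedType.Exports.
Set Implicit Arguments.
Unset Strict Implicit.
Unset Printing Implicit Defensive.
Local Open Scope classical_set_scope.
Local Open Scope ring_scope.

(** * Almost everywhere differential inequalities *)

(** The modified field is discontinuous and holds only almost everywhere along a solution, so
    derivatives do not pass to limits of trajectories. What must survive a limit is therefore an
    inequality between the states at two instants: the quadratic defect in [near_flow] for
    attraction, the one-step error in [step_estimate] for existence. Such inequalities are closed
    under pointwise limits, and derivatives are read off afterwards. In the existence proof the
    admission rates of the Euler steps may keep switching between free and truncated values near
    [qad], without any limit of their own; this is why combinations of R_i and q in which they
    cancel are followed. For stability there are two degeneracies. The service rate may have its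
    corner exactly at q^s, so p = mumax - mu(q) is kept as a separate input, of which u p <= 0 and
    |p| <= L |u| are used. And a strictly decreasing alpha may have derivative 0 at q^s, which
    leaves no direct damping of u and forces the case a = 0. *)

Section IncrementBounds.
Variable R : realType.
Implicit Types (f g : R -> R) (a b : R).

(* The cost of [lra] grows quickly with the number of order hypotheses in the
   context: the steps [move: H1 H2; slim; lra] keep only the listed ones, together
   with the section context, which [lra] ignores unless copied by a [have]. *)
Ltac slim := clear.

(* Bounding increments across t, rather than a derivative at t, makes the
   notion stable under finite maxima. *)
Definition straddle (k : R) f (t : R) :=
  forall e : R, 0 < e -> exists2 d : R, 0 < d &
    forall s s' : R, t - d < s -> s <= t -> t <= s' -> s' < t + d ->
      f s' - f s <= (k + e) * (s' - s).

(** With c the supremum of the endpoints reachable from a, the local property at c first gives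
    [P a c] and then leads past c unless c = b. *)
Lemma cousin (P : R -> R -> Prop) a b : a <= b ->
  (forall s t r : R, a <= s -> s <= t -> t <= r -> r <= b ->
     P s t -> P t r -> P s r) ->
  (forall x : R, a <= x <= b -> exists2 d : R, 0 < d &
     forall s t : R, a <= s -> s <= x -> x <= t -> t <= b ->
       x - d < s -> t < x + d -> P s t) ->
  P a b.
Proof.
move=> ab Padd Ploc.
pose A := [set t | a <= t <= b /\ P a t].
have Aa : A a.
  split; first by rewrite lexx.
  have [|d d0 Pd] := Ploc a; first by rewrite lexx.
  by apply: Pd => //; lra.
have Aub : ubound A b by move=> t [/andP[_ ?] _].
have hsA : has_sup A by split; [exists a | exists b].
pose c := sup A.
have ac : a <= c by apply: ub_le_sup => //; exists b.
have cb : c <= b by apply: ge_sup => //; exists a.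
have [|d d0 Pd] := Ploc c; first by rewrite ac.
have [t [/andP[at_ tb] Pat] ct] := sup_adherent d0 hsA.
have tc : t <= c by apply: ub_le_sup; [exists b|split => //; rewrite at_].
have Pac : P a c.
  by apply: (Padd a t c) => //; apply: Pd => //; rewrite /c; lra.
have [->//|cnb] := eqVneq b c.
have cb' : c < b by rewrite lt_neqAle eq_sym cnb.
pose c' := Num.min b (c + d / 2).
have cc' : c < c' by rewrite lt_min cb' /=; lra.
have c'b : c' <= b by rewrite ge_min lexx.
have c'd : c' < c + d by rewrite gt_min; apply/orP; right; lra.
have : A c'.
  split; first by rewrite c'b andbT; lra.
  apply: (Padd a c c') => //; first lra.
  by apply: Pd => //; lra.
move=> Ac'; suff : c' <= c by lra.
by apply: ub_le_sup => //; exists b.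
Qed.

Local Notation mu := (@lebesgue_measure R).

(** The exceptional null set is covered by an open set of small measure. Cousin's lemma cuts [a, b]
    into intervals that either lie in this open set or have increment at most e1 times their length;
    absolute continuity makes the increments over the former small in total. No integral of a
    derivative appears. *)
Lemma straddle_nincr f a b : a <= b -> absolutely_continuous a b f ->
  {ae mu, forall t : R, a < t < b -> straddle 0 f t} -> f b <= f a.
Proof.
move=> ab ACf [N [mN N0 Nf]].
apply/ler_addgt0Pr => e e0.
pose e1 := e / (b - a + 1).
have ba1 : 0 < b - a + 1 by lra.
have e10 : 0 < e1 by rewrite divr_gt0.
have [d d0 Hd] := ACf e1 e10.
(* The endpoints join the null set, since the hypothesis covers only the open interval. *)
pose D := N `|` ([set a] `|` [set b]).
have mD : measurable D by apply: measurableU => //; apply: measurableU; exact: measurable_set1.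
have D0 : mu D = 0%E.
  apply/eqP; rewrite eq_le measure_ge0 andbT.
  apply: (le_trans (measureU2 _ _ _)) => //; first by apply: measurableU; exact: measurable_set1.
  rewrite -[X in (X + _)%E]/(mu N) N0 add0e.
  apply: (le_trans (measureU2 _ _ _)); [exact: measurable_set1|exact: measurable_set1|].
  by rewrite -[(_ + _)%E]/(mu [set a] + mu [set b])%E !lebesgue_measure_set1 adde0.
have [U [oU DU UD]] : exists U : set R, [/\ open U, D `<=` U & (mu (U `\` D) < d%:E)%E].
  by apply: lebesgue_regularity_outer => //; rewrite [X in (X < _)%E]D0 ltry.
have mU : measurable U by exact: measurable_realfun.open_measurable.
have Ud : (mu U < d%:E)%E.
  apply: le_lt_trans UD.
  rewrite -[X in mu X](setDUK DU) (le_trans (measureU2 _ _ _)) //.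
    by apply: measurableD.
  by rewrite -[X in (X + _)%E]/(mu D) D0 add0e.
(* The intervals [u k, v k] carry the part of the increment that e1 (t - s) does not cover.
   Measuring U on half-open intervals makes the length bound additive under concatenation. *)
pose P (s t : R) := exists (m : nat) (u v : 'I_m -> R),
  [/\ forall k, s <= u k /\ u k <= v k /\ v k <= t,
      forall k l, k != l -> v k <= u l \/ v l <= u k,
      ((\sum_(k < m) (v k - u k))%:E <= mu (U `&` `]s, t]))%E
    & f t - f s <= e1 * (t - s) + \sum_(k < m) `|f (v k) - f (u k)|].
have mUI s t : measurable (U `&` `]s, t]) by apply: measurableI.
have : P a b.
  apply: cousin => // [s t r as_ st tr rb|x /andP[ax xb]].
    move=> [m1 [u1 [v1 [b1 d1 l1 i1]]]] [m2 [u2 [v2 [b2 d2 l2 i2]]]].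
    pose w (w1 : 'I_m1 -> R) (w2 : 'I_m2 -> R) (k : 'I_(m1 + m2)) :=
      match fintype.split k with inl i => w1 i | inr j => w2 j end.
    have wl w1 w2 i : w w1 w2 (lshift m2 i) = w1 i.
      by rewrite /w -[lshift _ _]/(unsplit (inl _)) unsplitK.
    have wr w1 w2 i : w w1 w2 (rshift m1 i) = w2 i.
      by rewrite /w -[rshift _ _]/(unsplit (inr _)) unsplitK.
    exists (m1 + m2)%N, (w u1 u2), (w v1 v2); split.
    - move=> k; rewrite /w; case: (fintype.split k) => i.
        by have := b1 i; move: st tr; slim; lra.
      by have := b2 i; move: st tr; slim; lra.
    - move=> k l; rewrite -(splitK k) -(splitK l).
      case: (fintype.split k) => i; case: (fintype.split l) => j /=; rewrite ?wl ?wr => kl.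
      + by apply: d1; apply: contraNneq kl => ->.
      + by left; have := b1 i; have := b2 j; slim; lra.
      + by right; have := b2 i; have := b1 j; slim; lra.
      + by apply: d2; apply: contraNneq kl => ->.
    - rewrite big_split_ord /=.
      under eq_bigr do rewrite !wl.
      under [X in (_ + X)%:E]eq_bigr do rewrite !wr.
      rewrite EFinD (_ : U `&` `]s, r] = (U `&` `]s, t]) `|` (U `&` `]t, r])); last first.
        rewrite -setIUr; congr (_ `&` _).
        by rewrite -itv_bndbnd_setU ?bnd_simp.
      rewrite measureU //; [exact: leeD|exact: mUI|exact: mUI|].
      apply/seteqP; split => // y /= [[_]]; rewrite !in_itv /= => /andP[_ yt][_ /andP[ty _]].
      by have := lt_le_trans ty yt; rewrite ltxx.
    - rewrite big_split_ord /=.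
      under eq_bigr do rewrite !wl.
      under [X in _ + (_ + X)]eq_bigr do rewrite !wr.
      move: i1 i2; slim; lra.
  have [Dx|nDx] := pselect (D x).
    have /nbhs_ballP[r /= r0 rU] : nbhs x U by exact/open_nbhs_nbhs/(conj oU)/DU.
    exists r => // s t as_ sx xt tb xs tx.
    exists 1%N, (fun=> s), (fun=> t); split.
    - by move=> _; lra.
    - by move=> k l; rewrite !ord1.
    - rewrite big_ord1 (_ : U `&` _ = `]s, t]%classic); last first.
        apply/seteqP; split => [y []//|y yst]; split => //.
        move: yst; rewrite /= in_itv /= => yst.
        by apply: rU; rewrite /ball /= ltr_norml; lra.
      by rewrite lebesgue_measure_itv /= lte_fin; case: ifPn => st //; rewrite lee_fin; lra.
    - rewrite big_ord1; have := ler_norm (f t - f s).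
      have : 0 <= e1 * (t - s) by apply: mulr_ge0; [exact: ltW|move: sx xt; slim; lra].
      slim; lra.
  have xab : a < x < b.
    rewrite !lt_neqAle ax xb !andbT; apply/andP; split.
      by apply/eqP => E; apply: nDx; right; left.
    by apply/eqP => E; apply: nDx; right; right.
  have : straddle 0 f x.
    apply: contrapT => nS; apply: nDx; left; apply: Nf => /= H; exact/nS/H.
  move=> /(_ e1 e10)[r r0 Hr]; exists r => // s t as_ sx xt tb xs tx.
  exists 0%N, (fun=> 0), (fun=> 0); split.
  - by case.
  - by case.
  - by rewrite big_ord0.
  - by rewrite big_ord0 addr0 -[e1]add0r; exact: Hr.
move=> [m [u [v [buv duv luv iuv]]]].
have := Hd m u v buv duv.
have /[swap] /[apply] : \sum_(k < m) (v k - u k) < d.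
  rewrite -lte_fin (le_lt_trans luv) // (le_lt_trans _ Ud) //.
  by apply: le_measure; rewrite ?inE; [exact: mUI|exact: mU|exact: subIsetl].
move=> sm; have : e1 * (b - a + 1) = e by rewrite /e1 divfK // gt_eqF.
lra.
Qed.

End IncrementBounds.

(** * Derivatives as linear approximations, and increments of maxima *)

Section Slopes.
Variable R : realType.
Implicit Types (f g : R -> R) (a b : R).
Ltac slim := clear.

(** Common form of the two notions of derivative in use: [is_derive] when D is everything,
    [has_derivative_ge0] when D is the half-line. *)
Definition slope (D : set R) f (t d : R) :=
  forall e : R, 0 < e -> exists2 r : R, 0 < r &
    forall s : R, D s -> `|s - t| < r -> `|f s - f t - d * (s - t)| <= e * `|s - t|.

Lemma is_derive_slope f (t d : R) : is_derive t 1 f d <-> slope setT f t d.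
Proof.
split.
  move=> [df <-] e e0.
  have : h^-1 *: ((f \o shift t) (h *: (1:R)) - f t) @[h --> 0^'] --> 'D_1 f t by exact: df.
  move/cvgrPdist_le => /(_ _ e0).
  rewrite near_withinE near_simpl => -[r /= r0 H].
  exists r => // s _ st.
  have [->|nst] := eqVneq s t; first by rewrite !subrr mulr0 subr0 normr0 mulr0.
  have n0 : s - t != 0 by rewrite subr_eq0.
  have := H (s - t); rewrite /ball /= sub0r normrN => /(_ st n0).
  rewrite /GRing.scale /= mulr1 subrK => H1.
  have -> : f s - f t - 'D_1 f t * (s - t) = ((s - t)^-1 * (f s - f t) - 'D_1 f t) * (s - t).
    by rewrite mulrBl mulrAC mulVf // mul1r.
  by rewrite normrM distrC ler_wpM2r.
move=> H.
suff E : h^-1 *: ((f \o shift t) (h *: (1:R)) - f t) @[h --> 0^'] --> d.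
  split; first by apply/cvg_ex; exists d.
  exact: cvg_lim E.
apply/cvgrPdist_le => e e0.
rewrite near_withinE near_simpl.
have [r r0 Hr] := H e e0.
exists r => //= h; rewrite /ball /= sub0r normrN => hr h0.
rewrite /GRing.scale /= mulr1.
have := Hr (h + t) I; rewrite addrK => /(_ hr).
have -> : d - h^-1 * (f (h + t) - f t) = - (h^-1 * (f (h + t) - f t - d * h)).
  by field.
by rewrite normrN normrM normfV [`|h|^-1 * _]mulrC ler_pdivrMr ?normr_gt0.
Qed.

Lemma has_derivative_ge0_slope f (t d : R) :
  has_derivative_ge0 f t d <-> slope [set y : R | 0 <= y] f t d.
Proof.
rewrite /has_derivative_ge0 /diffquo_ge0; split.
  move/cvgrPdist_le => H e e0; have := H _ e0.
  rewrite !near_withinE near_simpl => -[r /= r0 Hr].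
  exists r => // s s0 st.
  have [->|nst] := eqVneq s t; first by rewrite !subrr mulr0 subr0 normr0 mulr0.
  have n0 : s - t != 0 by rewrite subr_eq0.
  have := Hr s; rewrite /ball /= distrC => /(_ st nst s0) H1.
  have -> : f s - f t - d * (s - t) = ((f s - f t) / (s - t) - d) * (s - t).
    by rewrite mulrBl divfK.
  by rewrite normrM distrC ler_wpM2r.
move=> H; apply/cvgrPdist_le => e e0.
rewrite !near_withinE near_simpl.
have [r r0 Hr] := H e e0.
exists r => //= s; rewrite /ball /= distrC => st nst s0.
have n0 : s - t != 0 by rewrite subr_eq0.
have := Hr s s0 st.
have -> : d - (f s - f t) / (s - t) = - ((f s - f t - d * (s - t)) / (s - t)).
  by field.
by rewrite normrN normrM normfV ler_pdivrMr ?normr_gt0.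
Qed.

Lemma slope_subset (D E : set R) f (t d : R) : E `<=` D -> slope D f t d -> slope E f t d.
Proof.
move=> ED H e e0; have [r r0 Hr] := H e e0.
by exists r => // s Es; apply: Hr; exact: ED.
Qed.

Lemma slope_ge0_interior f (t d : R) : 0 < t ->
  slope [set y : R | 0 <= y] f t d -> is_derive t 1 f d.
Proof.
move=> t0 H; apply/is_derive_slope => e e0; have [r r0 Hr] := H e e0.
exists (Num.min r t); first by rewrite lt_min r0.
move=> s _; rewrite lt_min => /andP[sr st]; apply: Hr => //=.
move: st; rewrite ltr_norml; lra.
Qed.

Lemma derivative_ge0_slope f (t : R) : cvg (diffquo_ge0 f t) ->
  slope [set y : R | 0 <= y] f t (derivative_ge0 f t).
Proof. by move=> H; apply/has_derivative_ge0_slope. Qed.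

Lemma straddle_derive f (t d k : R) : is_derive t 1 f d -> d <= k -> straddle k f t.
Proof.
move=> /is_derive_slope H dk e e0; have [r r0 Hr] := H e e0.
exists r => // s s' ts st ts' s't.
have H1 : `|s - t| < r by rewrite ltr_norml; lra.
have H2 : `|s' - t| < r by rewrite ltr_norml; lra.
have := Hr s I H1; have := Hr s' I H2.
rewrite (ger0_norm (_ : 0 <= s' - t)); last lra.
rewrite (ler0_norm (_ : s - t <= 0)); last lra.
rewrite !ler_norml => /andP[_ A] /andP[B _].
have : 0 <= (k - d) * (s' - s) by apply: mulr_ge0; lra.
have : (k - d) * (s' - s) = k * s' - k * s - d * s' + d * s by ring.
have -> : (k + e) * (s' - s) = k * s' - k * s + e * s' - e * s by ring.
have : d * (s - t) = d * s - d * t by ring.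
have : d * (s' - t) = d * s' - d * t by ring.
have : e * (s' - t) = e * s' - e * t by ring.
have : e * - (s - t) = e * t - e * s by ring.
lra.
Qed.

Lemma straddle_cst (c k t : R) : 0 <= k -> straddle k (fun=> c) t.
Proof.
move=> k0 e e0; exists 1 => // s s' _ ? ? _.
by rewrite subrr mulr_ge0; lra.
Qed.

Lemma straddle_addlin f (c k t : R) : straddle k f t -> straddle (k + c) (fun s => f s + c * s) t.
Proof.
move=> H e e0; have [r r0 Hr] := H e e0; exists r => // s s' A B C D.
have := Hr s s' A B C D.
have -> : (k + c + e) * (s' - s) = (k + e) * (s' - s) + c * s' - c * s by ring.
lra.
Qed.

Lemma straddle_near f g (k t : R) : (exists2 r : R, 0 < r & forall s, `|s - t| < r ->
  f s = g s) ->
  straddle k f t -> straddle k g t.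
Proof.
move=> [r1 r10 fg] H e e0; have [r r0 Hr] := H e e0.
exists (Num.min r r1); first by rewrite lt_min r0.
move=> s s' A B C D.
have l1 : Num.min r r1 <= r by rewrite ge_min lexx.
have l2 : Num.min r r1 <= r1 by rewrite ge_min lexx orbT.
by rewrite -!fg ?ltr_norml; [apply: Hr|..]; lra.
Qed.

Definition cont_at f (t : R) :=
  forall e : R, 0 < e -> exists2 r : R, 0 < r & forall s, `|s - t| < r -> `|f s - f t| < e.

Lemma is_derive_cont f (t d : R) : is_derive t 1 f d -> cont_at f t.
Proof.
move=> /is_derive_slope H e e0; have [r r0 Hr] := H 1 ltr01.
pose c := `|d| + 1 + 1.
have c0 : 0 < c by rewrite /c; have := normr_ge0 d; lra.
exists (Num.min r (e / c)); first by rewrite lt_min r0 divr_gt0.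
move=> s; rewrite lt_min => /andP[sr se].
have := Hr s I sr; rewrite mul1r => H1.
have : `|f s - f t| <= `|f s - f t - d * (s - t)| + `|d * (s - t)|.
  by apply: le_trans (ler_normD _ _); rewrite subrK.
rewrite normrM; move: se; rewrite ltr_pdivlMr // /c => se.
have : `|s - t| * (`|d| + 1 + 1) = `|d| * `|s - t| + `|s - t| + `|s - t| by ring.
have := normr_ge0 (s - t); lra.
Qed.

Lemma cont_at_max f g (t : R) : cont_at f t -> cont_at g t -> cont_at (f \max g) t.
Proof.
move=> cf cg e e0; have [r r0 Hr] := cf e e0; have [r1 r10 Hr1] := cg e e0.
exists (Num.min r r1); first by rewrite lt_min r0.
move=> s; rewrite lt_min => /andP[A B].
have := Hr s A; have := Hr1 s B; rewrite /= !ltr_norml.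
rewrite /Num.max; case: ifP; case: ifP; slim; lra.
Qed.

(** A function strictly below the maximum at t stays below nearby and drops out. In a tie, the
    function that is larger at s' bounds the increment, because its value at s is at most the
    maximum there. *)
Lemma straddle_max2 f g (k t : R) : cont_at f t -> cont_at g t ->
  (f t = Num.max (f t) (g t) -> straddle k f t) ->
  (g t = Num.max (f t) (g t) -> straddle k g t) -> straddle k (f \max g) t.
Proof.
move=> cf cg Hf Hg.
have [fg|gf|E] := ltgtP (f t) (g t).
- apply: (@straddle_near g); last by apply: Hg; rewrite max_r ?ltW.
  have [r r0 Hr] := cf ((g t - f t) / 2) ltac:(lra).
  have [r1 r10 Hr1] := cg ((g t - f t) / 2) ltac:(lra).
  exists (Num.min r r1); first by rewrite lt_min r0.
  move=> s; rewrite lt_min => /andP[A B].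
  have := Hr s A; have := Hr1 s B; rewrite /= !ltr_norml => ? ?.
  by rewrite max_r //; lra.
- apply: (@straddle_near f); last by apply: Hf; rewrite max_l ?ltW.
  have [r r0 Hr] := cf ((f t - g t) / 2) ltac:(lra).
  have [r1 r10 Hr1] := cg ((f t - g t) / 2) ltac:(lra).
  exists (Num.min r r1); first by rewrite lt_min r0.
  move=> s; rewrite lt_min => /andP[A B].
  have := Hr s A; have := Hr1 s B; rewrite /= !ltr_norml => ? ?.
  by rewrite max_l //; lra.
- have Ef : f t = Num.max (f t) (g t) by rewrite E maxxx.
  have Eg : g t = Num.max (f t) (g t) by rewrite E maxxx.
  move=> e e0; have [r r0 Hr] := Hf Ef e e0; have [r1 r10 Hr1] := Hg Eg e e0.
  exists (Num.min r r1); first by rewrite lt_min r0.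
  move=> s s' A B C D.
  have l1 : Num.min r r1 <= r by rewrite ge_min lexx.
  have l2 : Num.min r r1 <= r1 by rewrite ge_min lexx orbT.
  have := Hr s s' ltac:(lra) B C ltac:(lra).
  have := Hr1 s s' ltac:(lra) B C ltac:(lra).
  rewrite /= /Num.max; case: ifP; case: ifP; slim; lra.
Qed.

Lemma cont_at_bigmax (I : Type) (r : seq I) (c t : R) (F : I -> R -> R) :
  (forall i, cont_at (F i) t) -> cont_at (fun s => \big[Num.max/c]_(i <- r) F i s) t.
Proof.
move=> Fc; elim: r => [|j r IHr].
  by move=> e e0; exists 1 => // s _; rewrite !big_nil subrr normr0.
suff -> : (fun s => \big[Num.max/c]_(i <- j :: r) F i s) =
          (F j \max fun s => \big[Num.max/c]_(i <- r) F i s) by exact: cont_at_max.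
by apply/funext => s; rewrite big_cons.
Qed.

(** The default value c acts as a floor. Where it attains the maximum, a constant competes, whence
    the condition 0 <= k in that case only. *)
Lemma straddle_bigmax (I : Type) (r : seq I) (c k t : R) (F : I -> R -> R) :
  (forall i, cont_at (F i) t) ->
  (c = \big[Num.max/c]_(i <- r) F i t -> 0 <= k) ->
  (forall i, F i t = \big[Num.max/c]_(i <- r) F i t -> straddle k (F i) t) ->
  straddle k (fun s => \big[Num.max/c]_(i <- r) F i s) t.
Proof.
elim: r => [|i r IH] Fc H0 HF.
  rewrite (_ : (fun s => _) = fun=> c); last by apply/funext => s; rewrite big_nil.
  by apply: straddle_cst; apply: H0; rewrite big_nil.
rewrite (_ : (fun s => _) = (F i \max fun s => \big[Num.max/c]_(i <- r) F i s)); last first.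
  by apply/funext => s; rewrite big_cons.
have cr := cont_at_bigmax r c Fc.
rewrite big_cons in H0 HF.
apply: straddle_max2 => //; first by move=> /HF.
move=> E; apply: IH => //.
  by rewrite E.
by move=> j; rewrite E => /HF.
Qed.

Local Notation mu := (@lebesgue_measure R).

Lemma ae_imp (P Q : R -> Prop) : (forall t, P t -> Q t) ->
  {ae mu, forall t, P t} -> {ae mu, forall t, Q t}.
Proof. by move=> PQ; apply: negligibleS => t /= nQ /PQ. Qed.

(** Single source of absolute continuity below: Lipschitz functions, sums, products and finite
    maxima are all instances. *)
Lemma ac_dominated (I : finType) (F : I -> R -> R) g a b (C : R) :
  (forall i, absolutely_continuous a b (F i)) ->
  (forall u v, a <= u -> u <= v -> v <= b ->
     `|g v - g u| <= C * \sum_i `|F i v - F i u|) ->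
  absolutely_continuous a b g.
Proof.
move=> ACF Hg e e0.
pose C1 := `|C| + 1.
have C10 : 0 < C1 by rewrite /C1; have := normr_ge0 C; lra.
pose N1 := #|I|%:R + 1 : R.
have N10 : 0 < N1 by rewrite /N1; have := ler0n R #|I|; lra.
pose e1 := e / (C1 * N1).
have e10 : 0 < e1 by rewrite divr_gt0 // mulr_gt0.
have /choice[d Hd] : forall i, exists d : R, 0 < d /\ forall (m : nat) (u v : 'I_m -> R),
      (forall k, a <= u k /\ u k <= v k /\ v k <= b) ->
      (forall k l, k != l -> v k <= u l \/ v l <= u k) ->
      \sum_(k < m) (v k - u k) < d ->
      \sum_(k < m) `|F i (v k) - F i (u k)| < e1.
  by move=> i; have [d d0 H] := ACF i e1 e10; exists d.
exists (\big[Num.min/1]_i d i).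
  apply: (big_ind (fun x => 0 < x)) => // [x y x0 y0|i _]; last exact: (Hd i).1.
  by rewrite lt_min x0.
move=> m u v uv duv suv.
apply: (@le_lt_trans _ _ (\sum_(k < m) C1 * \sum_i `|F i (v k) - F i (u k)|)).
  apply: ler_sum => k _; have [? [? ?]] := uv k.
  apply: (le_trans (Hg _ _ _ _ _)) => //.
  apply: ler_wpM2r; first by apply: sumr_ge0.
  by rewrite /C1; have := ler_norm C; lra.
rewrite -mulr_sumr exchange_big /=.
apply: (@le_lt_trans _ _ (C1 * (\sum_(i : I) e1))).
  apply: ler_wpM2l; first lra.
  apply: ler_sum => i _; apply: ltW; apply: (Hd i).2 => //.
  by apply: lt_le_trans suv _; exact: bigmin_le_cond.
rewrite sumr_const -mulr_natr (_ : C1 * (e1 * _) = e * (#|I|%:R / N1)); last first.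
  by rewrite /e1; field; rewrite !gt_eqF.
rewrite gtr_pMr // ltr_pdivrMr // /N1; lra.
Qed.

Lemma lipschitz_ac f a b (C : R) :
  (forall s t, a <= s -> s <= t -> t <= b -> `|f t - f s| <= C * (t - s)) ->
  absolutely_continuous a b f.
Proof.
move=> H; apply: (@ac_dominated unit (fun _ s => s) f a b C).
  move=> _ e e0; exists e => // m u v uv _.
  move=> H1; rewrite (eq_bigr (fun k => v k - u k)) // => k _.
    by rewrite ger0_norm // subr_ge0; have := uv k; lra.
move=> u v au uv vb.
rewrite big_const card_unit /= addr0 [X in _ * X]ger0_norm ?subr_ge0 //; exact: H.
Qed.

Lemma ac_sub f a b a' b' : a <= a' -> b' <= b -> absolutely_continuous a b f ->
  absolutely_continuous a' b' f.
Proof.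
move=> aa bb H e e0; have [d d0 Hd] := H e e0; exists d => // m u v uv.
by apply: Hd => k; have := uv k; lra.
Qed.

Lemma ac_incr_le f a b (k : R) : a <= b -> absolutely_continuous a b f ->
  {ae mu, forall t : R, a < t < b -> straddle k f t} -> f b - f a <= k * (b - a).
Proof.
move=> ab AC H.
suff : f b + (- k) * b <= f a + (- k) * a.
  have -> : k * (b - a) = k * b - k * a by ring.
  lra.
apply: (@straddle_nincr R (fun s => f s + (- k) * s)) => //.
  apply: (@ac_dominated bool (fun i s => if i then f s else s) _ a b (1 + `|k|)).
    case => //; apply: (@lipschitz_ac _ _ _ 1) => s t _ st _.
    by rewrite mul1r ger0_norm ?subr_ge0.
  move=> u v _ _ _; rewrite big_bool /=.
  have -> : f v + - k * v - (f u + - k * u) = (f v - f u) - k * (v - u) by ring.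
  apply: (le_trans (ler_normB _ _)); rewrite normrM.
  have : 0 <= `|k| * `|f v - f u| by rewrite mulr_ge0.
  have := normr_ge0 (v - u).
  have -> : (1 + `|k|) * (`|f v - f u| + `|v - u|) = `|f v - f u| + `|v - u| +
    `|k| * `|f v - f u| + `|k| * `|v - u| by ring.
  lra.
apply: ae_imp H => t H /H /(straddle_addlin (- k)).
by rewrite subrr.
Qed.

End Slopes.

(** * Levels that an absolutely continuous function cannot cross, and Lipschitz bounds *)

Section Barriers.
Variable R : realType.
Implicit Types (f : R -> R) (a b L v : R).
Local Notation mu := (@lebesgue_measure R).
Ltac slim := clear.

Lemma ac_continuous f a b : absolutely_continuous a b f ->
  forall e : R, 0 < e -> exists2 d : R, 0 < d &
    forall s t, a <= s -> s <= t -> t <= b -> t - s < d -> `|f t - f s| < e.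
Proof.
move=> AC e e0; have [d d0 H] := AC e e0; exists d => // s t as_ st tb std.
have := H 1%N (fun=> s) (fun=> t); rewrite !big_ord1; apply => //.
by move=> k l; rewrite !ord1.
Qed.

(** After the last time c with f c <= L the function is above L, hence does not increase on
    [c, b]. *)
Lemma ac_below f a b L : a <= b -> absolutely_continuous a b f ->
  {ae mu, forall t, a < t < b -> L < f t -> straddle 0 f t} ->
  f a <= L -> f b <= L.
Proof.
move=> ab AC Hf faL.
pose A := [set s | a <= s <= b /\ f s <= L].
have Aa : A a by split; rewrite ?lexx.
have Aub : ubound A b by move=> t [/andP[_ ?] _].
have hsA : has_sup A by split; [exists a | exists b].
pose c := sup A.
have ac : a <= c by apply: ub_le_sup => //; exists b.
have cb : c <= b by apply: ge_sup => //; exists a.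
have fcL : f c <= L.
  apply/ler_addgt0Pr => e e0; have [d d0 Hd] := ac_continuous AC e0.
  have [t [/andP[at_ tb] ftL] ct] := sup_adherent d0 hsA.
  have tc : t <= c by apply: ub_le_sup; [exists b|split => //; rewrite at_].
  have := Hd t c at_ tc cb; rewrite ltr_norml; move: ct; rewrite -/c => ct.
  by move=> /(_ ltac:(lra)); lra.
suff : f b - f c <= 0 * (b - c) by rewrite mul0r; lra.
apply: ac_incr_le => //; first exact: ac_sub AC.
apply: ae_imp Hf => t Ht /andP[ct tb]; apply: Ht; first by rewrite tb; lra.
rewrite ltNge; apply/negP => ftL.
suff : t <= c by lra.
by apply: ub_le_sup; [exists b|split => //; lra].
Qed.

(** Linear decrease brings f to L no later than (f 0 - L) / c, and [ac_below] keeps it there. *)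
Lemma ac_decay f L (c : R) : 0 < c ->
  (forall T, 0 <= T -> absolutely_continuous 0 T f) ->
  {ae mu, forall t, 0 < t -> L < f t -> straddle (- c) f t} ->
  exists2 T, 0 <= T & forall t, T <= t -> f t <= L.
Proof.
move=> c0 AC Hf.
have stay s t : 0 <= s -> s <= t -> f s <= L -> f t <= L.
  move=> s0 st; apply: ac_below => //.
    by apply: (ac_sub _ _ (AC t _)) => //; lra.
  apply: ae_imp Hf => r Hr /andP[sr rt] Lf e e0.
  have [d d0 Hd] := Hr ltac:(lra) Lf e e0; exists d => // u v A B C D.
  apply: (le_trans (Hd u v A B C D)).
  by apply: ler_wpM2r; lra.
pose T := Num.max 0 ((f 0 - L) / c).
have T0 : 0 <= T by rewrite le_max lexx.
exists T => // t Tt; apply: (stay T) => //.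
have [[s [s0 sT] fs]|H] := pselect (exists2 s, 0 <= s /\ s <= T & f s <= L).
  exact: (stay s).
have HL s : 0 <= s -> s <= T -> L < f s.
  by move=> s0 sT; rewrite ltNge; apply/negP => fs; apply: H; exists s.
have : f T - f 0 <= - c * (T - 0).
  apply: ac_incr_le => //; first exact: AC.
  by apply: ae_imp Hf => s Hs /andP[s0 sT]; apply: Hs => //; apply: HL; lra.
have : (f 0 - L) / c <= T by rewrite le_max lexx orbT.
rewrite ler_pdivrMr // subr0 mulNr [T * c]mulrC; lra.
Qed.

(** Monotonicity is known only below v. Up to the first time at which v is reached f would be
    nonincreasing, so its value there would be at most f 0 < v. *)
Lemma ac_trapped f v : (forall T, 0 <= T -> absolutely_continuous 0 T f) ->
  {ae mu, forall t, 0 < t -> f t < v -> straddle 0 f t} ->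
  f 0 < v -> forall t, 0 <= t -> f t <= f 0.
Proof.
move=> AC Hf f0v t t0.
have incr s : 0 <= s -> (forall r, 0 < r < s -> f r < v) -> f s <= f 0.
  move=> s0 Hs; suff : f s - f 0 <= 0 * (s - 0) by rewrite mul0r; lra.
  apply: ac_incr_le => //; first exact: AC.
  apply: ae_imp Hf => r Hr r0s; apply: Hr; last exact: Hs.
  by case/andP: r0s.
apply: (incr _ t0) => r r0t; rewrite ltNge; apply/negP => vr.
pose A := [set s | 0 <= s <= r /\ v <= f s].
have Ar : A r by split; rewrite ?lexx //; lra.
have Alb : lbound A 0 by move=> s [/andP[? _] _].
have hiA : has_inf A by split; [exists r|exists 0].
pose c := inf A.
have c0 : 0 <= c by apply: lb_le_inf => //; exists r.
have cr : c <= r by apply: ge_inf => //; exists 0.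
have fc : v <= f c.
  apply/ler_addgt0Pr => e e0; have [d d0 Hd] := ac_continuous (AC r ltac:(lra)) e0.
  have [s [/andP[s0 sr] fs] cs] := inf_adherent d0 hiA.
  have cs' : c <= s by apply: ge_inf; [exists 0|split => //; rewrite s0].
  have := Hd c s c0 cs' sr; rewrite ltr_norml; move: cs; rewrite -/c => cs.
  by move=> /(_ ltac:(lra)); lra.
have := incr c c0; suff : forall s, 0 < s < c -> f s < v by move=> H /(_ H); lra.
move=> s /andP[s0 sc]; rewrite ltNge; apply/negP => fs.
suff : c <= s by lra.
by apply: ge_inf; [exists 0|split => //; lra].
Qed.

(** Mean value inequality through Cousin's lemma, which treats the one-sided derivative at 0 like
    any other point; the constant is the maximum of |f'| on [0, b]. *)
Lemma C1_lipschitz f b : continuously_differentiable_ge0 f -> 0 <= b ->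
  exists2 L, 0 <= L & forall s t, 0 <= s <= b -> 0 <= t <= b -> `|f t - f s| <= L * `|t - s|.
Proof.
move=> [df cD] b0; pose D := derivative_ge0 f.
have cD1 : {within `[0, b], continuous (fun x => `|D x|)}.
  have sub : `[0, b]%classic `<=` [set x : R | 0 <= x].
    by move=> x /=; rewrite in_itv /= => /andP[].
  apply: (continuous_subspaceW sub) => x; apply: cvg_norm; exact: cD.
have [c _ Hc] := EVT_max b0 cD1.
exists `|D c| => //.
have main s t : 0 <= s -> s <= t -> t <= b -> `|f t - f s| <= `|D c| * (t - s).
  move=> s0 st tb.
  apply/ler_addgt0Pr => e e0.
  pose e1 := e / (t - s + 1).
  have ts1 : 0 < t - s + 1 by lra.
  have e10 : 0 < e1 by rewrite divr_gt0.
  suff : `|f t - f s| <= (`|D c| + e1) * (t - s).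
    have : e1 * (t - s + 1) = e by rewrite /e1 divfK // gt_eqF.
    have -> : (`|D c| + e1) * (t - s) = `|D c| * (t - s) + e1 * (t - s + 1) - e1 by ring.
    lra.
  apply: (@cousin R (fun s t => `|f t - f s| <= (`|D c| + e1) * (t - s))) => //.
    move=> x y z _ _ _ _ H1 H2.
    have -> : f z - f x = (f z - f y) + (f y - f x) by ring.
    apply: (le_trans (ler_normD _ _)).
    have -> : (`|D c| + e1) * (z - x) = (`|D c| + e1) * (z - y) + (`|D c| + e1) * (y - x) by ring.
    exact: lerD.
  move=> x /andP[sx xt].
  have [r r0 Hr] := derivative_ge0_slope (df x ltac:(lra)) e10.
  exists r => // y z ay yx xz zb ry rz.
  have B w : s <= w -> `|w - x| < r -> `|f w - f x| <= (`|D c| + e1) * `|w - x|.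
    move=> sw wr; have /= := Hr w ltac:(rewrite /=; lra) wr; rewrite -/D => H1.
    have -> : f w - f x = (f w - f x - D x * (w - x)) + D x * (w - x) by ring.
    apply: (le_trans (ler_normD _ _)); rewrite normrM mulrDl addrC.
    apply: lerD; [apply: ler_wpM2r; [exact: normr_ge0|apply: Hc]|exact: H1].
    by rewrite in_itv /=; lra.
  have -> : f z - f y = (f z - f x) - (f y - f x) by ring.
  apply: (le_trans (ler_normB _ _)).
  have -> : (`|D c| + e1) * (z - y) = (`|D c| + e1) * `|z - x| + (`|D c| + e1) * `|y - x|.
    by rewrite (ger0_norm (_ : 0 <= z - x)) ?(ler0_norm (_ : y - x <= 0)); [ring|lra|lra].
  by apply: lerD; apply: B; rewrite ?ltr_norml; move: ay yx xz sx r0 ry rz; slim; lra.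
move=> s t /andP[s0 sb] /andP[t0 tb].
have [st|ts] := leP s t.
  by rewrite [`|t - s|]ger0_norm ?subr_ge0 //; apply: main.
rewrite distrC [`|t - s|]distrC [`|s - t|]ger0_norm; last lra.
by apply: main => //; lra.
Qed.

End Barriers.

(** * Regularity of the model *)

Section ModelFacts.
Variables (R : realType) (n : nat) (M : model R n).
Implicit Types (q b L : R).
Ltac slim := clear - R n M.

Definition price_rate (i : 'I_n) (q : R) : R := f M i (price M q).

Lemma exit_rateE i q : exit_rate M i q = price_rate i q + alpha M q.
Proof. by []. Qed.

(* Positivity and Lipschitz bounds, with a common constant L, of the
   coefficients of the system on 0 <= q <= b. *)
Record tame (b L : R) : Prop := Tame {
  tame_K : forall i, 0 < K M i <= L;
  tame_mumax : 0 < mumax M <= L;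
  tame_alpha : forall q, 0 <= q <= b -> 0 < alpha M q <= L;
  tame_rate : forall i q, 0 <= q <= b -> 0 <= price_rate i q <= L;
  tame_mu : forall q, 0 <= q -> 0 <= mu M q <= mumax M;
  tame_mu0 : mu M 0 = 0;
  tame_alpha_mono : forall q q', 0 <= q -> q <= q' -> q' <= b ->
    alpha M q' <= alpha M q;
  tame_alpha_lip : forall q q', 0 <= q <= b -> 0 <= q' <= b ->
    `|alpha M q' - alpha M q| <= L * `|q' - q|;
  tame_rate_lip : forall i q q', 0 <= q <= b -> 0 <= q' <= b ->
    `|price_rate i q' - price_rate i q| <= L * `|q' - q|;
  tame_mu_lip : forall q q', 0 <= q <= b -> 0 <= q' <= b ->
    `|mu M q' - mu M q| <= L * `|q' - q|
}.

(** On the half-line this is the price divided by beta; the min-max form shows that it is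
    1-Lipschitz. *)
Definition tent q := Num.max 0 (Num.min q (2 * qm M - q)).

Lemma price_tent q : 0 < qm M -> 0 <= q -> price M q = beta M * tent q.
Proof.
move=> qm0 q0; rewrite /price /tent.
case: (leP q (qm M)) => h1.
  by rewrite min_l ?max_r //; lra.
case: (leP q (2 * qm M)) => h2.
  by rewrite min_r ?max_r //; lra.
by rewrite min_r ?max_l ?mulr0 //; lra.
Qed.

Lemma tent_lip q q' : `|tent q' - tent q| <= `|q' - q|.
Proof.
have step x y : tent x - tent y <= `|x - y|.
  rewrite /tent; have := ler_norm (x - y); have := ler_norm (y - x).
  rewrite distrC => ? ?.
  case: (leP x (2 * qm M - x)) => h1; case: (leP y (2 * qm M - y)) => h2.
  - by case: (leP 0 x) => h3; case: (leP 0 y) => h4; lra.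
  - by case: (leP 0 x) => h3; case: (leP 0 (2 * qm M - y)) => h4; lra.
  - by case: (leP 0 (2 * qm M - x)) => h3; case: (leP 0 y) => h4; lra.
  - by case: (leP 0 (2 * qm M - x)) => h3; case: (leP 0 (2 * qm M - y)) => h4; lra.
by have := step q q'; have := step q' q; rewrite distrC ler_norml => ? ?; lra.
Qed.

Lemma tent_bound q : 0 < qm M -> 0 <= tent q <= qm M.
Proof.
move=> qm0; rewrite /tent; case: (leP q (2 * qm M - q)) => h1.
  by case: (leP 0 q) => h3; lra.
by case: (leP 0 (2 * qm M - q)) => h3; lra.
Qed.

(** Turns the single equation at q^s into saturation of the service rate on all of [q^s, +oo). *)
Lemma mu_sat q : 0 < qc M -> 0 < mumax M -> mu M q = mumax M <-> qc M <= q.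
Proof.
move=> qc0 mm0; rewrite /mu; case: (leP q (qc M)) => h; last by split => // _; exact: ltW.
split=> [E|h'].
  rewrite -(ler_pM2l (_ : 0 < mumax M / qc M)) ?divr_gt0 // E divfK ?gt_eqF //.
have -> : q = qc M by lra.
by rewrite divfK ?gt_eqF.
Qed.

(** The bound b < q_max keeps alpha positive on [0, b], and each f_i is only evaluated on the range
    [0, beta q_m] of the price. L is the sum of all constants that arise. *)
Lemma model_tame b :
  (forall i, 0 < K M i) -> 0 < mumax M -> 0 < qc M -> 0 < beta M -> 0 < qm M ->
  continuously_differentiable_ge0 (alpha M) ->
  (forall q, 0 <= q -> q < qmax M -> 0 < alpha M q) ->
  (forall q q', 0 <= q -> q < q' -> q' < qmax M -> alpha M q' < alpha M q) ->
  (forall i (p : R), 0 <= p -> 0 <= f M i p) ->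
  (forall i, continuously_differentiable_ge0 (f M i)) ->
  (forall i (p p' : R), 0 <= p -> p <= p' -> f M i p <= f M i p') ->
  0 <= b -> b < qmax M -> exists2 L, 0 < L & tame b L.
Proof.
move=> K0 mm0 qc0 be0 qm0 aC a0 ad f0 fC fm b0 bq.
have [La La0 HLa] := C1_lipschitz aC b0.
have bq0 : 0 <= beta M * qm M by rewrite mulr_ge0 // ltW.
have /choice[Lf HLf] : forall i, exists L : R, 0 <= L /\
    forall s t, 0 <= s <= beta M * qm M -> 0 <= t <= beta M * qm M ->
      `|f M i t - f M i s| <= L * `|t - s|.
  by move=> i; have [L L0 H] := C1_lipschitz (fC i) bq0; exists L.
pose S1 := \sum_i K M i.
pose S2 := \sum_i f M i (beta M * qm M).
pose S3 := \sum_i Lf i * beta M.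
have S10 : 0 <= S1 by apply: sumr_ge0 => i _; apply: ltW.
have S20 : 0 <= S2 by apply: sumr_ge0 => i _; exact: f0.
have S30 : 0 <= S3 by apply: sumr_ge0 => i _; rewrite mulr_ge0 ?(HLf i).1 // ltW.
have mq0 : 0 < mumax M / qc M by rewrite divr_gt0.
have am q q' : 0 <= q -> q <= q' -> q' <= b -> alpha M q' <= alpha M q.
  move=> q0; rewrite le_eqVlt => /predU1P[->//|qq'] q'b; apply: ltW; apply: ad => //; lra.
have pr q : 0 <= q -> 0 <= price M q <= beta M * qm M.
  move=> q0; rewrite price_tent //; have /andP[t0 tq] := tent_bound q qm0.
  by rewrite mulr_ge0 ?ler_wpM2l // ltW.
have a00 : 0 < alpha M 0 by apply: a0 => //; lra.
have muE q : mu M q = mumax M / qc M * Num.min q (qc M).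
  rewrite /mu; case: (leP q (qc M)) => h //.
  by rewrite divfK ?gt_eqF.
have term (F : 'I_n -> R) i : (forall j, 0 <= F j) -> F i <= \sum_j F j.
  by move=> F0; rewrite (bigD1 i) //= lerDl; apply: sumr_ge0.
pose L := S1 + S2 + S3 + mumax M / qc M + mumax M + La + alpha M 0.
exists L; first by rewrite /L; lra.
split.
- move=> i; rewrite K0 /= /L; suff : K M i <= S1 by lra.
  by apply: term => j; exact: ltW.
- by rewrite mm0 /L /=; lra.
- move=> q /andP[q0 qb]; rewrite a0 //=; last lra.
  by have := am 0 q (lexx 0) q0 qb; move: S10 S20 S30 mq0 mm0 La0; rewrite /L; slim; lra.
- move=> i q /andP[q0 qb]; have /andP[p0 pb] := pr q q0.
  rewrite /price_rate f0 //= (le_trans (fm _ _ _ p0 pb)) //.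
  suff : f M i (beta M * qm M) <= S2 by rewrite /L; lra.
  by apply: (term (fun i => f M i (beta M * qm M))) => j; exact: f0.
- move=> q q0; rewrite muE.
  have m0 : 0 <= Num.min q (qc M) by rewrite le_min q0 ltW.
  rewrite mulr_ge0 //=; last exact: ltW.
  rewrite -[leRHS](@divfK _ (qc M)) ?gt_eqF //; apply: ler_wpM2l; first exact: ltW.
  by rewrite ge_min lexx orbT.
- by rewrite muE min_l ?mulr0 // ltW.
- exact: am.
- move=> q q' qb q'b; apply: (le_trans (HLa _ _ qb q'b)).
  by apply: ler_wpM2r => //; rewrite /L; lra.
- move=> i q q' /andP[q0 qb] /andP[q'0 q'b].
  apply: (le_trans ((HLf i).2 _ _ (pr _ q0) (pr _ q'0))).
  rewrite !price_tent // -mulrBr normrM (gtr0_norm be0) mulrA.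
  apply: ler_pM => //; first by rewrite mulr_ge0 ?(HLf i).1 // ltW.
    suff : Lf i * beta M <= S3 by rewrite /L; lra.
    by apply: (term (fun i => Lf i * beta M)) => j; rewrite mulr_ge0 ?(HLf j).1 // ltW.
  exact: tent_lip.
- move=> q q' _ _; rewrite !muE -mulrBr normrM (gtr0_norm mq0).
  apply: ler_pM => //; [exact: ltW|by rewrite /L; lra|].
  rewrite ler_norml; have := ler_norm (q' - q); have := ler_norm (q - q').
  rewrite distrC => n1 n2.
  by case: (leP q (qc M)); case: (leP q' (qc M)); move: n1 n2; slim; lra.
Qed.

End ModelFacts.

(** * The sign of g between its two zeros *)

Section NegativeG.
Variables (R : realType) (n : nat) (M : model R n).

Lemma cvgr_sum (T : Type) (F : set_system T) {FF : Filter F} (I : Type) (r : seq I)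
    (h : I -> T -> R) (l : I -> R) : (forall i, h i x @[x --> F] --> l i) ->
  \sum_(i <- r) h i x @[x --> F] --> \sum_(i <- r) l i.
Proof.
move=> hl; elim: r => [|i r IH].
  by rewrite big_nil; under eq_fun do rewrite big_nil; exact: cvg_cst.
rewrite big_cons; under eq_fun do rewrite big_cons; exact: cvgD.
Qed.

Lemma lip_cvg (h : R -> R) (b L x : R) : 0 < x -> x < b ->
  (forall q q' : R, 0 <= q <= b -> 0 <= q' <= b -> `|h q' - h q| <= L * `|q' - q|) ->
  h y @[y --> x] --> h x.
Proof.
move=> x0 xb H; apply/cvgrPdist_lt => e e0.
pose c := `|L| + 1.
have c0 : 0 < c by rewrite /c; have := normr_ge0 L; lra.
have r0 : 0 < Num.min (Num.min x (b - x)) (e / c) by rewrite !lt_min x0 divr_gt0 // subr_gt0 xb.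
exists (Num.min (Num.min x (b - x)) (e / c)) => //= y.
rewrite /ball /= !lt_min => /andP[/andP[y1 y2] y3].
have y1' := ltr_normlW y1; have y2' : y - x < b - x by apply: le_lt_trans y2;
  rewrite distrC ler_norm.
apply: (@le_lt_trans _ _ (c * `|x - y|)); last by rewrite mulrC -ltr_pdivlMr.
apply: (le_trans (H _ _ _ _)); [by lra|by lra|].
by apply: ler_wpM2r => //; rewrite /c; have := ler_norm L; lra.
Qed.

Lemma g_continuous (b L x : R) : tame M b L -> 0 < x -> x < b -> g M y @[y --> x] --> g M x.
Proof.
move=> tm x0 xb.
have xb' : 0 <= x <= b by lra.
have ca := lip_cvg x0 xb (tame_alpha_lip tm).
have /andP[ax _] := tame_alpha tm xb'.
rewrite /g; apply: cvgB.
  apply: cvgr_sum => i; apply: cvgM; first exact: cvg_cst.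
  have /andP[hx _] := tame_rate tm i xb'.
  apply: cvgV; first by rewrite exit_rateE gt_eqF //; lra.
  apply: cvgD => //; exact: (lip_cvg x0 xb (tame_rate_lip tm i)).
apply: cvgM; first exact: (lip_cvg x0 xb (tame_mu_lip tm)).
by apply: cvgV => //; rewrite gt_eqF.
Qed.

(** The positive derivative makes g negative just to the left of q^u; a nonnegative value at q would
    then produce a further zero by the intermediate value theorem. *)
Lemma g_neg_between (qs qu b L q : R) : tame M b L -> 0 < qs -> qs < q -> q < qu -> qu < b ->
  b <= qmax M ->
  (forall q : R, 0 <= q -> q < qmax M -> (g M q = 0 <-> q = qs \/ q = qu)) ->
  derivable (g M) qu 1 -> 0 < derive1 (g M) qu -> g M q < 0.
Proof.
move=> tm qs0 qsq qqu qub bq gz dg dgu.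
have gu : g M qu = 0 by apply/gz; [lra|lra|right].
have nz y : qs < y -> y < qu -> g M y <> 0.
  by move=> sy yu /gz; case; lra.
have [r r0 Hr] : exists2 r : R, 0 < r & forall s, qu - r < s -> s < qu -> g M s < 0.
  have : is_derive qu 1 (g M) (derive1 (g M) qu).
    by rewrite derive1E; exact: derivableP.
  move=> /is_derive_slope /(_ (derive1 (g M) qu / 2) ltac:(lra))[r r0 Hr].
  exists r => // s rs su.
  have := Hr s I ltac:(rewrite ltr_norml; lra).
  rewrite gu subr0 [`|s - qu|]ltr0_norm; last lra.
  set d := derive1 (g M) qu in dgu *.
  have p1 : 0 < d * (qu - s) by apply: mulr_gt0; lra.
  rewrite ler_norml => /andP[_].
  have -> : d / 2 * - (s - qu) = d * (qu - s) / 2 by lra.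
  have -> : d * (s - qu) = - (d * (qu - s)) by ring.
  lra.
rewrite ltNge; apply/negP => gq.
pose s := Num.max ((q + qu) / 2) (qu - r / 2).
have s1 : s < qu by rewrite gt_max; apply/andP; split; lra.
have s2 : (q + qu) / 2 <= s by rewrite le_max lexx.
have s3 : qu - r / 2 <= s by rewrite le_max lexx orbT.
have gs := Hr s ltac:(lra) s1.
have qs' : q <= s by lra.
have cg : {within `[q, s], continuous (g M)}.
  apply: continuous_in_subspaceT => y; rewrite inE /= in_itv /= => yy.
  by apply: (g_continuous tm); lra.
have [c] := @IVT R (g M) q s 0 qs' cg ltac:(rewrite ge_min le_max gq (ltW gs) orbT; done).
by rewrite in_itv /= => /andP[qc cs]; apply: nz; lra.
Qed.

End NegativeG.

(** * Bounds and Lipschitz estimates for the unmodified field *)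

Section FieldBounds.
Variables (R : realType) (n : nat) (M : model R n) (b L : R).
Hypothesis tm : tame M b L.
Ltac slim := clear - R n M b L tm.

Definition in_range (B : R) (x : state R n) :=
  (forall i, 0 <= x.1 0 i <= B) /\ 0 <= x.2 <= b.

Lemma field0_1E (x : state R n) i :
  (field0 M x).1 0 i = K M i - exit_rate M i x.2 * x.1 0 i.
Proof. by rewrite /= mxE exit_rateE /price_rate; ring. Qed.

Lemma tame_L_gt0 : 0 < L.
Proof. by have /andP[m0 mL] := tame_mumax tm; lra. Qed.

Lemma prod_diff_le (a a' c c' A C d : R) : `|a| <= A -> `|c'| <= C ->
  `|a' - a| <= d * A -> `|c' - c| <= d -> `|a' * c' - a * c| <= d * (A * (1 + C)).
Proof.
move=> aA c'C da dc.
have -> : a' * c' - a * c = (a' - a) * c' + a * (c' - c) by ring.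
apply: (le_trans (ler_normD _ _)); rewrite !normrM.
have -> : d * (A * (1 + C)) = d * A * C + A * d by ring.
by apply: lerD; apply: ler_pM.
Qed.

Lemma field0_bounds (B : R) : 0 <= B -> exists D : R, [/\ 0 < D,
  forall x, in_range B x -> (forall i, `|(field0 M x).1 0 i| <= D) /\ `|(field0 M x).2| <= D
  & forall x y (d : R), in_range B x -> in_range B y ->
    (forall i, `|y.1 0 i - x.1 0 i| <= d) -> `|y.2 - x.2| <= d ->
    (forall i, `|(field0 M y).1 0 i - (field0 M x).1 0 i| <= D * d) /\
    `|(field0 M y).2 - (field0 M x).2| <= D * d].
Proof.
move=> B0; have L0 := tame_L_gt0.
have LB0 : 0 <= L * B by rewrite mulr_ge0 // ltW.
have nLB : 0 <= n%:R * (L * B) by rewrite mulr_ge0.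
have nL : 0 <= n%:R * L by rewrite mulr_ge0 // ltW.
(* The sum over the R_k contributes at most n L (1 + B), all remaining terms at most 3 L (1 + B). *)
pose D := (n%:R + 3) * (L * (1 + B)).
have DE : D = n%:R * L + n%:R * (L * B) + 3 * L + 3 * (L * B) by rewrite /D; ring.
have Sb (x : state R n) : in_range B x -> 0 <= \sum_k x.1 0 k <= n%:R * B.
  move=> [xr _]; rewrite sumr_ge0 //=; last by move=> i _; case/andP: (xr i).
  rewrite -[n in n%:R]card_ord mulr_natl -sumr_const; apply: ler_sum => i _.
  by case/andP: (xr i).
exists D; split.
- by rewrite DE; lra.
- move=> x xB; have [xr xq] := xB; split.
    move=> i; rewrite field0_1E.
    have /andP[k0 kL] := tame_K tm i; have /andP[h0 hL] := tame_rate tm i xq.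
    have /andP[a0 aL] := tame_alpha tm xq; have /andP[r0 rB] := xr i.
    have p0 : 0 <= exit_rate M i x.2 * x.1 0 i by rewrite exit_rateE mulr_ge0 // addr_ge0 // ltW.
    have pB : exit_rate M i x.2 * x.1 0 i <= (2 * L) * B.
      by rewrite exit_rateE; apply: ler_pM => //; move: h0 hL a0 aL; slim; lra.
    rewrite ler_norml DE; lra.
  have /andP[s0 sB] := Sb _ xB; have /andP[a0 aL] := tame_alpha tm xq.
  have /andP[m0 mL] := tame_mu tm (proj1 (andP xq)).
  have /andP[_ mmL] := tame_mumax tm.
  have p0 : 0 <= alpha M x.2 * \sum_k x.1 0 k by rewrite mulr_ge0 // ltW.
  have pB : alpha M x.2 * \sum_k x.1 0 k <= L * (n%:R * B) by apply: ler_pM => //; exact: ltW.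
  have E : L * (n%:R * B) = n%:R * (L * B) by ring.
  rewrite /= ler_norml DE; lra.
move=> x y d xB yB dr dq; have [xr xq] := xB; have [yr yq] := yB.
have /andP[ax axL] := tame_alpha tm xq.
have d0 : 0 <= d by apply: le_trans dq; exact: normr_ge0.
have La : `|alpha M x.2| <= L by rewrite gtr0_norm.
have Lda : `|alpha M y.2 - alpha M x.2| <= d * L.
  apply: (le_trans (tame_alpha_lip tm xq yq)); rewrite mulrC.
  by apply: ler_wpM2r => //; exact: ltW.
split.
  move=> i; rewrite !field0_1E !exit_rateE.
  have /andP[h0 hL] := tame_rate tm i xq.
  have Lh : `|price_rate M i x.2| <= L by rewrite ger0_norm.
  have Ldh : `|price_rate M i y.2 - price_rate M i x.2| <= d * L.
    apply: (le_trans (tame_rate_lip tm i xq yq)); rewrite mulrC.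
    by apply: ler_wpM2r => //; exact: ltW.
  have yB' : `|y.1 0 i| <= B by rewrite ger0_norm; case/andP: (yr i).
  have := prod_diff_le La yB' Lda (dr i).
  have := prod_diff_le Lh yB' Ldh (dr i).
  set u := _ - _; set v := _ - _ => H1 H2.
  have -> : K M i - (price_rate M i y.2 + alpha M y.2) * y.1 0 i -
     (K M i - (price_rate M i x.2 + alpha M x.2) * x.1 0 i) = - (u + v) by rewrite /u /v; ring.
  rewrite normrN; apply: (le_trans (ler_normD _ _)).
  have : 0 <= (D - 2 * (L * (1 + B))) * d by apply: mulr_ge0 => //; rewrite DE;
    move: LB0 nLB nL L0; slim; lra.
  have -> : (D - 2 * (L * (1 + B))) * d = D * d - 2 * (d * (L * (1 + B))) by ring.
  move: H1 H2; slim; lra.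
have /andP[s0 sB] := Sb _ yB.
have sB' : `|\sum_k y.1 0 k| <= n%:R * B by rewrite ger0_norm.
have ds : `|\sum_k y.1 0 k - \sum_k x.1 0 k| <= n%:R * d.
  rewrite -sumrB; apply: (le_trans (ler_norm_sum _ _ _)).
  rewrite -[n in n%:R]card_ord mulr_natl -sumr_const; exact: ler_sum.
have Ldm : `|mu M y.2 - mu M x.2| <= d * L.
  apply: (le_trans (tame_mu_lip tm xq yq)); rewrite mulrC.
  by apply: ler_wpM2r => //; exact: ltW.
rewrite /=.
have -> : alpha M y.2 * \sum_k y.1 0 k - mu M y.2 - (alpha M x.2 * \sum_k x.1 0 k - mu M x.2) =
  (alpha M y.2 - alpha M x.2) * \sum_k y.1 0 k +
  alpha M x.2 * (\sum_k y.1 0 k - \sum_k x.1 0 k) - (mu M y.2 - mu M x.2) by ring.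
apply: (le_trans (ler_normB _ _)); apply: (le_trans (lerD (ler_normD _ _) Ldm)).
rewrite !normrM.
have H1 : `|alpha M y.2 - alpha M x.2| * `|\sum_k y.1 0 k| <=
  (d * L) * (n%:R * B) by apply: ler_pM.
have H2 : `|alpha M x.2| * `|\sum_k y.1 0 k - \sum_k x.1 0 k| <= L * (n%:R * d) by apply: ler_pM.
have : 0 <= (2 * L + 3 * (L * B)) * d by apply: mulr_ge0 => //; move: L0 LB0; slim; lra.
have -> : D * d = (d * L) * (n%:R * B) + L * (n%:R * d) + d * L + (2 * L +
  3 * (L * B)) * d by rewrite DE; ring.
move: H1 H2; slim; lra.
Qed.

(** Without rejection the factor S cancels against the share R_i / S. If S = 0, every R_i is 0 by
    nonnegativity and both terms vanish. *)
Lemma field_ad_free (qad : R) (x : state R n) : (forall i, 0 <= x.1 0 i) ->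
  alpha_ad M qad (\sum_k x.1 0 k) x.2 = alpha M x.2 * \sum_k x.1 0 k ->
  field_ad M qad x = field0 M x.
Proof.
move=> x0 E; rewrite /field_ad /field0 E; congr pair.
apply/rowP => i; rewrite !mxE; congr (_ - _).
have [S0|S0] := eqVneq (\sum_k x.1 0 k) 0; last by field.
have /eqP := S0; rewrite psumr_eq0; last by move=> k _; exact: x0.
by move=> /allP /(_ i (mem_index_enum _)) /eqP ->; rewrite mul0r !mulr0.
Qed.

End FieldBounds.

(** * Rejections eventually stop *)

Section Saturation.
Variables (R : realType) (n : nat) (M : model R n) (b L qad : R).
Hypothesis tm : tame M b L.
Hypotheses (n_ge1 : (1 <= n)%N) (qad0 : 0 < qad) (qadb : qad <= b).
Hypothesis mu_qad : forall q : R, qad <= q -> mu M q = mumax M.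
Hypothesis qad_min : forall i, minimal_at_right_end (exit_rate M i) qad.
Hypothesis qad_below : alpha M qad * \sum_i Rhat M qad 0 i < mumax M.
Variable x : R -> state R n.
Hypotheses (xsol : caratheodory_solution (field_ad M qad) x) (x0 : X_ad qad (x 0)).
Local Notation r i t := ((x t).1 0 i).
Local Notation q t := ((x t).2).
Local Notation leb := (@lebesgue_measure R).
Local Notation S t := (\sum_k r k t).
Ltac slim := clear - R n M b L qad tm n_ge1 qad0 qadb mu_qad qad_min qad_below x xsol x0.

Lemma alpha_qad : 0 < alpha M qad.
Proof. have qin : 0 <= qad <= b by rewrite qadb ltW.
by have /andP[] := tame_alpha tm qin. Qed.

Lemma rate_qad i : 0 <= price_rate M i qad.
Proof. have qin : 0 <= qad <= b by rewrite qadb ltW.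
by have /andP[] := tame_rate tm i qin. Qed.

Lemma Rhat_qad_gt0 i : 0 < Rhat M qad 0 i.
Proof.
rewrite mxE divr_gt0 //; first by have /andP[] := tame_K tm i.
by rewrite exit_rateE; have := alpha_qad; have := rate_qad i; lra.
Qed.

(** From [qad] on, admissions are capped by [mumax], which is the service rate there, so [qad] is a
    barrier. *)
Lemma q_le_qad t : 0 <= t -> 0 <= q t <= qad.
Proof.
move=> t0; have [xo xac xae] := xsol; have [_ ->/=] := xo t t0.
apply: (@ac_below _ (fun s => q s) 0) => //; first exact: (xac t t0).2.
  apply: ae_imp xae => s Hs /andP[s0 st] qs.
  have [_ H] := Hs s0; apply: (straddle_derive H) => /=.
  rewrite mu_qad; last exact: ltW.
  by rewrite /alpha_ad ltNge (ltW qs) /= subr_le0 ge_min lexx orbT.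
by have [_ /andP[]] := x0.
Qed.

Lemma alpha_ad_cases t : 0 <= t ->
  alpha_ad M qad (S t) (q t) = alpha M (q t) * S t \/
  [/\ q t = qad, mumax M < alpha M qad * S t & alpha_ad M qad (S t) (q t) = mumax M].
Proof.
move=> t0; have /andP[q0 qq] := q_le_qad t0; rewrite /alpha_ad.
case: ltP => h; first by left.
have -> : q t = qad by lra.
by case: (leP (alpha M qad * S t) (mumax M)) => h1; [left|right].
Qed.

(** The floor 1 + e discards the ratios close to 1, for which the decay rate would degenerate. *)
Definition ratio_max (e t : R) := \big[Num.max/1 + e]_i (r i t / Rhat M qad 0 i).

Lemma ratio_max_ac (e T : R) : 0 <= T -> absolutely_continuous 0 T (ratio_max e).
Proof.
move=> T0; have [_ /(_ T T0)[xac _] _] := xsol.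
pose C := \sum_i (Rhat M qad 0 i)^-1.
apply: (@ac_dominated _ _ (fun i t => r i t) _ 0 T C) => // u v _ _ _.
have C0 i : 0 <= (Rhat M qad 0 i)^-1 by rewrite invr_ge0 ltW // Rhat_qad_gt0.
have Ci i : (Rhat M qad 0 i)^-1 <= C.
  by rewrite /C (bigD1 i) //= lerDl; apply: sumr_ge0 => j _.
rewrite mulr_sumr.
apply: (@le_trans _ _ (\sum_i `|r i v / Rhat M qad 0 i - r i u / Rhat M qad 0 i|)).
  rewrite /ratio_max; elim: (index_enum _) => [|i s IH].
    by rewrite !big_nil subrr normr0.
  rewrite !big_cons; move: IH.
  set U := \big[_/_]_(_ <- _) _; set V := \big[_/_]_(_ <- _) _; set W := \sum_(_ <- _) _.
  have := normr_ge0 (r i v / Rhat M qad 0 i - r i u / Rhat M qad 0 i).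
  have := ler_norm (r i v / Rhat M qad 0 i - r i u / Rhat M qad 0 i).
  have := ler_norm (- (r i v / Rhat M qad 0 i - r i u / Rhat M qad 0 i)).
  rewrite normrN; set a := r i v / _; set c := r i u / _; set N := `|a - c|.
  rewrite !ler_norml => n1 n2 n3 n4.
  by case: (leP a U) ; case: (leP c V); move: n1 n2 n3 n4; slim; lra.
apply: ler_sum => i _; rewrite -mulrBl normrM mulrC.
by apply: ler_wpM2r => //; rewrite ger0_norm.
Qed.

(** Let i attain the maximum m > 1 + e. Without rejection the outflow exceeds K_i by at least e
    times the exit rate at [qad] times [Rhat]. With rejection, S <= m Sh, so the share R_i / S is at
    least its value at [Rhat]; the outflow mumax R_i / S then exceeds alpha(qad) times [Rhat] by the
    margin c1 supplied by [qad_below]. Maximality of the ratio is what makes the share comparison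
    work. *)
Lemma ratio_max_straddle (e : R) : 0 < e -> exists2 c, 0 < c &
  {ae leb, forall t, 0 < t -> 1 + e < ratio_max e t -> straddle (- c) (ratio_max e) t}.
Proof.
move=> e0; set Sh := \sum_i Rhat M qad 0 i.
have Sh0 : 0 < Sh.
  rewrite /Sh (bigD1 (Ordinal n_ge1)) //= ltr_pwDl ?Rhat_qad_gt0 //.
  by apply: sumr_ge0 => i _; exact/ltW/Rhat_qad_gt0.
have a0 := alpha_qad.
pose c1 := mumax M / Sh - alpha M qad.
have c10 : 0 < c1 by rewrite subr_gt0 ltr_pdivlMr.
exists (Num.min (e * alpha M qad) c1); first by rewrite lt_min mulr_gt0.
have [xo _ xae] := xsol.
apply: ae_imp xae => t Ht t0 Mt; have {Ht}[Hr Hq] := Ht t0.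
have [r0 q0] := xo t (ltW t0).
have qq := q_le_qad (ltW t0).
have dF i : is_derive t 1 (fun s => r i s / Rhat M qad 0 i)
   ((field_ad M qad (x t)).1 0 i / Rhat M qad 0 i).
  have -> : (fun s => r i s / Rhat M qad 0 i) = (Rhat M qad 0 i)^-1 \*: (fun s => r i s).
    by apply/funext => s; rewrite /= /GRing.scale /= mulrC.
  by apply: is_derive_eq (is_deriveZ _ (Hr i)) _; rewrite /GRing.scale /= mulrC.
apply: straddle_bigmax.
- by move=> i; exact: is_derive_cont (dF i).
- by move=> E; move: Mt; rewrite /ratio_max -E ltxx.
move=> i Fi; apply: (straddle_derive (dF i)).
set m := ratio_max e t in Mt.
have Rh0 := Rhat_qad_gt0.
have ri : r i t = m * Rhat M qad 0 i by rewrite /m /ratio_max -Fi divfK // gt_eqF.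
have rj j : r j t <= m * Rhat M qad 0 j by rewrite -ler_pdivrMr // le_bigmax_cond.
have SmS : S t <= m * Sh by rewrite mulr_sumr; apply: ler_sum => j _.
have m0 : 0 < m by lra.
have ri0 : 0 < r i t by rewrite ri mulr_gt0.
have S0 : 0 < S t.
  by rewrite (bigD1 i) //= ltr_pwDl //; apply: sumr_ge0 => j _.
have /andP[K0 _] := tame_K tm i.
have h0 : 0 < exit_rate M i qad by rewrite exit_rateE; have := rate_qad i; lra.
have KE : K M i = exit_rate M i qad * Rhat M qad 0 i.
  by rewrite mxE mulrC divfK // gt_eqF.
rewrite ler_pdivrMr //.
case: (alpha_ad_cases (ltW t0)) => [E|[qE aS E]].
  rewrite (field_ad_free r0 E) field0_1E.
  have hq := @qad_min i (q t) qq.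
  have H1 : exit_rate M i qad * r i t <= exit_rate M i (q t) * r i t.
    by apply: ler_wpM2r => //; exact: ltW.
  have H2 : Num.min (e * alpha M qad) c1 * Rhat M qad 0 i <=
    e * exit_rate M i qad * Rhat M qad 0 i.
    apply: ler_wpM2r; first exact: ltW.
    rewrite (le_trans (_ : _ <= e * alpha M qad)) ?ge_min ?lexx //.
    apply: ler_wpM2l; first exact: ltW.
    by rewrite exit_rateE; have := rate_qad i; lra.
  have H3 : 0 <= (m - 1 - e) * (exit_rate M i qad * Rhat M qad 0 i).
    by apply: mulr_ge0; [lra|rewrite mulr_ge0 // ltW].
  rewrite {2}ri in H1; rewrite {1}KE mulNr.
  have E2 : (m - 1 - e) * (exit_rate M i qad * Rhat M qad 0 i) =
    exit_rate M i qad * (m * Rhat M qad 0 i) - exit_rate M i qad * Rhat M qad 0 i - e *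
      exit_rate M i qad * Rhat M qad 0 i by ring.
  by move: H1; rewrite ri; lra.
rewrite /= mxE E qE -/(price_rate M i qad).
have H1 : mumax M / Sh * Rhat M qad 0 i <= mumax M * (r i t / S t).
  rewrite ri -mulrA; apply: ler_wpM2l; first by have /andP[/ltW] := tame_mumax tm.
  rewrite ler_pdivlMr // mulrAC; apply: ler_wpM2r; first exact: ltW.
  by rewrite mulrC ler_pdivrMr.
have H2 : price_rate M i qad * Rhat M qad 0 i <= price_rate M i qad * r i t.
  apply: ler_wpM2l; first exact: rate_qad.
  by rewrite ri ler_peMl ?(ltW (Rh0 i)) //; lra.
have H3 : Num.min (e * alpha M qad) c1 * Rhat M qad 0 i <= c1 * Rhat M qad 0 i.
  by apply: ler_wpM2r; [exact: ltW|rewrite ge_min lexx orbT].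
rewrite KE exit_rateE mulNr.
move: H3; rewrite {2}/c1.
have -> : (mumax M / Sh - alpha M qad) * Rhat M qad 0 i =
  mumax M / Sh * Rhat M qad 0 i - alpha M qad * Rhat M qad 0 i by ring.
have -> : (price_rate M i qad +
  alpha M qad) * Rhat M qad 0 i = price_rate M i qad * Rhat M qad 0 i +
  alpha M qad * Rhat M qad 0 i by ring.
lra.
Qed.

Lemma eventually_r_le (e : R) : 0 < e -> exists2 T, 0 <= T & forall t, T <= t -> forall i,
  r i t <= (1 + e) * Rhat M qad 0 i.
Proof.
move=> e0; have [c c0 H] := ratio_max_straddle e0.
have [T T0 HT] := ac_decay c0 (@ratio_max_ac e) H.
exists T => // t Tt i; rewrite -ler_pdivrMr ?Rhat_qad_gt0 //.
by apply: le_trans (HT t Tt); exact: le_bigmax_cond.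
Qed.

(** With e large enough for all initial ratios to be below 1 + e, [ratio_max] starts at its floor
    and never leaves it. *)
Lemma r_bounded : exists2 B, 0 <= B & forall t, 0 <= t -> in_range qad B (x t).
Proof.
have [xo _ _] := xsol.
pose e := \sum_i r i 0 / Rhat M qad 0 i + 1.
have F0 t i : 0 <= t -> 0 <= r i t / Rhat M qad 0 i.
  by move=> t0; rewrite divr_ge0 // ?(xo t t0).1 // ltW // Rhat_qad_gt0.
have e0 : 0 < e by rewrite ltr_wpDl // sumr_ge0 // => i _; exact: F0.
have [c c0 H] := ratio_max_straddle e0.
have bnd t : 0 <= t -> ratio_max e t <= 1 + e.
  move=> t0; apply: (@ac_below _ _ 0) => //; first exact: ratio_max_ac.
    apply: ae_imp H => s Hs /andP[s0 _] es; move=> d d0.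
    have [u u0 Hu] := Hs s0 es d d0; exists u => // v w A B C D.
    apply: (le_trans (Hu v w A B C D)); apply: ler_wpM2r; lra.
  apply/bigmax_leP; split => // i _.
  have : r i 0 / Rhat M qad 0 i <= \sum_i r i 0 / Rhat M qad 0 i.
    by rewrite (bigD1 i) //= lerDl sumr_ge0 // => j _; exact: F0.
  rewrite /e; lra.
have Rh0 := Rhat_qad_gt0.
exists (\sum_i (1 + e) * Rhat M qad 0 i).
  by apply: sumr_ge0 => i _; rewrite mulr_ge0 // ?(ltW (Rh0 i)) //; lra.
move=> t t0; split; last exact: q_le_qad.
move=> i; rewrite (xo t t0).1 /=.
apply: (@le_trans _ _ ((1 + e) * Rhat M qad 0 i)).
  rewrite -ler_pdivrMr //; apply: le_trans (bnd t t0); exact: le_bigmax_cond.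
rewrite (bigD1 i) //= lerDl; apply: sumr_ge0 => j _.
by rewrite mulr_ge0 // ?(ltW (Rh0 j)) //; lra.
Qed.

Lemma eventually_free : exists2 T : R, 0 <= T & {ae leb, forall t : R, T < t ->
  (forall i, is_derive t 1 (fun s => r i s) ((field0 M (x t)).1 0 i)) /\
  is_derive t 1 (fun s => q s) (field0 M (x t)).2}.
Proof.
set Sh := \sum_i Rhat M qad 0 i.
have Sh0 : 0 < Sh.
  rewrite /Sh (bigD1 (Ordinal n_ge1)) //= ltr_pwDl ?Rhat_qad_gt0 //.
  by apply: sumr_ge0 => i _; exact/ltW/Rhat_qad_gt0.
have a0 := alpha_qad.
(* Solves alpha(qad) (1 + e) Sh = mumax, the threshold of rejection; it is positive by
   [qad_below]. *)
pose e := mumax M / (alpha M qad * Sh) - 1.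
have aS0 : 0 < alpha M qad * Sh by rewrite mulr_gt0.
have e0 : 0 < e by rewrite subr_gt0 ltr_pdivlMr // mul1r.
have [T T0 HT] := eventually_r_le e0.
exists T => //; have [xo _ xae] := xsol.
apply: ae_imp xae => t Ht Tt; have t0 : 0 < t by lra.
rewrite -(@field_ad_free _ _ _ qad); first exact: Ht.
  exact: (xo t (ltW t0)).1.
case: (alpha_ad_cases (ltW t0)) => // -[_ aS _]; exfalso; move: aS; apply/negP; rewrite -leNgt.
have : S t <= (1 + e) * Sh by rewrite mulr_sumr; apply: ler_sum => i _; exact: HT (ltW Tt) i.
move=> /(ler_wpM2l (ltW a0)) /le_trans; apply.
rewrite /e addrCA subrr addr0 mulrCA divfK // gt_eqF //.
Qed.

End Saturation.

(** * Limits of paths along an ultrafilter *)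

Section ClusterPaths.
Variables (R : realType) (n : nat).
Implicit Types (x y : state R n).

Definition close (e : R) x y :=
  (forall i, `|x.1 0 i - y.1 0 i| <= e) /\ `|x.2 - y.2| <= e.

Lemma close_sym e x y : close e x y -> close e y x.
Proof. by move=> [A B]; split=> [i|]; rewrite distrC. Qed.

Lemma close_trans e e' x y w : close e x y -> close e' y w -> close (e + e') x w.
Proof.
move=> [A B] [A' B']; split=> [i|].
  by rewrite (le_trans (ler_distD (y.1 0 i) _ _)) // lerD.
by rewrite (le_trans (ler_distD y.2 _ _)) // lerD.
Qed.

Lemma close_le e e' x y : e <= e' -> close e x y -> close e' x y.
Proof. by move=> ee [A B]; split=> [i|]; apply: le_trans ee. Qed.

Lemma close_sum e x y : 0 <= e -> close e x y ->
  `|\sum_k x.1 0 k - \sum_k y.1 0 k| <= n%:R * e.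
Proof.
move=> e0 [A _]; rewrite -sumrB; apply: (le_trans (ler_norm_sum _ _ _)).
rewrite -[n in n%:R]card_ord mulr_natl -sumr_const; exact: ler_sum.
Qed.

Lemma close_euclidean e x y : 0 <= e -> close e x y ->
  euclidean_dist x y <= (n%:R + 1) * e.
Proof.
move=> e0 [A B]; rewrite /euclidean_dist.
have n0 : 0 <= (n%:R + 1 : R) by rewrite addr_ge0.
rewrite -[leRHS]ger0_norm ?mulr_ge0 // -sqrtr_sqr ler_sqrt ?sqr_ge0 //.
have sq (u : R) : `|u| <= e -> u ^+ 2 <= e ^+ 2.
  by move=> ue; rewrite -real_normK ?num_real // ler_pXn2r ?nnegrE.
have H1 : \sum_(i < n) (x.1 0 i - y.1 0 i) ^+ 2 <= n%:R * e ^+ 2.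
  rewrite -[n in n%:R]card_ord mulr_natl -sumr_const; apply: ler_sum => i _; exact: sq.
apply: (le_trans (lerD H1 (sq _ B))).
rewrite exprMn -[X in _ + X]mul1r -mulrDl; apply: ler_wpM2r; first exact: sqr_ge0.
rewrite expr2 ler_peMr //; have := ler0n R n; lra.
Qed.

(** The image of an ultrafilter is an ultrafilter, and on a compact segment it converges. *)
Lemma ultra_limit (U : set_system nat) (u : nat -> R) (a c : R) : UltraFilter U ->
  (\forall k \near U, a <= u k <= c) -> exists2 l, a <= l <= c & u k @[k --> U] --> l.
Proof.
move=> UU Hu.
have FU : UltraFilter (u @ U).
  split=> [|G GF uG]; first exact: fmap_proper_filter.
  rewrite predeqE => A; split; last exact: uG.
  move=> GA; have [//|nA] := in_ultra_setVsetC (u @^-1` A) UU.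
  have GnA : G (~` A) by apply: uG.
  by have /filter_ex [? []] : G (A `&` (~` A)) by exact: filterI.
have := @segment_compact R a c; rewrite compact_ultra => /(_ (u @ U) FU).
case; first by apply: filterS Hu => k; rewrite /= in_itv.
by move=> l [/= lac ul]; exists l => //; move: lac; rewrite in_itv.
Qed.

(** One ultrafilter gives limits at all times simultaneously, in place of an extraction of
    subsequences. Approximation at two times is enough, because every later estimate compares two
    instants; N allows k to be taken as large as desired. *)
Lemma cluster_path (y : nat -> R -> state R n) (B b : R -> R) :
  (forall s, exists N, forall k, (N <= k)%N -> in_range (b s) (B s) (y k s)) ->
  exists z : R -> state R n, (forall s, in_range (b s) (B s) (z s)) /\
    forall s s' e N, 0 < e ->
      exists2 k, (N <= k)%N & close e (y k s) (z s) /\ close e (y k s') (z s').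
Proof.
move=> Hy.
have [U [UU sU]] := ultraFilterLemma eventually_filter.
have Ularge N : U [set k | (N <= k)%N] by apply: sU; exists N.
have /choice[lr Hr] : forall p : R * 'I_n, exists l : R, 0 <= l <= B p.1 /\
    (y k p.1).1 0 p.2 @[k --> U] --> l.
  move=> [s i] /=; have [N HN] := Hy s.
  have [|l l0 ul] := @ultra_limit U (fun k => (y k s).1 0 i) 0 (B s) UU.
    by apply: filterS (Ularge N) => k /= /HN[H _]; exact: H.
  by exists l.
have /choice[lq Hq] : forall s : R, exists l : R, 0 <= l <= b s /\
    (y k s).2 @[k --> U] --> l.
  move=> s; have [N HN] := Hy s.
  have [|l l0 ul] := @ultra_limit U (fun k => (y k s).2) 0 (b s) UU.
    by apply: filterS (Ularge N) => k /= /HN[].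
  by exists l.
exists (fun s => (\row_i lr (s, i), lq s)); split.
  move=> s; split=> /= [i|]; last exact: (Hq s).1.
  by rewrite mxE; exact: (Hr (s, i)).1.
have Hc s e : 0 < e -> U [set k | close e (y k s) (\row_i lr (s, i), lq s)].
  move=> e0.
  have Hqs : U [set k | `|(y k s).2 - lq s| <= e].
    have /cvgrPdist_le /(_ _ e0) := (Hq s).2.
    by apply: filterS => k /=; rewrite distrC.
  have Hrs : U [set k | forall i, `|(y k s).1 0 i - lr (s, i)| <= e].
    apply: filter_forall => i.
    have /cvgrPdist_le /(_ _ e0) := (Hr (s, i)).2.
    by apply: filterS => k /=; rewrite distrC.
  apply: filterS (filterI Hqs Hrs) => k /= [A C]; split => //= i.
  by rewrite mxE.
move=> s s' e N e0.
have /filter_ex[k [/= Nk [A C]]] : U ([set k | (N <= k)%N] `&`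
    ([set k | close e (y k s) (\row_i lr (s, i), lq s)] `&`
     [set k | close e (y k s') (\row_i lr (s', i), lq s')])).
  by apply: filterI => //; apply: filterI; exact: Hc.
by exists k.
Qed.

End ClusterPaths.

(** * Increments from derivative bounds, and growth backwards in time *)

Section Increments.
Variable R : realType.
Local Notation leb := (@lebesgue_measure R).

Lemma ac_deriv_bound (h phi : R -> R) (a b c k : R) : a <= b ->
  absolutely_continuous a b h ->
  {ae leb, forall t, a < t < b -> is_derive t 1 h (phi t) /\ `|phi t - c| <= k} ->
  `|h b - h a - c * (b - a)| <= k * (b - a).
Proof.
move=> ab AC H.
have H1 : h b - h a <= (c + k) * (b - a).
  apply: ac_incr_le => //; apply: ae_imp H => t Ht /Ht[hd]; rewrite ler_norml => ?.
  by apply: (straddle_derive hd); lra.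
have H2 : (- h) b - (- h) a <= (k - c) * (b - a).
  apply: ac_incr_le => //.
    apply: (@ac_dominated _ unit (fun _ => h) _ a b 1) => // u v _ _ _.
    by rewrite big_const card_unit /= addr0 mul1r -[leLHS]/(`|- h v - - h u|) -opprD normrN.
  apply: ae_imp H => t Ht /Ht[hd]; rewrite ler_norml => ?.
  by apply: (straddle_derive (is_deriveN hd)); lra.
move: H2; rewrite -[(- h) a]/(- h a) -[(- h) b]/(- h b) => H2.
move: H1 H2.
have -> : (c + k) * (b - a) = c * (b - a) + k * (b - a) by ring.
have -> : (k - c) * (b - a) = k * (b - a) - c * (b - a) by ring.
by rewrite ler_norml; lra.
Qed.

(** Followed backwards from a value above l, h stays above l and grows at rate at least c, which
    contradicts the bound B. *)
Lemma entire_upper (h : R -> R) (l c B : R) : 0 < c ->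
  (forall a b, a <= b -> absolutely_continuous a b h) ->
  (forall t, l < h t -> straddle (- c) h t) -> (forall t, h t <= B) ->
  forall t, h t <= l.
Proof.
move=> c0 AC H hB t; rewrite leNgt; apply/negP => lt.
have all_ae (P : R -> Prop) : (forall t, P t) -> {ae leb, forall t, P t}.
  by move=> HP; apply: aeW.
have Habove a : a <= t -> l < h a.
  move=> at_; rewrite ltNge; apply/negP => hal.
  suff : h t <= l by lra.
  apply: (@ac_below _ _ a) => //; first exact: AC.
  apply: all_ae => s _ ls e e0; have [d d0 Hd] := H s ls e e0.
  exists d => // u v p1 p2 p3 p4; apply: (le_trans (Hd u v p1 p2 p3 p4)).
  by apply: ler_wpM2r; lra.
(* Far enough in the past for h a to be at least B + c. *)
pose a := t - ((B - h t) / c + 1).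
have Bh : 0 <= (B - h t) / c by rewrite divr_ge0 ?subr_ge0 // ltW.
have at_ : a <= t by rewrite /a; lra.
have : h t - h a <= - c * (t - a).
  apply: ac_incr_le => //; first exact: AC.
  by apply: all_ae => s /andP[_ st]; apply: H; apply: Habove; exact: ltW.
have -> : - c * (t - a) = - (B - h t) - c.
  by rewrite /a; field; rewrite gt_eqF.
have := hB a; lra.
Qed.

End Increments.

(** * Solutions of the unmodified system as two-time inequalities *)

Section FreeFlow.
Variables (R : realType) (n : nat) (M : model R n) (b L : R).
Hypothesis tm : tame M b L.

(** A Lipschitz bound together with a quadratic error of the Euler step from s. It is closed under
    pointwise limits, unlike the differential equation, and still determines the derivative. *)
Definition near_flow (C : R) (y : R -> state R n) (s t : R) :=
  close (C * (t - s)) (y t) (y s) /\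
  (forall i, `|(y t).1 0 i - (y s).1 0 i - (t - s) * (field0 M (y s)).1 0 i| <=
    C * (t - s) ^+ 2) /\
  `|(y t).2 - (y s).2 - (t - s) * (field0 M (y s)).2| <= C * (t - s) ^+ 2.

Lemma free_near_flow (B T : R) (y : R -> state R n) : 0 <= B ->
  (forall t, T <= t -> in_range b B (y t)) ->
  (forall s t, T <= s -> s <= t -> (forall i, absolutely_continuous s t (fun t => (y t).1 0 i)) /\
     absolutely_continuous s t (fun t => (y t).2)) ->
  {ae (@lebesgue_measure R), forall t, T < t ->
    (forall i, is_derive t 1 (fun s => (y s).1 0 i) ((field0 M (y t)).1 0 i)) /\
    is_derive t 1 (fun s => (y s).2) (field0 M (y t)).2} ->
  exists2 C, 0 < C & forall s t, T <= s -> s <= t -> near_flow C y s t.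
Proof.
move=> B0 yB yAC yd.
have [D [D0 Db Dl]] := field0_bounds tm B0.
have lip s t : T <= s -> s <= t -> close (D * (t - s)) (y t) (y s).
  move=> Ts st; have [AC1 AC2] := yAC s t Ts st; split.
    move=> i; have := @ac_deriv_bound R (fun t => (y t).1 0 i) (fun t => (field0 M (y t)).1 0
      i) s t 0 D st (AC1 i).
    rewrite mul0r subr0; apply; apply: ae_imp yd => r Hr /andP[sr rt].
    have [|H _] := Hr; first lra.
    by split => //; rewrite subr0; apply: (Db _ _).1; apply: yB; lra.
  have := @ac_deriv_bound R (fun t => (y t).2) (fun t => (field0 M (y t)).2) s t 0 D st AC2.
  rewrite mul0r subr0; apply; apply: ae_imp yd => r Hr /andP[sr rt].
  have [|_ H] := Hr; first lra.
  by split => //; rewrite subr0; apply: (Db _ _).2; apply: yB; lra.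
exists (D + D * D); first by rewrite addr_gt0 // mulr_gt0.
move=> s t Ts st; have [AC1 AC2] := yAC s t Ts st.
have ts0 : 0 <= t - s by lra.
have DD0 : 0 <= D * D by rewrite mulr_ge0 // ltW.
have mono r : s < r -> r < t -> close (D * (t - s)) (y r) (y s).
  move=> sr rt; apply: close_le (lip _ _ Ts (ltW sr)).
  by apply: ler_wpM2l; [exact: ltW|lra].
have C2 : D * (D * (t - s)) * (t - s) <= (D + D * D) * (t - s) ^+ 2.
  have -> : D * (D * (t - s)) * (t - s) = D * D * (t - s) ^+ 2 by ring.
  apply: ler_wpM2r; first exact: sqr_ge0.
  by rewrite lerDr ltW.
split; first by apply: close_le (lip s t Ts st); apply: ler_wpM2r => //; lra.
split.
  move=> i; apply: le_trans C2; rewrite [(t - s) * _]mulrC.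
  apply: (@ac_deriv_bound R (fun t => (y t).1 0 i) (fun t => (field0 M (y t)).1 0 i)) => //.
  apply: ae_imp yd => r Hr /andP[sr rt].
  have [|H _] := Hr; first lra.
  split => //; have [A C] := mono r sr rt.
  by apply: (Dl _ _ _ (yB s Ts) (yB r _) A C).1; lra.
apply: le_trans C2; rewrite [(t - s) * _]mulrC.
apply: (@ac_deriv_bound R (fun t => (y t).2) (fun t => (field0 M (y t)).2)) => //.
apply: ae_imp yd => r Hr /andP[sr rt].
have [|_ H] := Hr; first lra.
split => //; have [A C] := mono r sr rt.
by apply: (Dl _ _ _ (yB s Ts) (yB r _) A C).2; lra.
Qed.

Lemma quadratic_slope (h : R -> R) (t d C : R) (D : set R) : 0 < C ->
  (forall s, D s -> `|h s - h t - d * (s - t)| <= C * (s - t) ^+ 2) -> slope D h t d.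
Proof.
move=> C0 H e e0; exists (e / C); first by rewrite divr_gt0.
move=> s Ds; rewrite ltr_pdivlMr // => st.
apply: (le_trans (H s Ds)); rewrite -real_normK ?num_real // expr2 mulrA.
by apply: ler_wpM2r => //; rewrite mulrC ltW.
Qed.

(** For s before t the Euler step is based at s; the Lipschitz bound of the field moves its base to
    t at quadratic cost, which yields the two-sided derivative. *)
Lemma near_flow_slope (B C : R) (z : R -> state R n) (D : set R) : 0 <= B -> 0 < C ->
  (forall t, D t -> in_range b B (z t)) ->
  (forall s t, D s -> D t -> s <= t -> near_flow C z s t) ->
  forall t, D t ->
    (forall i, slope D (fun s => (z s).1 0 i) t ((field0 M (z t)).1 0 i)) /\
    slope D (fun s => (z s).2) t (field0 M (z t)).2.
Proof.
move=> B0 C0 zB zf t Dt.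
have [E [E0 _ El]] := field0_bounds tm B0.
have CE0 : 0 < C + E * C by rewrite addr_gt0 // mulr_gt0.
have main (h F : R -> R) : (forall s s', D s -> D s' -> s <= s' ->
     `|h s' - h s - (s' - s) * F s| <= C * (s' - s) ^+ 2 /\ `|F s' - F s| <=
       E * (C * (s' - s))) ->
   slope D h t (F t).
  move=> H; apply: (quadratic_slope CE0) => s Ds.
  have [ts|st] := leP t s.
    have [H1 _] := H t s Dt Ds ts; rewrite [F t * _]mulrC; apply: (le_trans H1).
    apply: ler_wpM2r; first exact: sqr_ge0.
    by rewrite lerDl mulr_ge0 // ltW.
  have [H1 H2] := H s t Ds Dt (ltW st).
  have -> : h s - h t - F t * (s - t) = - (h t - h s - (t - s) * F s) +
    (t - s) * (F t - F s) by ring.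
  apply: (le_trans (ler_normD _ _)); rewrite normrN normrM [`|t - s|]gtr0_norm ?subr_gt0 //.
  have := ler_wpM2l (_ : 0 <= t - s) H2; rewrite subr_ge0 (ltW st) => /(_ isT).
  have -> : (C + E * C) * (s - t) ^+ 2 = C * (t - s) ^+ 2 + (t - s) * (E * (C * (t - s))) by ring.
  lra.
split.
  move=> i; apply: (main _ (fun s => (field0 M (z s)).1 0 i)) => s s' Ds Ds' ss'.
  have [cl [H1 _]] := zf s s' Ds Ds' ss'.
  by split => //; apply: (El _ _ _ (zB s Ds) (zB s' Ds') cl.1 cl.2).1.
apply: (main _ (fun s => (field0 M (z s)).2)) => s s' Ds Ds' ss'.
have [cl [_ H1]] := zf s s' Ds Ds' ss'.
by split => //; apply: (El _ _ _ (zB s Ds) (zB s' Ds') cl.1 cl.2).2.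
Qed.

(** Each inequality holds for z up to (2 + (t - s) D) e, with e arbitrary; D accounts for the change
    of the field at the base point. *)
Lemma near_flow_limit (B C s t : R) (z : R -> state R n) : 0 <= B ->
  s <= t ->
  (forall e, 0 < e -> exists2 y : R -> state R n, in_range b B (y s) /\ near_flow C y s t &
     close e (y s) (z s) /\ close e (y t) (z t)) ->
  in_range b B (z s) -> near_flow C z s t.
Proof.
move=> B0 st H zB.
have [D [D0 _ Dl]] := field0_bounds tm B0.
have ts0 : 0 <= t - s by lra.
have c0 : 0 < 2 + (t - s) * D by rewrite ltr_pwDl // mulr_ge0 // ltW.
have small (u v : R) : (forall e, 0 < e -> u <= v + (2 + (t - s) * D) * e) -> u <= v.
  move=> Huv; apply/ler_addgt0Pr => d d0.
  have := Huv (d / (2 + (t - s) * D)) ltac:(rewrite divr_gt0; done).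
  by rewrite mulrCA divff ?mulr1 // gt_eqF.
have term (a a' c c' E e0 : R) : `|a - a'| <= e0 -> `|c - c'| <= e0 -> `|a - c| <= E -> 0 <= e0 ->
    `|a' - c'| <= E + (2 + (t - s) * D) * e0.
  move=> H1 H2 H3 e00.
  have -> : a' - c' = (a - c) - (a - a') + (c - c') by ring.
  apply: (le_trans (ler_normD _ _)); apply: (le_trans (lerD (ler_normB _ _) H2)).
  have := mulr_ge0 (mulr_ge0 ts0 (ltW D0)) e00.
  have -> : (2 + (t - s) * D) * e0 = 2 * e0 + (t - s) * D * e0 by ring.
  lra.
have term2 (a a' c c' F F' E e0 : R) : `|a - a'| <= e0 -> `|c - c'| <= e0 ->
    `|F' - F| <= D * e0 -> `|a - c - (t - s) * F| <= E ->
    `|a' - c' - (t - s) * F'| <= E + (2 + (t - s) * D) * e0.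
  move=> H1 H2 H3 H4.
  have -> : a' - c' - (t - s) * F' = (a - c - (t - s) * F) - (a - a') +
    (c - c') - (t - s) * (F' - F) by ring.
  apply: (le_trans (ler_normB _ _)).
  rewrite normrM (ger0_norm ts0).
  have H5 := ler_wpM2l ts0 H3.
  have := lerD (le_trans (ler_normD _ _) (lerD (le_trans (ler_normB _ _) (lerD H4 H1)) H2)) H5.
  have -> : (2 + (t - s) * D) * e0 = 2 * e0 + (t - s) * (D * e0) by ring.
  lra.
split; [split|split].
- move=> i; apply: small => e1 e10; have [w [_ [[H1 _] _]] [[A _] [A' _]]] := H e1 e10.
  by apply: (term ((w t).1 0 i) _ ((w s).1 0 i)) => //; exact: ltW.
- apply: small => e1 e10; have [w [_ [[_ H1] _]] [[_ A] [_ A']]] := H e1 e10.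
  by apply: (term (w t).2 _ (w s).2) => //; exact: ltW.
- move=> i; apply: small => e1 e10; have [w [wB [_ [H1 _]]] [A A']] := H e1 e10.
  have [A1 A2] := close_sym A.
  apply: (term2 ((w t).1 0 i) _ ((w s).1 0 i) _ _ _ _ _ _ _ _ (H1 i)); [exact: A'.1|exact: A.1|].
  exact: (Dl _ _ _ wB zB A1 A2).1.
- apply: small => e1 e10; have [w [wB [_ [_ H1]]] [A A']] := H e1 e10.
  have [A1 A2] := close_sym A.
  apply: (term2 (w t).2 _ (w s).2 _ _ _ _ _ _ _ _ H1); [exact: A'.2|exact: A.2|].
  exact: (Dl _ _ _ wB zB A1 A2).2.
Qed.

End FreeFlow.

(** * Entire solutions and the core *)

Section EntireSolutions.
Variables (R : realType) (n : nat) (M : model R n) (b L qsat qdag qad : R).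
Hypothesis tm : tame M b L.
Hypotheses (qsat0 : 0 <= qsat) (qsatd : qsat < qdag) (qdad : qdag <= qad) (qadb : qad <= b).
Hypothesis mu_sat_ge : forall q : R, qsat <= q -> mu M q = mumax M.
Hypothesis rate_min : forall q : R, qdag <= q <= qad ->
  forall i, minimal_at_right_end (exit_rate M i) q.
Hypothesis below : forall q : R, qdag <= q <= qad ->
  alpha M q * \sum_i Rhat M q 0 i < mumax M.
Variables (z : R -> state R n) (B C : R).
Hypotheses (B0 : 0 <= B) (C0 : 0 < C).
Hypothesis zB : forall t, in_range qad B (z t).
Hypothesis zflow : forall s t, s <= t -> near_flow M C z s t.
Ltac slim := clear - R n M b L qsat qdag qad tm qsat0 qsatd qdad qadb mu_sat_ge rate_min below
  z B C B0 C0 zB zflow.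

Lemma entire_derive (t : R) :
  (forall i, is_derive t 1 (fun s => (z s).1 0 i) ((field0 M (z t)).1 0 i)) /\
  is_derive t 1 (fun s => (z s).2) (field0 M (z t)).2.
Proof.
have [||H1 H2] := @near_flow_slope R n M b L tm B C z setT B0 C0 _ _ t I.
- by move=> s _; have [A /andP[q0 q1]] := zB s; split=> //; rewrite q0 (le_trans q1).
- by move=> s s' _ _; exact: zflow.
by split=> [i|]; apply/is_derive_slope.
Qed.

Lemma entire_ac s t : s <= t -> (forall i, absolutely_continuous s t (fun t => (z t).1 0 i)) /\
  absolutely_continuous s t (fun t => (z t).2).
Proof.
move=> st; split=> [i|]; apply: (@lipschitz_ac _ _ _ _ C) => u v _ uv _.
  exact: (zflow uv).1.1.
exact: (zflow uv).1.2.
Qed.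

Lemma Rhat_ge0 q i : 0 <= q <= b -> 0 < exit_rate M i q /\ K M i = exit_rate M i q * Rhat M q 0 i.
Proof.
move=> qb; have /andP[a0 _] := tame_alpha tm qb; have /andP[h0 _] := tame_rate tm i qb.
have e0 : 0 < exit_rate M i q by rewrite exit_rateE; lra.
by split => //; rewrite mxE mulrC divfK // gt_eqF.
Qed.

(** By minimality of the exit rate at q, any R_i above its bound by d decreases at rate at least d
    times that exit rate, so [entire_upper] applies. *)
Lemma entire_r_le q : qdag <= q <= qad -> (forall t, (z t).2 <= q) ->
  forall t i, (z t).1 0 i <= Rhat M q 0 i.
Proof.
move=> /andP[qd qa] zq t i; apply/ler_addgt0Pr => d d0.
have h1 := qsat0; have h2 := qsatd; have h3 := qdad; have h4 := qadb.
have qb : 0 <= q <= b by lra.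
have [e0 KE] := Rhat_ge0 i qb.
apply: (@entire_upper R (fun t => (z t).1 0 i) _ (exit_rate M i q * d) B).
- by rewrite mulr_gt0.
- by move=> u v uv; exact: (entire_ac uv).1.
- move=> s zs; have [/(_ i) zd _] := entire_derive s.
  apply: (straddle_derive zd); rewrite field0_1E KE.
  have [r0 /andP[q0 _]] := zB s.
  have H := @rate_min q ltac:(rewrite qd qa; done) i (z s).2 ltac:(rewrite q0 zq; done).
  have H1 := ler_wpM2r (_ : 0 <= (z s).1 0 i) H.
  have {H1} : exit_rate M i q * (z s).1 0 i <= exit_rate M i (z s).2 * (z s).1 0 i.
    by apply: H1; case/andP: (r0 i).
  have : exit_rate M i q * (Rhat M q 0 i + d) <= exit_rate M i q * (z s).1 0 i.
    by rewrite ler_pM2l // ltW.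
  rewrite mulrDr; lra.
- by move=> s; have [/(_ i)/andP[]] := zB s.
Qed.

Lemma entire_q_lt t : (z t).2 <= qdag.
Proof.
rewrite leNgt; apply/negP => dt.
pose A := [set y | exists s, y = (z s).2].
have Aub : ubound A qad by move=> _ [s ->]; have [_ /andP[]] := zB s.
have hsA : has_sup A by split; [exists (z t).2; exists t|exists qad].
pose q := sup A.
have zq s : (z s).2 <= q by apply: ub_le_sup; [exists qad|exists s].
have qa : q <= qad by apply: ge_sup => //; exists (z t).2; exists t.
have qd : qdag <= q by apply: le_trans (zq t); exact: ltW.
have qin : qdag <= q <= qad by rewrite qd qa.
have rle := entire_r_le qin zq.
have L0 := tame_L_gt0 tm.
have h1 := qsat0; have h2 := qsatd; have h3 := qdad; have h4 := qadb.
have qb : 0 <= q <= b by lra.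
set Sh := \sum_i Rhat M q 0 i.
have gap := below qin; rewrite -/Sh in gap.
have Sh0 : 0 <= Sh.
  apply: sumr_ge0 => i _; have [r0 _] := zB t; have /andP[+ _] := r0 i.
  by move=> /le_trans; apply; exact: rle.
pose c := (mumax M - alpha M q * Sh) / 2.
have c0 : 0 < c by rewrite /c; lra.
pose LS := L * (Sh + 1).
have LS0 : 0 < LS by rewrite mulr_gt0 //; lra.
(* Within e below the supremum q, mu is saturated and alpha is at most alpha(q) + L e, so the queue
   decreases at rate at least c. [entire_upper] then puts the whole path under q - e, against the
   choice of q. *)
pose e := Num.min (q - qsat) (c / LS).
have e0 : 0 < e by rewrite lt_min divr_gt0 // andbT; lra.
have eq : e <= q - qsat by rewrite ge_min lexx.
have ec : LS * e <= c by rewrite -ler_pdivlMl // [_^-1 * _]mulrC ge_min lexx orbT.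
have [y [s ->] ys] := sup_adherent e0 hsA; rewrite -/q in ys.
suff : (z s).2 <= q - e by lra.
apply: (@entire_upper R (fun t => (z t).2) _ c qad) => //.
- by move=> u v uv; exact: (entire_ac uv).2.
- move=> u zu; have [_ zd] := entire_derive u.
  apply: (straddle_derive zd) => /=; rewrite mu_sat_ge; last lra.
  have [r0 /andP[q0 _]] := zB u.
  have SS : \sum_k (z u).1 0 k <= Sh by apply: ler_sum => k _; exact: rle.
  have S0 : 0 <= \sum_k (z u).1 0 k by apply: sumr_ge0 => k _; case/andP: (r0 k).
  have qu : 0 <= (z u).2 <= b by have := zq u; move: q0 qa h4; slim; lra.
  have /andP[a0 _] := tame_alpha tm qu.
  have := tame_alpha_lip tm qb qu; rewrite ler_norml => /andP[_ H1].
  have H2 : `|(z u).2 - q| <= e by rewrite ler_norml; have := zq u; move: zu e0; slim; lra.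
  have H3 := ler_wpM2l (ltW L0) H2.
  have H4 : alpha M (z u).2 <= alpha M q + L * e by move: H1 H3; slim; lra.
  have H5 : alpha M (z u).2 * \sum_k (z u).1 0 k <= (alpha M q + L * e) * Sh.
    by apply: ler_pM => //; exact: ltW.
  have H6 : L * e * Sh <= LS * e.
    have -> : LS * e = L * e * Sh + L * e by rewrite /LS; ring.
    by rewrite lerDl mulr_ge0 // ltW.
  have E1 : (alpha M q + L * e) * Sh = alpha M q * Sh + L * e * Sh by ring.
  have E2 : 2 * c = mumax M - alpha M q * Sh by rewrite /c; slim; lra.
  move: H5 H6 E1 E2 ec; slim; lra.
- by move=> u; have [_ /andP[]] := zB u.
Qed.

Lemma entire_in_box t : box M qdag (z t).
Proof.
have [r0 /andP[q0 _]] := zB t; split; first by rewrite q0 entire_q_lt.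
move=> i; have /andP[-> _] := r0 i; rewrite /=.
by apply: entire_r_le; [rewrite lexx qdad|exact: entire_q_lt].
Qed.

(** For each s, the path shifted by t - s is a solution starting in the box and reaching [z t] at
    time s; it starts in the box for every s because the entire path lies there. *)
Lemma entire_in_core t : core M qdag (z t).
Proof.
move=> s /= s0; exists (fun u => z (t - s + u)); split.
- move=> u u0; have [r0 /andP[q0 _]] := zB (t - s + u).
  split; first by split => // i; case/andP: (r0 i).
    move=> i; apply/has_derivative_ge0_slope; apply: (@slope_subset _ setT) => //.
    have /is_derive_slope H := (entire_derive (t - s + u)).1 i.
    move=> e e0; have [d d0 Hd] := H e e0; exists d => // v _ vu.
    have E : v - u = (t - s + v) - (t - s + u) by ring.
    by rewrite E; apply: Hd => //; rewrite -E.
  apply/has_derivative_ge0_slope; apply: (@slope_subset _ setT) => //.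
  have /is_derive_slope H := (entire_derive (t - s + u)).2.
  move=> e e0; have [d d0 Hd] := H e e0; exists d => // v _ vu.
  have E : v - u = (t - s + v) - (t - s + u) by ring.
  by rewrite E; apply: Hd => //; rewrite -E.
- exact: entire_in_box.
- by rewrite subrK.
Qed.

End EntireSolutions.

(** * Convergence to the core *)

Section Attraction.
Variables (R : realType) (n : nat) (M : model R n) (b L qsat qdag qad : R).
Hypothesis tm : tame M b L.
Hypothesis n_ge1 : (1 <= n)%N.
Hypotheses (qsat0 : 0 <= qsat) (qsatd : qsat < qdag) (qdad : qdag <= qad) (qadb : qad <= b).
Hypothesis mu_sat_ge : forall q : R, qsat <= q -> mu M q = mumax M.
Hypothesis rate_min : forall q : R, qdag <= q <= qad ->
  forall i, minimal_at_right_end (exit_rate M i) q.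
Hypothesis below : forall q : R, qdag <= q <= qad ->
  alpha M q * \sum_i Rhat M q 0 i < mumax M.
Variable x : R -> state R n.
Hypotheses (xsol : caratheodory_solution (field_ad M qad) x) (x0 : X_ad qad (x 0)).

Lemma dist_to_core_cvg : dist_to_set (x t) (core M qdag) @[t --> +oo] --> 0%E.
Proof.
have h1 := qsat0; have h2 := qsatd; have h3 := qdad; have h4 := qadb.
have qad0 : 0 < qad by lra.
have qadin : qdag <= qad <= qad by rewrite qdad lexx.
have mu_qad q : qad <= q -> mu M q = mumax M by move=> ?; apply: mu_sat_ge; lra.
have [B B0 xB] := r_bounded tm n_ge1 qad0 qadb mu_qad (rate_min qadin) (below qadin) xsol x0.
have [T T0 xfree] := eventually_free tm n_ge1 qad0 qadb mu_qad (rate_min qadin) (below qadin)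
  xsol x0.
have [_ xac _] := xsol.
have xBb t : 0 <= t -> in_range b B (x t).
  by move=> /xB[A /andP[q0 q1]]; split=> //; rewrite q0 (le_trans q1).
have [C C0 xC] : exists2 C, 0 < C & forall s t, T <= s -> s <= t -> near_flow M C x s t.
  apply: (free_near_flow tm B0 _ _ xfree).
    by move=> t Tt; apply: xBb; lra.
  move=> s t Ts st; have t0 : 0 <= t by lra.
  have [A1 A2] := xac t t0.
  have s0 : 0 <= s by lra.
  by split=> [i|]; [apply: ac_sub (A1 i)|apply: ac_sub A2].
(* Otherwise x stays farther than e from the core at times tk >= k. The paths shifted by tk cluster
   at an entire solution z, and the core point z 0 is close to some x (tk). *)
have key e : 0 < e -> exists T1, forall t, T1 <= t -> (dist_to_set (x t) (core M qdag) <= e%:E)%E.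
  move=> e0; apply: contrapT => H.
  have /choice[tk Htk] : forall k : nat, exists t, k%:R <=
    t /\ (e%:E < dist_to_set (x t) (core M qdag))%E.
    move=> k; apply: contrapT => Hk; apply: H; exists k%:R => t kt.
    by rewrite leNgt; apply/negP => et; apply: Hk; exists t.
  (* Since s may be negative, the shifted path is in its free regime at s only for large k. *)
  have large (s : R) : exists N : nat, forall k, (N <= k)%N -> T <= tk k + s.
    have [N HN] : exists N : nat, T - s <= N%:R.
      exists (Num.truncn `|T - s|).+1.
      by rewrite (le_trans (ler_norm _)) // ltW // truncnS_gt.
    exists N => k Nk; have [kt _] := Htk k.
    have : (N%:R <= k%:R :> R) by rewrite ler_nat.
    lra.
  have [s|z [zB zcl]] := @cluster_path R n (fun k s => x (tk k + s)) (fun=> B) (fun=> qad).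
    have [N HN] := large s; exists N => k /HN Hk; apply: xB; lra.
  have zflow s t : s <= t -> near_flow M C z s t.
    move=> st; apply: (near_flow_limit tm B0 st); last first.
      by have [A /andP[q0 q1]] := zB s; split=> //; rewrite q0 (le_trans q1).
    move=> d d0; have [N HN] := large s; have [k Nk [c1 c2]] := zcl s t d N d0.
    have Tk := HN k Nk.
    exists (fun s => x (tk k + s)); last by split.
    split; first by apply: xBb; lra.
    have := xC (tk k + s) (tk k + t) Tk ltac:(lra).
    by rewrite /near_flow (_ : tk k + t - (tk k + s) = t - s) //; ring.
  have zcore := entire_in_core tm qsat0 qsatd qdad qadb mu_sat_ge rate_min below B0 C0 zB zflow 0.
  pose d := e / (n%:R + 1).
  have n0 : 0 < (n%:R + 1 : R) by rewrite ltr_wpDl.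
  have d0 : 0 < d by rewrite divr_gt0.
  have [k _ [c1 _]] := zcl 0 0 d 0%N d0.
  rewrite addr0 in c1; have [_] := Htk k; apply/negP; rewrite -leNgt.
  apply: (@le_trans _ _ (euclidean_dist (x (tk k)) (z 0))%:E).
    by apply: ereal_inf_lbound; exists (z 0).
  rewrite lee_fin; apply: (le_trans (close_euclidean (ltW d0) c1)).
  by rewrite /d mulrC divfK // gt_eqF.
have dge0 t : (0 <= dist_to_set (x t) (core M qdag))%E.
  by apply: le_ereal_inf_tmp => _ [y _ <-]; rewrite lee_fin sqrtr_ge0.
(* The distance is extended-real valued; the case e = 1 shows that it is eventually finite. *)
apply/fine_cvgP; split.
  have [T1 H1] := key 1 ltr01; exists T1; split; first exact: num_real.
  move=> t T1t; rewrite ge0_fin_numE //.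
  by apply: (le_lt_trans (H1 t (ltW T1t))); rewrite ltry.
apply/cvgrPdist_le => e e0; have [T1 H1] := key e e0; exists T1; split; first exact: num_real.
move=> t T1t; have H := H1 t (ltW T1t).
have fd : dist_to_set (x t) (core M qdag) \is a fin_num.
  by rewrite ge0_fin_numE //; apply: (le_lt_trans H); rewrite ltry.
rewrite sub0r normrN /= ger0_norm ?fine_ge0 //.
by rewrite -lee_fin fineK.
Qed.

End Attraction.

(** * Existence of solutions *)

Section EulerScheme.
Variables (R : realType) (n : nat) (M : model R n) (b L qsat qad : R).
Hypothesis tm : tame M b L.
Hypotheses (qsat0 : 0 <= qsat) (qsata : qsat < qad) (qadb : qad <= b).
Hypothesis mu_sat_ge : forall q : R, qsat <= q -> mu M q = mumax M.
Implicit Types (x w : state R n) (h : R).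
Local Notation Sm x := (\sum_k x.1 0 k).
Ltac slim := clear - R n M b L qsat qad tm qsat0 qsata qadb mu_sat_ge.

Definition euler_next h x : R := Num.min (x.2 + h * (alpha M x.2 * Sm x - mu M x.2)) qad.

(** The rate A for which the truncated step equals q + h (A - mu): truncation of q becomes rejection
    of requests. *)
Definition euler_admission h x : R := (euler_next h x - x.2) / h + mu M x.2.

Definition euler_step h x : state R n :=
  (\row_i (x.1 0 i + h * (K M i - price_rate M i x.2 * x.1 0 i
                          - euler_admission h x * (x.1 0 i / Sm x))),
   euler_next h x).

Lemma sum_r_bounds (B : R) x : 0 <= B -> in_range qad B x -> 0 <= Sm x <= n%:R * B.
Proof.
move=> B0 [xr _]; rewrite sumr_ge0 //=; last by move=> i _; case/andP: (xr i).
rewrite -[n in n%:R]card_ord mulr_natl -sumr_const; apply: ler_sum => i _.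
by case/andP: (xr i).
Qed.

Lemma euler_admission_bounds h x : 0 < h -> X_ad qad x ->
  0 <= euler_admission h x <= alpha M x.2 * Sm x.
Proof.
move=> h0 [r0 /andP[q0 qq]].
have qb : 0 <= x.2 <= b by rewrite q0 (le_trans qq).
have /andP[a0 _] := tame_alpha tm qb.
have /andP[m0 _] := tame_mu tm q0.
have S0 : 0 <= Sm x by apply: sumr_ge0 => i _.
have aS0 := mulr_ge0 (ltW a0) S0.
have E u : h * ((u - x.2) / h + mu M x.2) = u - x.2 + h * mu M x.2.
  by field; rewrite gt_eqF.
have p1 := mulr_ge0 (ltW h0) m0; have p2 := mulr_ge0 (ltW h0) aS0.
apply/andP; split; [rewrite -(pmulr_rge0 _ h0)|rewrite -(ler_pM2l h0)];
  rewrite /euler_admission E /euler_next mulrBr;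
  by case: (leP (x.2 + (h * (alpha M x.2 * Sm x) - h * mu M x.2)) qad) => ?; lra.
Qed.

(** Bounds the outflow A R_i / S by c R_i uniformly, including S = 0, where the quotient is read as
    0. *)
Lemma share_bounds x i : (forall k, 0 <= x.1 0 k) -> 0 <= x.1 0 i / Sm x /\
  forall A c : R, 0 <= A <= c * Sm x -> A * (x.1 0 i / Sm x) <= c * x.1 0 i.
Proof.
move=> r0; have S0 : 0 <= Sm x by apply: sumr_ge0.
split; first by rewrite divr_ge0.
move=> A c /andP[A0 Ac].
have [SE|SN] := eqVneq (Sm x) 0.
  have : Sm x == 0 by rewrite SE.
  rewrite psumr_eq0 // => /allP /(_ i (mem_index_enum _)) /eqP ->.
  by rewrite mul0r !mulr0.
have Sp : 0 < Sm x by rewrite lt_neqAle eq_sym SN.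
rewrite mulrA ler_pdivrMr // mulrAC.
by apply: ler_wpM2r.
Qed.

(** The outflow of R_i is at most 2 L R_i and the service rate at most L q, because mu(0) = 0; hence
    steps with 2 L h <= 1 preserve nonnegativity. *)
Lemma euler_step_X_ad h x : 0 < h -> h * (2 * L) <= 1 -> X_ad qad x ->
  X_ad qad (euler_step h x) /\ forall i, (euler_step h x).1 0 i <= x.1 0 i + h * L.
Proof.
move=> h0 hL xX; have := euler_admission_bounds h0 xX => /andP[A0 AS].
have [r0 /andP[q0 qq]] := xX.
have qb : 0 <= x.2 <= b by rewrite q0 (le_trans qq).
have L0 := tame_L_gt0 tm.
have h1 := qsat0; have h2 := qsata.
have rate i : 0 <= price_rate M i x.2 * x.1 0 i + euler_admission h x * (x.1 0 i / Sm x)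
    <= 2 * L * x.1 0 i.
  have [s0 sA] := share_bounds i r0.
  have /andP[H0 HL] := tame_rate tm i qb.
  have /andP[a0 aL] := tame_alpha tm qb.
  apply/andP; split; first by apply: addr_ge0; apply: mulr_ge0.
  have := sA (euler_admission h x) (alpha M x.2) ltac:(rewrite A0 AS; done).
  have := ler_wpM2r (r0 i) HL; have := ler_wpM2r (r0 i) aL.
  have -> : 2 * L * x.1 0 i = L * x.1 0 i + L * x.1 0 i by ring.
  lra.
split; first split.
- move=> i /=; rewrite mxE.
  have /andP[_ R1] := rate i; have /andP[K0 _] := tame_K tm i.
  have := ler_wpM2l (ltW h0) R1; have := ler_wpM2r (r0 i) hL.
  have -> : h * (2 * L) * x.1 0 i = h * (2 * L * x.1 0 i) by ring.
  have p := mulr_gt0 h0 K0.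
  have -> : h * (K M i - price_rate M i x.2 * x.1 0 i - euler_admission h x * (x.1 0 i / Sm x)) =
    h * K M i - h * (price_rate M i x.2 * x.1 0 i +
      euler_admission h x * (x.1 0 i / Sm x)) by ring.
  lra.
- rewrite /= /euler_next ge_min lexx orbT andbT le_min; apply/andP; split; last lra.
  have S0 : 0 <= Sm x by apply: sumr_ge0.
  have /andP[a0 _] := tame_alpha tm qb.
  have p := mulr_ge0 (ltW h0) (mulr_ge0 (ltW a0) S0).
  have q00 : 0 <= (0:R) <= b by rewrite lexx /= (le_trans q0) // (le_trans qq).
  have := tame_mu_lip tm q00 qb; rewrite (tame_mu0 tm) !subr0 (ger0_norm q0) => m1.
  have /andP[m0 _] := tame_mu tm q0; rewrite ger0_norm // in m1.
  have := ler_wpM2l (ltW h0) m1; have := ler_wpM2r q0 hL.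
  have -> : h * (2 * L) * x.2 = h * (L * x.2) + h * (L * x.2) by ring.
  have p3 := mulr_ge0 (ltW h0) (mulr_ge0 (ltW L0) q0).
  rewrite mulrBr; lra.
- move=> i /=; rewrite mxE lerD2l ler_pM2l //.
  have /andP[R0 _] := rate i; have /andP[_ KL] := tame_K tm i.
  lra.
Qed.

(* One Euler step, compared with the vector field frozen at a state w within d
   of x.  The combination (sum w_k) R_i + w_i q removes the admission rate. *)
Definition step_estimate (B C : R) h x :=
  close (h * C) (euler_step h x) x /\
  forall w d, in_range qad B w -> close d x w ->
    (forall i, `|(Sm w * (euler_step h x).1 0 i + w.1 0 i * (euler_step h x).2)
       - (Sm w * x.1 0 i + w.1 0 i * x.2)
       - h * (Sm w * (K M i - price_rate M i w.2 * w.1 0 i) - w.1 0 i * mu M w.2)|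
        <= h * (C * d)) /\
    (x.2 + h * (alpha M x.2 * Sm x - mu M x.2) <= qad ->
      (forall i, `|(euler_step h x).1 0 i - x.1 0 i - h * (field0 M w).1 0 i| <= h * (C * d)) /\
      `|(euler_step h x).2 - x.2 - h * (field0 M w).2| <= h * (C * d)).

Lemma euler_step_lin (B : R) : 0 <= B -> exists2 C, 0 < C & forall h x, 0 < h ->
  in_range qad B x -> step_estimate B C h x.
Proof.
move=> B0; have [D [D0 Db Dl]] := field0_bounds tm B0.
have L0 := tame_L_gt0 tm.
have nn : 0 <= n%:R :> R by [].
have LB := mulr_ge0 (ltW L0) B0.
have nLB := mulr_ge0 nn LB.
have nLBB := mulr_ge0 nLB B0.
(* C1 serves for the combination free of the admission rate, one summand for each of [Z1], [Z2],
   [Z3]; C2 bounds the length of a step, and D the change of the unmodified field. *)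
pose C1 := n%:R * B * (L * (1 + B)) + B * L + 2 * (n%:R * (L * B)).
have C10 : 0 <= C1.
  have -> : C1 = n%:R * (L * B) + n%:R * (L * B) * B + L * B +
    2 * (n%:R * (L * B)) by rewrite /C1; ring.
  lra.
pose C2 := 2 * L + 2 * (L * B) + n%:R * (L * B).
have C20 : 0 <= C2 by rewrite !addr_ge0 // mulr_ge0 //; lra.
exists (D + C1 + C2); first lra.
move=> h x h0 xr; have [r0 /andP[q0 qq]] := xr.
have xX : X_ad qad x by split; [move=> i; case/andP: (r0 i)|rewrite q0].
have r0' i : 0 <= x.1 0 i by case/andP: (r0 i).
have qb : 0 <= x.2 <= b by rewrite q0 (le_trans qq).
have xrb : in_range b B x by split.
have := euler_admission_bounds h0 xX => /andP[A0 AS].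
have /andP[S0 SB] := sum_r_bounds B0 xr.
have /andP[a0 aL] := tame_alpha tm qb.
have /andP[mm0 mmL] := tame_mumax tm.
have /andP[m0 mL] := tame_mu tm q0.
have E1 i : (euler_step h x).1 0 i - x.1 0 i = h * (K M i - price_rate M i x.2 * x.1 0 i -
     euler_admission h x * (x.1 0 i / Sm x)) by rewrite /= mxE addrC addKr.
have E2 : (euler_step h x).2 - x.2 = h * (euler_admission h x - mu M x.2).
  by rewrite /euler_admission addrK mulrC divfK // gt_eqF.
have DC : D <= D + C1 + C2 by move: D0 C10 C20; slim; lra.
have C1C : C1 <= D + C1 + C2 by move: D0 C10 C20; slim; lra.
have C2C : C2 <= D + C1 + C2 by move: D0 C10 C20; slim; lra.
set C := D + C1 + C2 in DC C1C C2C *.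
split.
  split.
    move=> i; rewrite E1 normrM (gtr0_norm h0) ler_pM2l //; apply: le_trans C2C.
    have /andP[K0 KL] := tame_K tm i; have /andP[H0 HL] := tame_rate tm i qb.
    have [s0 sA] := share_bounds i r0'.
    have H1 := sA (euler_admission h x) (alpha M x.2) ltac:(rewrite A0 AS; done).
    have /andP[_ rB] := r0 i.
    have H2 : alpha M x.2 * x.1 0 i <= L * B by apply: ler_pM => //; exact: ltW.
    have H3 : price_rate M i x.2 * x.1 0 i <= L * B by apply: ler_pM.
    have H4 := mulr_ge0 H0 (r0' i); have H5 := mulr_ge0 A0 s0.
    by rewrite ler_norml /C2; move: K0 KL H1 H2 H3 H4 H5 L0 LB nLB; slim; lra.
  rewrite E2 normrM (gtr0_norm h0) ler_pM2l //; apply: le_trans C2C.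
  have H2 : alpha M x.2 * Sm x <= L * (n%:R * B) by apply: ler_pM => //; exact: ltW.
  have E3 : L * (n%:R * B) = n%:R * (L * B) by ring.
  by rewrite ler_norml /C2; move: A0 AS m0 mL mmL H2 E3 L0 LB nLB; slim; lra.
move=> w d wr xw; have [wr0 /andP[wq0 wqq]] := wr.
have wqb : 0 <= w.2 <= b by rewrite wq0 (le_trans wqq).
have wrb : in_range b B w by split.
have /andP[wS0 wSB] := sum_r_bounds B0 wr.
have d0 : 0 <= d by case: xw => _; apply: le_trans; exact: normr_ge0.
have [dr dq] := xw.
have dS := close_sum d0 xw.
split.
  move=> i.
  have /andP[wi0 wiB] := wr0 i; have /andP[xi0 xiB] := r0 i.
  pose Z1 := Sm w * (price_rate M i w.2 * w.1 0 i - price_rate M i x.2 * x.1 0 i).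
  pose Z2 := w.1 0 i * (mu M w.2 - mu M x.2).
  (* The admission rate A survives only here, multiplied by a factor that vanishes at x = w. The
     bound A <= L S(x) keeps the quotient A / S(x) bounded even for small S(x). *)
  pose Z3 := euler_admission h x * (w.1 0 i - Sm w * (x.1 0 i / Sm x)).
  have -> : Sm w * (euler_step h x).1 0 i + w.1 0 i * (euler_step h x).2
       - (Sm w * x.1 0 i + w.1 0 i * x.2)
       - h * (Sm w * (K M i - price_rate M i w.2 * w.1 0 i) - w.1 0 i * mu M w.2) = h * (Z1 +
         Z2 + Z3).
    transitivity (Sm w * ((euler_step h x).1 0 i - x.1 0 i) + w.1 0 i * ((euler_step h x).2 - x.2)
       - h * (Sm w * (K M i - price_rate M i w.2 * w.1 0 i) - w.1 0 i * mu M w.2)); first by ring.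
    by rewrite E1 E2 /Z1 /Z2 /Z3; ring.
  rewrite normrM (gtr0_norm h0) ler_pM2l //.
  have /andP[H0 HL] := tame_rate tm i qb.
  have B1 : `|Z1| <= n%:R * B * (d * (L * (1 + B))).
    rewrite normrM (ger0_norm wS0); apply: ler_pM => //.
    apply: prod_diff_le.
    - by rewrite ger0_norm.
    - by rewrite ger0_norm.
    - apply: (le_trans (tame_rate_lip tm i qb wqb)); rewrite mulrC distrC.
      by apply: ler_wpM2r => //; exact: ltW.
    - by rewrite distrC.
  have B2 : `|Z2| <= B * (L * d).
    rewrite normrM (ger0_norm wi0); apply: ler_pM => //.
    apply: (le_trans (tame_mu_lip tm qb wqb)); apply: ler_wpM2l; first exact: ltW.
    by rewrite distrC.
  have B3 : `|Z3| <= 2 * (n%:R * (L * B)) * d.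
    have [SE|SN] := eqVneq (Sm x) 0.
      have -> : Z3 = 0.
        rewrite /Z3 (_ : euler_admission h x = 0) ?mul0r //.
        by apply/eqP; rewrite eq_le A0 andbT; move: AS; rewrite SE mulr0.
      by rewrite normr0; apply: mulr_ge0 => //; apply: mulr_ge0.
    have Sp : 0 < Sm x by rewrite lt_neqAle eq_sym SN.
    have -> : Z3 = euler_admission h x / Sm x * (w.1 0 i * (Sm x - Sm w) +
      Sm w * (w.1 0 i - x.1 0 i)).
      by rewrite /Z3; field; rewrite gt_eqF.
    rewrite normrM.
    have Q0 : 0 <= euler_admission h x / Sm x by rewrite divr_ge0.
    have QL : euler_admission h x / Sm x <= L.
      by rewrite ler_pdivrMr //; apply: (le_trans AS); apply: ler_wpM2r.
    rewrite (ger0_norm Q0).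
    have -> : 2 * (n%:R * (L * B)) * d = L * (B * (n%:R * d) + n%:R * B * d) by ring.
    apply: ler_pM => //; apply: (le_trans (ler_normD _ _)); apply: lerD.
      by rewrite normrM (ger0_norm wi0); apply: ler_pM.
    by rewrite normrM (ger0_norm wS0); apply: ler_pM => //; rewrite distrC.
  apply: (le_trans (ler_normD _ _)).
  apply: (le_trans (lerD (ler_normD _ _) B3)).
  have := ler_wpM2r d0 C1C.
  have -> : C1 * d = n%:R * B * (d * (L * (1 + B))) + B * (L * d) + 2 * (n%:R * (L * B)) * d.
    by rewrite /C1; ring.
  move: B1 B2; slim; lra.
move=> nc.
have AE : euler_admission h x = alpha M x.2 * Sm x.
  by rewrite /euler_admission /euler_next min_l //; field; rewrite gt_eqF.
have xw' := close_sym xw.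
have [Fl1 Fl2] := Dl w x d wrb xrb dr dq.
have F1 i : (euler_step h x).1 0 i - x.1 0 i = h * (field0 M x).1 0 i.
  rewrite E1 field0_1E exit_rateE AE; congr (_ * _).
  have -> : alpha M x.2 * Sm x * (x.1 0 i / Sm x) = alpha M x.2 * x.1 0 i.
    have [SE|SN] := eqVneq (Sm x) 0; last by field.
    have : Sm x == 0 by rewrite SE.
    rewrite psumr_eq0 // => /allP /(_ i (mem_index_enum _)) /eqP ->.
    by rewrite mul0r !mulr0.
  by ring.
have F2 : (euler_step h x).2 - x.2 = h * (field0 M x).2 by rewrite E2 AE.
have DCd := ler_wpM2r d0 DC.
split=> [i|].
  rewrite F1 -mulrBr normrM (gtr0_norm h0) ler_pM2l //.
  exact: le_trans DCd.
rewrite F2 -mulrBr normrM (gtr0_norm h0) ler_pM2l //.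
exact: le_trans DCd.
Qed.

(** Below [qad] a short step cannot pass [qad]. At [qad] the strict inequality alpha S < mumax
    persists up to equality in a neighbourhood where mu is saturated, so an untruncated step does
    not increase q. *)
Lemma no_clip (B : R) w : 0 <= B -> in_range qad B w ->
  w.2 < qad \/ alpha M w.2 * Sm w < mumax M ->
  exists2 d, 0 < d & forall x h, in_range qad B x -> close d x w -> 0 < h -> h <= d ->
    x.2 + h * (alpha M x.2 * Sm x - mu M x.2) <= qad.
Proof.
move=> B0 wr; have L0 := tame_L_gt0 tm; have h1 := qsat0; have h2 := qsata.
have nn : 0 <= n%:R :> R by [].
have [wr0 /andP[wq0 wqq]] := wr.
have wqb : 0 <= w.2 <= b by rewrite wq0 (le_trans wqq).
have nB := mulr_ge0 nn B0.
have LnB := mulr_ge0 (ltW L0) nB.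
have [lt_w|ge_w] := ltP w.2 qad.
  move=> _; pose c := 1 + L * (n%:R * B).
  have c0 : 0 < c by rewrite /c; lra.
  exists ((qad - w.2) / c); first by rewrite divr_gt0 // subr_gt0.
  move=> x h xr [_ dq] h0 hd; have [r0 /andP[q0 qq]] := xr.
  have qb : 0 <= x.2 <= b by rewrite q0 (le_trans qq).
  have /andP[S0 SB] := sum_r_bounds B0 xr.
  have /andP[a0 aL] := tame_alpha tm qb; have /andP[m0 _] := tame_mu tm q0.
  set d := (qad - w.2) / c in dq hd.
  have dE : d * c = qad - w.2 by rewrite /d divfK // gt_eqF.
  have H1 : alpha M x.2 * Sm x <= L * (n%:R * B) by apply: ler_pM => //; exact: ltW.
  have H2 : h * (alpha M x.2 * Sm x - mu M x.2) <= d * (L * (n%:R * B)).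
    apply: (@le_trans _ _ (h * (L * (n%:R * B)))); first by rewrite ler_pM2l //; move: H1 m0;
      slim; lra.
    exact: ler_wpM2r.
  move: dq; rewrite ler_norml => /andP[_ dq].
  have : d * c = d + d * (L * (n%:R * B)) by rewrite /c; ring.
  move: dq H2 dE; slim; lra.
case=> [?|aS]; first lra.
have wE : w.2 = qad by lra.
pose gap := mumax M - alpha M w.2 * Sm w.
have gap0 : 0 < gap by rewrite subr_gt0.
pose c := L * (n%:R * (1 + B)) + 1.
have c0 : 0 < c by rewrite /c; have := mulr_ge0 (ltW L0) (mulr_ge0 nn (_ : 0 <= 1 + B)); lra.
exists (Num.min (gap / c) (qad - qsat)); first by rewrite lt_min divr_gt0 // subr_gt0.
move=> x h xr xw h0 _; have [r0 /andP[q0 qq]] := xr.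
have [dr dq] := xw; set d := Num.min _ _ in xw dr dq.
have qb : 0 <= x.2 <= b by rewrite q0 (le_trans qq).
have d0 : 0 <= d.
  by rewrite le_min; apply/andP; split; [rewrite divr_ge0 // ltW|lra].
have dc : d * c <= gap by rewrite -ler_pdivlMr // ge_min lexx.
have dqs : d <= qad - qsat by rewrite ge_min lexx orbT.
have /andP[S0 SB] := sum_r_bounds B0 xr.
have /andP[wS0 wSB] := sum_r_bounds B0 wr.
have /andP[wa0 waL] := tame_alpha tm wqb.
have dS := close_sum d0 xw.
have muE : mu M x.2 = mumax M.
  by apply: mu_sat_ge; move: dq; rewrite ler_norml wE => /andP[dq _]; move: dq dqs; slim; lra.
suff : alpha M x.2 * Sm x <= mumax M.
  move=> H; have : h * (alpha M x.2 * Sm x - mu M x.2) <= 0.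
    by rewrite pmulr_rle0 // subr_le0 muE.
  move: qq; slim; lra.
have H1 : `|alpha M x.2 - alpha M w.2| <= L * d.
  by apply: (le_trans (tame_alpha_lip tm wqb qb)); apply: ler_wpM2l => //; exact: ltW.
have H2 : `|alpha M x.2 * Sm x - alpha M w.2 * Sm w| <= L * d * (n%:R * B) + L * (n%:R * d).
  have -> : alpha M x.2 * Sm x - alpha M w.2 * Sm w = (alpha M x.2 - alpha M w.2) * Sm x +
    alpha M w.2 * (Sm x - Sm w) by ring.
  apply: (le_trans (ler_normD _ _)); rewrite !normrM; apply: lerD; apply: ler_pM => //.
    by rewrite ger0_norm.
  by rewrite gtr0_norm.
move: H2; rewrite ler_norml => /andP[_ H2].
have : d * c = L * d * (n%:R * B) + L * (n%:R * d) + d by rewrite /c; ring.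
move: H2 dc d0; rewrite /gap; slim; lra.
Qed.

Lemma steps_lin (v : nat -> R) (j l : nat) h (c k : R) :
  (forall m, (j <= m)%N -> (m < j + l)%N -> `|v m.+1 - v m - h * c| <= h * k) ->
  `|v (j + l)%N - v j - l%:R * h * c| <= l%:R * h * k.
Proof.
elim: l => [|l IH] H.
  by rewrite addn0 subrr !mul0r subr0 normr0.
have := IH (fun m jm ml => H m jm ltac:(rewrite addnS ltnS ltnW; done)).
have := H (j + l)%N (leq_addr _ _) ltac:(rewrite addnS ltnSn; done).
rewrite -natr1 addnS => H1 H2.
have -> : v (j + l).+1 - v j - (l%:R + 1) * h * c = (v (j + l).+1 - v (j + l)%N - h * c) +
  (v (j + l)%N - v j - l%:R * h * c) by ring.
apply: (le_trans (ler_normD _ _)).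
have -> : (l%:R + 1) * h * k = h * k + l%:R * h * k by ring.
exact: lerD.
Qed.

End EulerScheme.

(** * The limit of the Euler paths *)

Section Existence.
Variables (R : realType) (n : nat) (M : model R n) (b L qsat qad : R).
Hypothesis tm : tame M b L.
Hypotheses (qsat0 : 0 <= qsat) (qsata : qsat < qad) (qadb : qad <= b).
Hypothesis mu_sat_ge : forall q : R, qsat <= q -> mu M q = mumax M.
Variable x0 : state R n.
Hypothesis x0X : X_ad qad x0.
Implicit Types (x w : state R n) (h s t e : R).
Local Notation Sm x := (\sum_k x.1 0 k).
Ltac slim := clear - R n M b L qsat qad tm qsat0 qsata qadb mu_sat_ge x0 x0X.

Definition euler_path h (m : nat) : state R n := iter m (euler_step M qad h) x0.

(** Each R_i gains at most h L per Euler step; the sum of the initial values covers all indices at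
    once. *)
Definition growth_bound t : R := \sum_i x0.1 0 i + L * t.

Lemma growth_bound_ge0 t : 0 <= t -> 0 <= growth_bound t.
Proof.
move=> t0; rewrite addr_ge0 //; first by apply: sumr_ge0 => i _; exact: x0X.1.
by rewrite mulr_ge0 // ltW // (tame_L_gt0 tm).
Qed.

Lemma euler_path_range h m t : 0 < h -> h * (2 * L) <= 1 -> m%:R * h <= t ->
  in_range qad (growth_bound t) (euler_path h m).
Proof.
move=> h0 hL mt.
have L0 := tame_L_gt0 tm.
have [Xm rm] : X_ad qad (euler_path h m) /\
    forall i, (euler_path h m).1 0 i <= x0.1 0 i + m%:R * h * L.
  elim: m {mt} => [|m [Xm rm]]; first by split => // i; rewrite !mul0r addr0.
  have [A B] := euler_step_X_ad tm qsat0 qsata qadb h0 hL Xm.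
  split=> // i; apply: (le_trans (B i)); rewrite -natr1.
  have := rm i; have -> : (m%:R + 1) * h * L = m%:R * h * L + h * L by ring.
  lra.
have [r0 q0] := Xm; split => // i; rewrite r0 /=.
apply: (le_trans (rm i)); rewrite /growth_bound [L * t]mulrC; apply: lerD.
  by rewrite (bigD1 i) //= lerDl; apply: sumr_ge0 => j _; exact: x0X.1.
by apply: ler_wpM2r => //; exact: ltW.
Qed.

(** The Euler path with step h_k is read at step number floor(|t| / h_k). For any two times the
    conclusion provides a chain of genuine Euler steps between points close to the limit path, over
    which one-step estimates can be summed. *)
Lemma euler_cluster : exists z : R -> state R n, [/\ z 0 = x0,
  forall t, in_range qad (growth_bound `|t|) (z t) &
  forall T, 0 <= T -> exists2 C, 0 < C &
  (forall h x, 0 < h -> in_range qad (growth_bound T) x ->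
     step_estimate M qad (growth_bound T) C h x) /\
  forall s t e, 0 <= s -> s <= t -> t <= T -> 0 < e -> exists h j l,
    [/\ 0 < h <= e, `|l%:R * h - (t - s)| <= e,
     close e (euler_path h j) (z s), close e (euler_path h (j + l)) (z t) &
     forall m, (j <= m)%N -> (m <= j + l)%N -> [/\ in_range qad (growth_bound T) (euler_path h m),
       close (l%:R * h * C) (euler_path h m) (euler_path h j) &
       close (l%:R * h * C) (euler_path h m) (euler_path h (j + l))]]].
Proof.
have L0 := tame_L_gt0 tm.
(* The largest step size that [euler_step_X_ad] admits. *)
pose h0 := (2 * L)^-1.
have h00 : 0 < h0 by rewrite invr_gt0; lra.
pose h (k : nat) := h0 / k.+1%:R.
have hk0 k : 0 < h k by rewrite divr_gt0.
have hkL k : h k * (2 * L) <= 1.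
  rewrite /h mulrAC /h0 mulVf; last by rewrite gt_eqF //; lra.
  by rewrite div1r invf_le1 // ler1n.
pose J k t := Num.truncn (`|t| / h k).
have J1 k t : (J k t)%:R * h k <= `|t|.
  by rewrite -ler_pdivlMr // truncn_le // divr_ge0 // ltW.
have J2 k t : `|t| < (J k t)%:R * h k + h k.
  have := truncnS_gt (`|t| / h k); rewrite -/(J k t) -natr1 ltr_pdivrMr //.
  by rewrite mulrDl mul1r.
pose y k t := euler_path (h k) (J k t).
have [s|z [zr zc]] := @cluster_path R n y (fun s => growth_bound `|s|) (fun=> qad).
  by exists 0%N => k _; exact: euler_path_range.
exists z; split=> //.
  have y0 k : y k 0 = x0 by rewrite /y /J normr0 mul0r truncn0.
  have [sm1 sm2] : (forall i, (z 0).1 0 i = x0.1 0 i) /\ (z 0).2 = x0.2.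
    have zero (a c : R) : (forall e, 0 < e -> `|a - c| <= e) -> c = a.
      move=> H; apply/eqP; rewrite eq_sym -subr_eq0 -normr_le0; apply/ler_addgt0Pr => e e0.
      by rewrite add0r; exact: H.
    split=> [i|]; apply: zero => e e0; have [k _ [[A B] _]] := zc 0 0 e 0%N e0; rewrite y0 in A B.
      exact: A.
    exact: B.
  rewrite [z 0]surjective_pairing [x0]surjective_pairing sm2; congr pair.
  by apply/rowP => i; exact: sm1.
move=> T T0; have gT := growth_bound_ge0 T0.
have [C C0 HC] := euler_step_lin tm qadb gT.
exists C => //; split; first exact: HC.
move=> s t e s0 st tT e0.
have [N HN] : exists N, forall k, (N <= k)%N -> h k <= e.
  exists (Num.truncn (h0 / e)) => k Nk; rewrite /h ler_pdivrMr //.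
  rewrite mulrC -ler_pdivrMr //; apply: ltW; apply: (lt_le_trans (truncnS_gt _)).
  by rewrite ler_nat ltnS.
have [k Nk [c1 c2]] := zc s t e N e0.
have t0 : 0 <= t by lra.
have Jst : (J k s <= J k t)%N.
  rewrite -ltnS -(ltr_nat R) -(ltr_pM2r (hk0 k)) -natr1 mulrDl mul1r.
  by have := J1 k s; have := J2 k t; rewrite (ger0_norm s0) (ger0_norm t0) => *; lra.
exists (h k), (J k s), (J k t - J k s)%N.
have El : (J k s + (J k t - J k s))%N = J k t by rewrite subnKC.
have Er : (J k t - J k s)%:R * h k = (J k t)%:R * h k - (J k s)%:R * h k.
  by rewrite natrB // mulrBl.
have range m : (m <= J k t)%N -> in_range qad (growth_bound T) (euler_path (h k) m).
  move=> mJ; apply: euler_path_range => //.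
  apply: (@le_trans _ _ ((J k t)%:R * h k)); first by rewrite ler_pM2r // ler_nat.
  by apply: (le_trans (J1 k t)); rewrite ger0_norm.
split.
- by rewrite hk0 HN.
- have := J1 k s; have := J2 k s; have := J1 k t; have := J2 k t; have := HN k Nk.
  by rewrite Er (ger0_norm s0) (ger0_norm t0) ler_norml => *; lra.
- exact: c1.
- by rewrite El.
- rewrite El => m jm ml.
  have steps m1 m2 : (m1 <= m2)%N -> (m2 <= J k t)%N ->
      close ((m2 - m1)%:R * h k * C) (euler_path (h k) m2) (euler_path (h k) m1).
    move=> m12; rewrite -(subnKC m12); set d := (m2 - m1)%N; rewrite addKn.
    elim: d => [|d IH] dl.
      by rewrite addn0 !mul0r; split=> [i|]; rewrite subrr normr0.
    rewrite addnS -natr1.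
    have [cl _] := HC (h k) _ (hk0 k) (range (m1 + d)%N ltac:(rewrite ltnW // -addnS; done)).
    have := close_trans cl (IH ltac:(rewrite ltnW // -addnS; done)).
    by apply: close_le; rewrite le_eqVlt; apply/orP; left; apply/eqP; ring.
  have mono m1 m2 : (m1 <= m2)%N -> m1%:R * h k * C <= m2%:R * h k * C.
    by move=> ?; rewrite !ler_pM2r // ler_nat.
  split; first exact: range.
    by apply: close_le (steps _ _ jm ml); apply: mono; exact: leq_sub2r.
  apply: close_sym; apply: close_le (steps _ _ ml (leqnn _)); apply: mono.
  exact: leq_sub2l.
Qed.

(** Here d is the time elapsed along a chain of Euler steps and e the accuracy of the approximation;
    [k1] collects the coefficients of e in the total error. *)
Lemma path_limit (u : state R n -> R) (z : R -> state R n) (A c k0 C s t e0 : R) :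
  (forall x y e, close e x y -> `|u x - u y| <= A * e) -> 0 < e0 -> s <= t -> 0 <= C -> 0 <= k0 ->
  (forall e, 0 < e -> e <= e0 -> exists x y d, [/\ close e x (z s), close e y (z t),
     `|d - (t - s)| <= e, 0 <= d & `|u y - u x - d * c| <= d * (k0 + C * e)]) ->
  `|u (z t) - u (z s) - (t - s) * c| <= (t - s) * k0.
Proof.
move=> uA e00 st C0 k00 H; apply/ler_addgt0Pr => e1 e10.
pose k1 := 2 * `|A| + `|c| + k0 + C * (t - s) + C * e0 + 1.
have Ce0 : 0 <= C * e0 by rewrite mulr_ge0 // ltW.
have Cts : 0 <= C * (t - s) by rewrite mulr_ge0 // subr_ge0.
have k10 : 0 < k1 by rewrite /k1; have := normr_ge0 A; have := normr_ge0 c; lra.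
pose e := Num.min e0 (e1 / k1).
have e_gt0 : 0 < e by rewrite lt_min e00 divr_gt0.
have ee0 : e <= e0 by rewrite ge_min lexx.
have ek1 : e * k1 <= e1 by rewrite -ler_pdivlMr // ge_min lexx orbT.
have [x [y [d [cx cy dts d0 Hd]]]] := H e e_gt0 ee0.
have ux := uA _ _ _ cx; have uy := uA _ _ _ cy.
have -> : u (z t) - u (z s) - (t - s) * c =
  (u y - u x - d * c) - (u y - u (z t)) + (u x - u (z s)) + (d - (t - s)) * c by ring.
have AA := ler_wpM2r (ltW e_gt0) (ler_norm A).
have cc : `|(d - (t - s)) * c| <= e * `|c| by rewrite normrM; apply: ler_wpM2r.
have dd : d <= t - s + e by move: dts; rewrite ler_norml => /andP[_]; slim; lra.
have Ce := mulr_ge0 C0 (ltW e_gt0).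
have Hd2 : d * (k0 + C * e) <= (t - s + e) * (k0 + C * e) by apply: ler_wpM2r => //;
  move: k00 Ce; slim; lra.
have Cee : C * e * e <= C * e0 * e by apply: ler_wpM2r; [exact: ltW|apply: ler_wpM2l].
have E : (t - s + e) * (k0 + C * e) = (t - s) * k0 + C * (t - s) * e + e * k0 + C * e * e by ring.
have E2 : e * k1 = 2 * (`|A| * e) + e * `|c| + e * k0 + C * (t - s) * e + C * e0 * e +
  e by rewrite /k1; ring.
apply: (le_trans (ler_normD _ _)); apply: (le_trans (lerD (ler_normD _ _) cc)).
apply: (le_trans (lerD (lerD (ler_normB _ _) (lexx _)) (lexx _))).
move: ux uy AA Hd Hd2 Cee E E2 ek1 e_gt0; slim; lra.
Qed.

End Existence.

(** * Lebesgue density points *)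

Section DensityPoints.
Variable R : realType.
Local Notation leb := (@lebesgue_measure R).

Lemma quad_is_derive (h : R -> R) (t d C r : R) : 0 < C -> 0 < r ->
  (forall s, `|s - t| < r -> `|h s - h t - d * (s - t)| <= C * (s - t) ^+ 2) ->
  is_derive t 1 h d.
Proof.
move=> C0 r0 H; apply/is_derive_slope => e e0.
have [r1 r10 H1] := @quadratic_slope R h t d C [set s | `|s - t| < r] C0 H e e0.
exists (Num.min r r1); first by rewrite lt_min r0.
by move=> s _; rewrite lt_min => /andP[A B]; exact: H1.
Qed.

(** If E missed the ball of radius e |s - x| about s, it would miss a fraction e / (1 + e) of the
    ball of radius (1 + e) |s - x| about x, against density 1 at x. *)
Lemma density_point (E : set R) : measurable E ->
  {ae leb, forall x, E x -> forall e : R, 0 < e -> exists2 r : R, 0 < r &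
    forall s, `|s - x| < r -> exists2 s', E s' & `|s' - s| <= e * `|s - x|}.
Proof.
move=> mE; apply: ae_imp (lebesgue_density mE) => x H Ex e e0.
rewrite indicE mem_set //= in H.
pose c := 1 + e.
have c0 : 0 < c by rewrite /c; lra.
have c1 : 0 <= e / c by rewrite divr_ge0 // ltW.
have near1 : \forall r \near (0:R)^'+,
    ((1 - e / c)%:E < leb (E `&` ball x r) * (leb (ball x r))^-1)%E.
  apply: (H [set y : \bar R | ((1 - e / c)%:E < y)%E]).
  apply: open_nbhs_nbhs; split; first exact: open_ereal_gt_ereal.
  by rewrite /= lte_fin ltrBlDr ltrDl divr_gt0.
move: near1; rewrite near_withinE => -[r1 /= r10 Hr].
exists (r1 / c); first by rewrite divr_gt0.
move=> s sx; apply: contrapT => Hn.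
have [sE|sN] := eqVneq s x.
  by apply: Hn; exists x => //; rewrite sE subrr normr0 mulr0.
pose d := `|s - x|.
have d0 : 0 < d by rewrite normr_gt0 subr_eq0.
pose r := c * d.
have r0 : 0 < r by rewrite mulr_gt0.
have rr1 : r < r1 by rewrite /r mulrC -ltr_pdivlMr.
have := Hr r; rewrite /ball /= sub0r normrN gtr0_norm // => /(_ rr1 r0).
apply/negP; rewrite -leNgt.
have r0' : 0 <= r by exact: ltW.
rewrite lebesgue_measure_ball // inver mulrn_eq0 /= gt_eqF //.
have r2 : 0 < (r *+ 2)^-1 by rewrite invr_gt0 mulrn_wgt0.
have sub1 : (E `&` ball x r) `<=` ball x r `\` ball s (e * d).
  move=> y [Ey yx]; split => // ys; apply: Hn; exists y => //.
  by rewrite -/d distrC; apply: ltW; move: ys; rewrite /ball /=.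
have sub2 : ball s (e * d) `<=` ball x r.
  move=> y; rewrite /ball /= => ys; apply: (@le_lt_trans _ _ (`|x - s| + `|s - y|)).
    exact: ler_distD.
  by rewrite /r /c mulrDl mul1r distrC -/d ltrD2l.
have ed0 : 0 <= e * d by rewrite mulr_ge0 // ltW.
have le1 : (leb (E `&` ball x r) <= (r *+ 2 - (e * d) *+ 2)%:E)%E.
  apply: (@le_trans _ _ (leb (ball x r `\` ball s (e * d)))).
    apply: le_measure => //; rewrite inE.
      by apply: measurableI => //; exact: measurable_realfun.measurable_ball.
    by apply: measurableD; exact: measurable_realfun.measurable_ball.
  rewrite measureD; [|exact: measurable_realfun.measurable_ball
    |exact: measurable_realfun.measurable_ball|].
    by rewrite setIidr // -[X in (X - _)%E]/(leb _) -[X in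
      (_ - X)%E]/(leb _) !lebesgue_measure_ball.
  by rewrite -[X in (X < _)%E]/(leb _) lebesgue_measure_ball // ltry.
apply: (@le_trans _ _ ((r *+ 2 - (e * d) *+ 2)%:E * ((r *+ 2)^-1)%:E)%E).
  by apply: lee_wpmul2r => //; rewrite lee_fin ltW.
rewrite -EFinM lee_fin /r.
have -> : ((c * d) *+ 2 - (e * d) *+ 2) / ((c * d) *+ 2) = 1 - e / c.
  by field; rewrite !gt_eqF.
by [].
Qed.

End DensityPoints.

(** * The limit path solves the modified system *)

Section ExistenceTheorem.
Variables (R : realType) (n : nat) (M : model R n) (b L qsat qad : R).
Hypothesis tm : tame M b L.
Hypotheses (qsat0 : 0 <= qsat) (qsata : qsat < qad) (qadb : qad <= b).
Hypothesis mu_sat_ge : forall q : R, qsat <= q -> mu M q = mumax M.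
Variable x0 : state R n.
Hypothesis x0X : X_ad qad x0.
Local Notation Sm x := (\sum_k x.1 0 k).
Ltac slim := clear - R n M b L qsat qad tm qsat0 qsata qadb mu_sat_ge x0 x0X.

Lemma caratheodory_exists : exists x : R -> state R n,
  caratheodory_solution (field_ad M qad) x /\ x 0 = x0.
Proof.
have h1 := qsat0; have h2 := qsata; have h3 := qadb.
have [z [z0 zr zscheme]] := euler_cluster tm qsat0 qsata qadb x0X.
exists z; split => //.
have zr' t : 0 <= t -> in_range qad (growth_bound L x0 t) (z t).
  by move=> t0; have := zr t; rewrite ger0_norm.
(* estimates for one Euler step pass to the limit path *)
have key T : 0 <= T -> exists2 C, 0 < C &
    (forall h x, 0 < h -> in_range qad (growth_bound L x0 T) x ->
      step_estimate M qad (growth_bound L x0 T) C h x) /\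
    forall (u : state R n -> R) (A c k0 C1 e0 s t : R),
      (forall x y e, close e x y -> `|u x - u y| <= A * e) ->
      0 <= s -> s <= t -> t <= T -> 0 < e0 -> 0 <= k0 -> 0 <= C1 ->
      (forall e h x d, 0 < e -> e <= e0 -> 0 < h -> h <= e ->
        in_range qad (growth_bound L x0 T) x ->
         step_estimate M qad (growth_bound L x0 T) C h x ->
         d <= (t - s) * C + (C + 1) * e ->
         close d x (z s) -> close d x (z t) ->
         `|u (euler_step M qad h x) - u x - h * c| <= h * (k0 + C1 * e)) ->
      `|u (z t) - u (z s) - (t - s) * c| <= (t - s) * k0.
  move=> T0; have [C C0 [HC Hs]] := zscheme T T0; exists C => //; split => //.
  move=> u A c k0 C1 e0 s t uA s0 st tT e00 k00 C10 H.
  apply: (path_limit uA e00 st C10 k00) => e e_gt0 ee0.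
  have [h [j [l [/andP[h0 he] hl c1 c2 Hm]]]] := Hs s t e s0 st tT e_gt0.
  exists (euler_path M qad x0 h j), (euler_path M qad x0 h (j + l)), (l%:R * h); split => //.
    by rewrite mulr_ge0 // ltW.
  apply: (@steps_lin R (fun m => u (euler_path M qad x0 h m))) => m jm ml.
  have [rm cm1 cm2] := Hm m jm (ltnW ml).
  apply: (H e h _ (l%:R * h * C + e)) => //; first exact: HC.
  - have := ler_wpM2r (ltW C0) (_ : l%:R * h <= t - s + e).
    have -> : (t - s + e) * C = (t - s) * C + C * e by ring.
    have -> : (C + 1) * e = C * e + e by ring.
    move=> /(_ _)/= => H1; have : l%:R * h <= t - s + e by move: hl;
      rewrite ler_norml => /andP[_]; slim; lra.
    by move/H1; slim; lra.
  - exact: close_trans cm1 c1.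
  - exact: close_trans cm2 c2.
have pr1 i : forall (x y : state R n) e, close e x y -> `|x.1 0 i - y.1 0 i| <= 1 * e.
  by move=> x y e [H _]; rewrite mul1r.
have pr2 : forall (x y : state R n) e, close e x y -> `|x.2 - y.2| <= 1 * e.
  by move=> x y e [_ H]; rewrite mul1r.
have lip T : 0 <= T -> exists2 C, 0 < C & forall s t, 0 <= s -> s <= t -> t <= T ->
    close (C * (t - s)) (z t) (z s).
  move=> T0; have [C C0 [_ HC]] := key T T0; exists C => // s t s0 st tT.
  have LL (u : state R n -> R) : (forall x y e, close e x y -> `|u x - u y| <= 1 * e) ->
      `|u (z t) - u (z s)| <= C * (t - s).
    move=> u1; have := HC u 1 0 C 0 1 s t u1 s0 st tT ltr01 (ltW C0) (lexx _).
    rewrite mulr0 subr0 mulrC; apply => e h x d _ _ h0 _ _ [cl _] _ _ _.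
    by rewrite mulr0 subr0 mul0r addr0; have := u1 _ _ _ cl; rewrite mul1r.
  by split=> [i|]; [exact: LL (pr1 i)|exact: LL pr2].
split.
- by move=> t t0; have [A /andP[B _]] := zr' t t0; split => // i; case/andP: (A i).
- move=> T T0; have [C C0 HC] := lip T T0.
  by split=> [i|]; apply: (@lipschitz_ac _ _ _ _ C) => s t s0 st tT;
    [exact: (HC s t s0 st tT).1|exact: (HC s t s0 st tT).2].
(* Clamping negative times to 0 makes E the preimage of a point under a function continuous on the
   whole line, hence measurable. *)
pose E := (fun t => (z (Num.max t 0)).2) @^-1` [set qad].
have mE : measurable E.
  rewrite -[E]setTI.
  suff : measurable_fun setT (fun t : R => (z (Num.max t 0)).2).
    by apply => //; exact: measurable_set1.
  apply: measurable_realfun.continuous_measurable_fun => t.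
  apply/cvgrPdist_lt => e e0.
  have T0 : 0 <= Num.max t 0 + 1 by rewrite addr_ge0 // le_max lexx orbT.
  have [C C0 HC] := lip _ T0.
  have r0 : 0 < Num.min 1 (e / C) by rewrite lt_min ltr01 divr_gt0.
  exists (Num.min 1 (e / C)) => //= s; rewrite /ball /= lt_min => /andP[s1 s2].
  have m1 : `|Num.max t 0 - Num.max s 0| <= `|t - s|.
    rewrite ler_norml; have := ler_norm (t - s); have := ler_norm (s - t); rewrite distrC.
    by case: (leP t 0); case: (leP s 0); slim; lra.
  have bd : `|(z (Num.max t 0)).2 - (z (Num.max s 0)).2| <= C * `|Num.max t 0 - Num.max s 0|.
    have [ts|st] := leP (Num.max t 0) (Num.max s 0).
      rewrite distrC [`|Num.max t 0 - _|]distrC [`|Num.max s 0 - _|]ger0_norm ?subr_ge0 //.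
      apply: (HC _ _ _ ts _).2; first by rewrite le_max lexx orbT.
      by move: m1; rewrite ler_norml => /andP[? _]; lra.
    rewrite [`|Num.max t 0 - _|]gtr0_norm ?subr_gt0 //.
    apply: (HC _ _ _ (ltW st) _).2; first by rewrite le_max lexx orbT.
    lra.
  apply: (le_lt_trans bd); apply: (@le_lt_trans _ _ (C * `|t - s|)); first by rewrite ler_pM2l.
  by rewrite mulrC -ltr_pdivlMr.
apply: ae_imp (density_point mE) => t Hd t0.
pose T := t + 1.
have T0 : 0 <= T by rewrite /T; lra.
have [C C0 [HC0 HC]] := key T T0.
have [CL CL0 HCL] := lip T T0.
set w := z t.
have wr : in_range qad (growth_bound L x0 T) w.
  have [A B] := zr' t (ltW t0); split => // i; have /andP[-> H] := A i.
  apply: (le_trans H); rewrite lerD2l ler_pM2l ?(tame_L_gt0 tm) // /T; lra.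
have B0 : 0 <= growth_bound L x0 T by apply: (growth_bound_ge0 tm x0X).
have [wr0 /andP[wq0 wqq]] := wr.
(* [w] is the state at one of the two ends of each interval considered *)
have quad (u : state R n -> R) (A c rho e0 : R) : 0 < rho -> 0 < e0 ->
    (forall x y e, close e x y -> `|u x - u y| <= A * e) ->
    (forall h x d, 0 < h -> h <= e0 -> in_range qad (growth_bound L x0 T) x ->
         step_estimate M qad (growth_bound L x0 T) C h x ->
         d <= rho * C + (C + 1) * e0 -> close d x w ->
         `|u (euler_step M qad h x) - u x - h * c| <= h * (C * d)) ->
    is_derive t 1 (fun s => u (z s)) c.
  move=> rho0 e00 uA H.
  have CC : 0 < C * C by rewrite mulr_gt0.
  apply: (@quad_is_derive R _ t c (C * C) (Num.min rho (Num.min 1 t))) => //.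
    by rewrite !lt_min rho0 ltr01.
  have main s s' : 0 <= s -> s <= s' -> s' <= T -> s' - s <= rho -> w = z s \/ w = z s' ->
      `|u (z s') - u (z s) - (s' - s) * c| <= C * C * (s' - s) ^+ 2.
    move=> s0 ss sT sr ws.
    have k0 : 0 <= C * C * (s' - s) by rewrite mulr_ge0 ?subr_ge0 // ltW.
    have C1 : 0 <= C * (C + 1) by apply: mulr_ge0; [exact: ltW|apply: addr_ge0 => //; exact: ltW].
    have -> : C * C * (s' - s) ^+ 2 = (s' - s) * (C * C * (s' - s)) by ring.
    apply: (HC u A c _ (C * (C + 1)) e0 s s' uA s0 ss sT e00 k0 C1).
    move=> e h x d e_gt0 ee0 hh0 he xr se dle cs cs'.
    have cw : close d x w by case: ws => ->.
    apply: (@le_trans _ _ (h * (C * d))).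
      apply: H => //; first exact: le_trans he ee0.
      apply: (le_trans dle); apply: lerD; first by rewrite ler_pM2r.
      by apply: ler_wpM2l => //; apply: addr_ge0 => //; exact: ltW.
    rewrite ler_pM2l //.
    have := ler_wpM2l (ltW C0) dle.
    have -> : C * ((s' - s) * C + (C + 1) * e) = C * C * (s' - s) + C * (C + 1) * e by ring.
    by [].
  move=> s; rewrite !lt_min => /and3P[sr s1 st].
  have [ts|st'] := leP t s.
    rewrite ger0_norm ?subr_ge0 // in sr s1 st.
    have := main t s (ltW t0) ts ltac:(move: s1; rewrite /T; slim;
      lra) (ltW sr) (or_introl erefl).
    by rewrite [(s - t) * c]mulrC.
  rewrite distrC gtr0_norm ?subr_gt0 // in sr s1 st.
  have := main s t ltac:(move: st; slim; lra) (ltW st') ltac:(rewrite /T; slim;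
    lra) (ltW sr) (or_intror erefl).
  rewrite -normrN -sqrrN.
  have -> : - (u (z t) - u (z s) - (t - s) * c) = u (z s) - u (z t) - c * (s - t) by ring.
  by rewrite opprB.
have [free|nfree] := pselect (w.2 < qad \/ alpha M w.2 * Sm w < mumax M).
  have [dl dl0 Hdl] := no_clip tm qsat0 qsata qadb mu_sat_ge B0 wr free.
  rewrite (@field_ad_free _ _ _ qad); first last.
  - rewrite /alpha_ad; case: ltP => // qw; case: free => [wl|aS];
    first by move: (lt_le_trans wl qw); rewrite ltxx.
    by rewrite min_l // ltW.
  - by move=> i; case/andP: (wr0 i).
  (* The time span rho and the accuracy e0 each use half of the radius dl given by [no_clip]. *)
  pose rho := dl / (2 * C).
  have rho0 : 0 < rho by rewrite divr_gt0 // mulr_gt0.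
  pose e0 := Num.min dl (dl / (2 * (C + 1))).
  have e00 : 0 < e0 by rewrite lt_min dl0 divr_gt0 // mulr_gt0 //; move: C0; slim; lra.
  have ed : rho * C + (C + 1) * e0 <= dl.
    have : rho * C = dl / 2 by rewrite /rho; field; rewrite gt_eqF.
    have C10 : 0 < C + 1 by move: C0; slim; lra.
    have : (C + 1) * e0 <= (C + 1) * (dl / (2 * (C + 1))) by rewrite ler_pM2l // ge_min lexx orbT.
    have -> : (C + 1) * (dl / (2 * (C + 1))) = dl / 2 by field; rewrite gt_eqF.
    slim; lra.
  have nc h x d : 0 < h -> h <= e0 -> in_range qad (growth_bound L x0 T) x ->
      d <= rho * C + (C + 1) * e0 -> close d x w ->
        x.2 + h * (alpha M x.2 * Sm x - mu M x.2) <= qad.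
    move=> hh0 he xr dle cw; apply: Hdl => //; first by apply: close_le cw;
      exact: le_trans dle ed.
    by apply: (le_trans he); rewrite ge_min lexx.
  split=> [i|].
    apply: (quad (fun x => x.1 0 i) 1 _ rho e0 rho0 e00 (pr1 i)) => h x d hh0 he xr [_ se] dle cw.
    exact: ((se w d wr cw).2 (nc h x d hh0 he xr dle cw)).1.
  apply: (quad (fun x => x.2) 1 _ rho e0 rho0 e00 pr2) => h x d hh0 he xr [_ se] dle cw.
  exact: ((se w d wr cw).2 (nc h x d hh0 he xr dle cw)).2.
have qE : w.2 = qad.
  by apply/eqP; rewrite eq_le wqq /= leNgt; apply/negP => ?; apply: nfree; left.
have aS : mumax M <= alpha M w.2 * Sm w.
  by rewrite leNgt; apply/negP => ?; apply: nfree; right.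
have /andP[mm0 _] := tame_mumax tm.
have S0 : 0 < Sm w.
  have wS0 : 0 <= Sm w by apply: sumr_ge0 => i _; case/andP: (wr0 i).
  rewrite lt_neqAle wS0 andbT eq_sym; apply/eqP => SE.
  by move: (lt_le_trans mm0 aS); rewrite SE mulr0 ltxx.
have Et : E t by rewrite /E /= max_l ?(ltW t0) // -/w qE.
have AE : alpha_ad M qad (Sm w) w.2 = mumax M.
  by rewrite /alpha_ad qE ltxx -qE min_r.
have muE : mu M w.2 = mumax M by apply: mu_sat_ge; rewrite qE ltW.
(* Density gives a point s' of E within e1 |s - t| of s. As q = q_ad both at s' and at t, the
   Lipschitz constant CL bounds the increment of q from t to s by e |s - t|. *)
have dq : is_derive t 1 (fun s => (z s).2) 0.
  apply/is_derive_slope => e e0.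
  pose e1 := Num.min 1 (e / CL).
  have e10 : 0 < e1 by rewrite lt_min ltr01 divr_gt0.
  have [r r0 Hr] := Hd Et e1 e10.
  exists (Num.min r (Num.min (1 / 2) (t / 2))); first by rewrite !lt_min r0 !divr_gt0.
  move=> s _; rewrite !lt_min => /and3P[sr s1 s2].
  have [s' Es' s's] := Hr s sr.
  have e1l : e1 <= 1 by rewrite ge_min lexx.
  have s'd : `|s' - s| <= `|s - t| by apply: (le_trans s's); rewrite ler_piMl.
  have [b1 b2] : 0 < s' /\ s' <= T.
    by move: s'd s1 s2; rewrite ler_norml /T; have := ler_norm (s - t);
      have := ler_norm (- (s - t)); rewrite normrN; slim; lra.
  have [b3 b4] : 0 < s /\ s <= T.
    by move: s1 s2; rewrite /T; have := ler_norm (s - t); have := ler_norm (- (s - t));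
      rewrite normrN; slim; lra.
  have qs' : (z s').2 = qad by move: Es'; rewrite /E /= max_l ?ltW.
  rewrite mul0r subr0 -/w qE -qs'.
  apply: (@le_trans _ _ (CL * `|s' - s|)).
    have [ss|ss] := leP s s'.
      rewrite distrC [`|s' - s|]ger0_norm ?subr_ge0 //.
      exact: (HCL s s' (ltW b3) ss b2).2.
    rewrite [`|s' - s|]distrC [`|s - s'|]gtr0_norm ?subr_gt0 //.
    exact: (HCL s' s (ltW b1) (ltW ss) b4).2.
  apply: (@le_trans _ _ (CL * (e1 * `|s - t|))); first by rewrite ler_pM2l.
  rewrite mulrA; apply: ler_wpM2r => //.
  by rewrite mulrC -ler_pdivlMr // ge_min lexx orbT.
split; last first.
  apply: is_derive_eq dq _.
  by rewrite /= AE muE subrr.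
move=> i.
have du : is_derive t 1 (fun s => Sm w * (z s).1 0 i + w.1 0 i * (z s).2)
    (Sm w * (K M i - price_rate M i w.2 * w.1 0 i) - w.1 0 i * mu M w.2).
  apply: (quad (fun x => Sm w * x.1 0 i + w.1 0 i * x.2) (Sm w + w.1 0 i) _ 1 1) => //.
    have wi0 : 0 <= w.1 0 i by case/andP: (wr0 i).
    move=> x y e [H1 H2].
    have -> : Sm w * x.1 0 i + w.1 0 i * x.2 - (Sm w * y.1 0 i + w.1 0 i * y.2) =
      Sm w * (x.1 0 i - y.1 0 i) + w.1 0 i * (x.2 - y.2) by ring.
    apply: (le_trans (ler_normD _ _)); rewrite !normrM (gtr0_norm S0) (ger0_norm wi0) mulrDl.
    by apply: lerD; apply: ler_wpM2l => //; exact: ltW.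
  move=> h x d hh0 he xr [_ se] dle cw.
  exact: (se w d wr cw).1.
(* R_i is recovered from the combination and from q, both differentiable at t; S(w) > 0 because
   admissions are at their cap. *)
have -> : (fun s => (z s).1 0 i) = (Sm w)^-1 \*: ((fun s => Sm w * (z s).1 0 i +
  w.1 0 i * (z s).2)
    - (w.1 0 i \*: (fun s => (z s).2))).
  apply/funext => s; rewrite /= /GRing.scale /= -[X in _ = _ * X]/(Sm w * (z s).1 0 i +
    w.1 0 i * (z s).2 - w.1 0 i * (z s).2).
  by rewrite addrK mulKf // gt_eqF.
apply: is_derive_eq (is_deriveZ _ (is_deriveB du (is_deriveZ _ dq))) _.
rewrite /GRing.scale /= mulr0 subr0 mxE AE muE -/(price_rate M i w.2).
by field; rewrite gt_eqF.
Qed.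

End ExistenceTheorem.

(** * Local stability *)

Section LyapunovForm.
Variables (R : realType) (n : nat).
Variables (a al L : R) (phi fr Rs : 'I_n -> R) (i0 : 'I_n).
Hypotheses (a_ge0 : 0 <= a) (al_gt0 : 0 < al) (L_ge0 : 0 <= L).
Hypotheses (phi_ge0 : forall i, 0 <= phi i) (fr_ge0 : forall i, 0 <= fr i).
Hypotheses (Rs_gt0 : forall i, 0 < Rs i) (phi_gt0 : 0 < phi i0).
Ltac slim := clear - R n a al L phi fr Rs i0 a_ge0 al_gt0 L_ge0 phi_ge0 fr_ge0 Rs_gt0 phi_gt0.

Definition lyap (c : 'I_n -> R) (e u : R) (rho : 'I_n -> R) : R :=
  u ^+ 2 / 2 + \sum_i c i * rho i ^+ 2 / 2 + e * (u * rho i0).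

(* The derivative of lyap when u' = y and rho' = v. *)
Definition lyap_dot (c : 'I_n -> R) (e u : R) (rho : 'I_n -> R) (y : R) (v : 'I_n -> R) : R :=
  u * y + \sum_i c i * (rho i * v i) + e * (y * rho i0 + u * v i0).

(** The input p stands for mumax - mu(q), which is not linearized because mu may have its corner at
    q^s. *)
Definition lin_q (u p : R) (rho : 'I_n -> R) : R :=
  - (a * (\sum_i Rs i) * u) + al * (\sum_i rho i) + p.

Definition lin_r (u : R) (rho : 'I_n -> R) (i : 'I_n) : R :=
  (a - phi i) * Rs i * u - (fr i + al) * rho i.

Definition sqnorm (u : R) (rho : 'I_n -> R) : R := u ^+ 2 + \sum_i rho i ^+ 2.

Lemma sqnorm_ge0 u rho : 0 <= sqnorm u rho.
Proof. by rewrite addr_ge0 ?sqr_ge0 // sumr_ge0 // => i _; rewrite sqr_ge0. Qed.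

Lemma pos_lower_bound (F : 'I_n -> R) : (forall i, 0 < F i) ->
  exists2 m, 0 < m & forall i, m <= F i.
Proof.
move=> F0; exists (\big[Num.min/1]_i F i); last by move=> i; exact: bigmin_le_cond.
by apply: (big_ind (fun x => 0 < x)) => // x y x0 y0; rewrite lt_min x0.
Qed.

Definition lyap_good (c : 'I_n -> R) (e k : R) :=
  [/\ 0 < k, forall i, 0 < c i, 0 <= e
    & forall u p rho, u * p <= 0 -> `|p| <= L * `|u| ->
      k * sqnorm u rho <= lyap c e u rho /\
      lyap_dot c e u rho (lin_q u p rho) (lin_r u rho) <= - (k * sqnorm u rho)].

(** Put y_i = c_i rho_i. Since c_i (a + phi_i) Rs_i = al, the cross terms add up to 2 a Rs_i u y_i
    and minus the derivative is at least the sum of the squares [Q]. This sum is definite: phi_i0 >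
    0 controls y_i0, then u - y_i0 controls u, and u - y_i controls every y_i. *)
Lemma lyap_pos_slope : 0 < a -> exists c e k, lyap_good c e k.
Proof.
move=> a0.
pose c i := al / ((a + phi i) * Rs i).
have ap i : 0 < a + phi i by rewrite ltr_wpDr.
have apR i : 0 < (a + phi i) * Rs i by rewrite mulr_gt0.
have c0 i : 0 < c i by rewrite divr_gt0.
have [m m0 mc] := pos_lower_bound c0.
(* k0 and ki are the constants in u^2 <= k0 QQ and rho_i^2 <= ki QQ, both from x^2 <= 2 (x - y)^2 +
   2 y^2. *)
pose k0 := 2 / (a * Rs i0) + 2 / (phi i0 * Rs i0).
have k00 : 0 <= k0 by rewrite /k0 addr_ge0 // divr_ge0 // ltW // mulr_gt0.
pose ki i := (2 / (a * Rs i) + 2 * k0) / (c i) ^+ 2.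
have ki0 i : 0 <= ki i.
  rewrite /ki divr_ge0 ?sqr_ge0 //; apply: addr_ge0; last exact: mulr_ge0.
  by rewrite divr_ge0 // ltW // mulr_gt0.
pose KK := k0 + \sum_i ki i + 1.
have KK0 : 0 < KK by rewrite /KK ltr_wpDl // addr_ge0 // sumr_ge0.
pose k := Num.min (Num.min (1 / 2) (m / 2)) KK^-1.
have k_gt0 : 0 < k by rewrite !lt_min invr_gt0 KK0 !divr_gt0.
exists c, 0, k; split => // u p rho up pL.
split.
  rewrite /lyap mul0r addr0 /sqnorm mulrDr mulr_sumr.
  have k12 : k <= 1 / 2 by rewrite !ge_min lexx.
  have km : k <= m / 2 by rewrite !ge_min lexx orbT.
  apply: lerD.
    have := sqr_ge0 u; have := ler_wpM2r (sqr_ge0 u) k12; lra.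
  apply: ler_sum => i _.
  have := ler_wpM2r (sqr_ge0 (rho i)) km; have := ler_wpM2r (sqr_ge0 (rho i)) (mc i); lra.
pose y i := c i * rho i.
pose Q i := a * Rs i * (u - y i) ^+ 2 + phi i * Rs i * y i ^+ 2.
have Q0 i : 0 <= Q i.
  by apply: addr_ge0; apply: mulr_ge0; rewrite ?sqr_ge0 // mulr_ge0 // ltW.
have W : lyap_dot c 0 u rho (lin_q u p rho) (lin_r u rho) <= - \sum_i Q i.
  rewrite /lyap_dot mul0r addr0 /lin_q.
  have -> : u * (- (a * (\sum_i Rs i) * u) + al * (\sum_i rho i) + p) =
     \sum_i (- (a * Rs i * u ^+ 2) + al * (u * rho i)) + u * p.
    rewrite big_split /= sumrN -mulr_sumr -!mulr_sumr.
    have -> : \sum_i a * Rs i * u ^+ 2 = a * (\sum_i Rs i) * u ^+ 2.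
      by rewrite mulr_sumr mulr_suml.
    ring.
  rewrite addrAC -big_split /= -sumrN.
  suff : \sum_i (- (a * Rs i * u ^+ 2) + al * (u * rho i) +
    c i * (rho i * lin_r u rho i)) <= \sum_i - Q i by lra.
  apply: ler_sum => i _.
  have alE : al = c i * ((a + phi i) * Rs i) by rewrite /c divfK // gt_eqF.
  have H : c i * ((a + phi i) * Rs i) * (c i * rho i ^+ 2) <= c i * (rho i ^+ 2 * (fr i + al)).
    rewrite -alE.
    have := mulr_ge0 (mulr_ge0 (ltW (c0 i)) (sqr_ge0 (rho i))) (fr_ge0 i).
    have -> : c i * (rho i ^+ 2 * (fr i + al)) = c i * rho i ^+ 2 * fr i +
      al * (c i * rho i ^+ 2) by ring.
    lra.
  have -> : - (a * Rs i * u ^+ 2) + al * (u * rho i) + c i * (rho i * lin_r u rho i) =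
     - (a * Rs i * u ^+ 2) + (al +
       c i * ((a - phi i) * Rs i)) * (u * rho i) - c i * (rho i ^+ 2 * (fr i + al)).
    by rewrite /lin_r; ring.
  apply: (@le_trans _ _ (- (a * Rs i * u ^+ 2) + (c i * ((a + phi i) * Rs i) +
    c i * ((a - phi i) * Rs i)) * (u * rho i) - c i * ((a + phi i) * Rs i) * (c i * rho i ^+ 2))).
    by rewrite -alE in H *; lra.
  by rewrite le_eqVlt; apply/orP; left; apply/eqP; rewrite /Q /y; ring.
apply: (le_trans W); rewrite lerN2.
set QQ := \sum_i Q i.
have QQi i : Q i <= QQ by rewrite /QQ (bigD1 i) //= lerDl sumr_ge0.
have aR i : 0 < a * Rs i by rewrite mulr_gt0.
have d1 i : (u - y i) ^+ 2 <= QQ / (a * Rs i).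
  rewrite ler_pdivlMr // mulrC; apply: le_trans (QQi i); rewrite lerDl.
  by rewrite mulr_ge0 ?sqr_ge0 // mulr_ge0 // ltW.
have d2 : y i0 ^+ 2 <= QQ / (phi i0 * Rs i0).
  rewrite ler_pdivlMr ?mulr_gt0 // mulrC; apply: le_trans (QQi i0); rewrite lerDr.
  by rewrite mulr_ge0 ?sqr_ge0 // ltW.
have uk : u ^+ 2 <= k0 * QQ.
  have := d1 i0; have := d2; have := sqr_ge0 (u - 2 * y i0).
  have -> : k0 * QQ = 2 * (QQ / (a * Rs i0)) + 2 * (QQ / (phi i0 * Rs i0)).
    by rewrite /k0; field; rewrite !gt_eqF.
  have -> : (u - 2 * y i0) ^+ 2 = u ^+ 2 - 4 * (u * y i0) + 4 * y i0 ^+ 2 by ring.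
  have -> : (u - y i0) ^+ 2 = u ^+ 2 - 2 * (u * y i0) + y i0 ^+ 2 by ring.
  lra.
have rk i : rho i ^+ 2 <= ki i * QQ.
  rewrite /ki mulrAC ler_pdivlMr ?exprn_gt0 //.
  have -> : rho i ^+ 2 * c i ^+ 2 = y i ^+ 2 by rewrite /y; ring.
  have := d1 i; have := sqr_ge0 (y i - 2 * u).
  have -> : (2 / (a * Rs i) + 2 * k0) * QQ = 2 * (QQ / (a * Rs i)) + 2 * (k0 * QQ).
    by field; rewrite !gt_eqF.
  have -> : (y i - 2 * u) ^+ 2 = y i ^+ 2 - 4 * (u * y i) + 4 * u ^+ 2 by ring.
  have -> : (u - y i) ^+ 2 = u ^+ 2 - 2 * (u * y i) + y i ^+ 2 by ring.
  lra.
have QQ0 : 0 <= QQ by apply: sumr_ge0.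
have NK : sqnorm u rho <= KK * QQ.
  have : \sum_i rho i ^+ 2 <= (\sum_i ki i) * QQ by rewrite mulr_suml; apply: ler_sum.
  rewrite /sqnorm.
  have -> : KK * QQ = k0 * QQ + (\sum_i ki i) * QQ + QQ by rewrite /KK; ring.
  lra.
apply: (@le_trans _ _ (KK^-1 * sqnorm u rho)).
  apply: ler_wpM2r; first exact: sqnorm_ge0.
  by rewrite !ge_min lexx orbT.
by rewrite mulrC ler_pdivrMr // mulrC.
Qed.

Lemma sqr_sum_le (rho : 'I_n -> R) : (\sum_i rho i) ^+ 2 <= n%:R * \sum_i rho i ^+ 2.
Proof.
have main (r : seq 'I_n) : (\sum_(i <- r) rho i) ^+ 2 <= (size r)%:R * \sum_(i <- r) rho i ^+ 2.
  elim: r => [|i r IH]; first by rewrite !big_nil expr0n /= mul0r.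
  rewrite !big_cons /= -natr1; set s := \sum_(_ <- _) _ in IH *; set q := \sum_(_ <- _) _ in IH *.
  have q0 : 0 <= q by apply: sumr_ge0 => j _; exact: sqr_ge0.
  have [r0|r0] := eqVneq (size r) 0%N.
    have -> : s = 0 by rewrite /s (size0nil r0) big_nil.
    by rewrite r0 addr0 add0r mul1r lerDl.
  have rp : 0 < (size r)%:R :> R by rewrite ltr0n lt0n.
  have H : 0 <= ((size r)%:R * rho i - s) ^+ 2 / (size r)%:R by rewrite divr_ge0 ?sqr_ge0 // ltW.
  have E : ((size r)%:R * rho i - s) ^+ 2 / (size r)%:R =
    (size r)%:R * rho i ^+ 2 - 2 * (rho i * s) + s ^+ 2 / (size r)%:R.
    by field; rewrite gt_eqF.
  have : s ^+ 2 / (size r)%:R <= q by rewrite ler_pdivrMr // mulrC.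
  have -> : (rho i + s) ^+ 2 = rho i ^+ 2 + 2 * (rho i * s) + s ^+ 2 by ring.
  have -> : ((size r)%:R + 1) * (rho i ^+ 2 + q) = (size r)%:R * rho i ^+ 2 + (size r)%:R * q +
    rho i ^+ 2 + q by ring.
  move: H; rewrite E; lra.
have := main (index_enum _); rewrite (_ : size (index_enum _) = n) //.
by rewrite -[RHS]card_ord cardT enumT.
Qed.

(** Where phi_i > 0 the weight cancels the cross term al u rho_i exactly; where phi_i = 0 a large
    weight absorbs it by Young's inequality, at the price of a little u^2. The damping of u that
    pays for this is - e phi_i0 Rs_i0 u^2, from the derivative of e u rho_i0. *)
Lemma lyap_zero_slope : a = 0 -> exists c e k, lyap_good c e k.
Proof.
move=> a0.
have al0 := al_gt0; have LL := L_ge0.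
pose h i := fr i + al.
have h0 i : 0 < h i by rewrite ltr_wpDl.
(* A lower bound for the weights that does not involve G. The choices are thus not circular: m and
   m1 come from cp, e from them, G from e, and c from G. *)
pose cp i := if phi i == 0 then 1 else al / (phi i * Rs i).
have cp0 i : 0 < cp i.
  rewrite /cp; case: eqVneq => // pi; rewrite divr_gt0 // mulr_gt0 //.
  by rewrite lt_neqAle eq_sym pi phi_ge0.
have [m m0 mc] := pos_lower_bound (fun i => mulr_gt0 (cp0 i) (h0 i)).
have [m1 m10 m1c] := pos_lower_bound cp0.
pose Ph := phi i0 * Rs i0.
have Ph0 : 0 < Ph by rewrite mulr_gt0.
pose N1 := n%:R + 1 : R.
have nn : 0 <= n%:R :> R by [].
have N10 : 0 < N1 by rewrite /N1; lra.
pose MM := (L + h i0) ^+ 2 / Ph + al * N1.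
have MM0 : 0 < MM by rewrite ltr_wpDl ?divr_ge0 ?sqr_ge0 ?mulr_gt0 // ltW.
pose e := Num.min (m / (2 * MM)) (Num.min (1 / 2) (m1 / 2)).
have e0 : 0 < e by rewrite !lt_min !divr_gt0 // mulr_gt0.
have eM : e * MM <= m / 2.
  have : e <= m / (2 * MM) by rewrite ge_min lexx.
  rewrite ler_pdivlMr ?mulr_gt0 //; lra.
have e12 : e <= 1 / 2 by rewrite !ge_min lexx orbT.
have em : e <= m1 / 2 by rewrite !ge_min lexx !orbT.
(* Young constant in al u rho_i <= e Ph / (4 N1) u^2 + G rho_i^2; summed over i, the u^2 parts cost
   at most a quarter of e Ph u^2. *)
pose G := N1 * al ^+ 2 / (e * Ph).
have ePh : 0 < e * Ph by rewrite mulr_gt0.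
have G0 : 0 <= G by rewrite divr_ge0 ?(ltW ePh) // mulr_ge0 ?sqr_ge0 // ltW.
pose c i := if phi i == 0 then 1 + (G + m) / h i else al / (phi i * Rs i).
have ccp i : cp i <= c i.
  by rewrite /cp /c; case: eqP => // _; rewrite lerDl divr_ge0 ?addr_ge0 // ltW.
have c0 i : 0 < c i by apply: lt_le_trans (ccp i).
pose k := Num.min (e * Ph / 4) (Num.min (m / 2) (Num.min (1 / 4) (m1 / 4))).
have k0 : 0 < k by rewrite !lt_min !divr_gt0.
have k1 : k <= e * Ph / 4 by rewrite ge_min lexx.
have k2 : k <= m / 2 by rewrite !ge_min lexx !orbT.
have k3 : k <= 1 / 4 by rewrite !ge_min lexx !orbT.
have k4 : k <= m1 / 4 by rewrite !ge_min lexx !orbT.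
exists c, e, k; split => //; first exact: ltW.
move=> u p rho up pL.
have r00 := sqr_ge0 (rho i0); have u0 := sqr_ge0 u.
have term i : rho i ^+ 2 <= \sum_i rho i ^+ 2.
  by rewrite (bigD1 i) //= lerDl sumr_ge0 // => j _; exact: sqr_ge0.
have T0 := term i0.
have TT : 0 <= \sum_i rho i ^+ 2 by apply: sumr_ge0 => i _; exact: sqr_ge0.
have ur : `|u * rho i0| <= (u ^+ 2 + rho i0 ^+ 2) / 2.
  rewrite ler_norml; have := sqr_ge0 (u - rho i0); have := sqr_ge0 (u + rho i0).
  have -> : (u - rho i0) ^+ 2 = u ^+ 2 + rho i0 ^+ 2 - 2 * (u * rho i0) by ring.
  have -> : (u + rho i0) ^+ 2 = u ^+ 2 + rho i0 ^+ 2 + 2 * (u * rho i0) by ring.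
  slim; lra.
split.
  rewrite /lyap /sqnorm mulrDr.
  have S1 : m1 / 2 * \sum_i rho i ^+ 2 <= \sum_i c i * rho i ^+ 2 / 2.
    rewrite mulr_sumr; apply: ler_sum => i _.
    have := ler_wpM2r (sqr_ge0 (rho i)) (le_trans (m1c i) (ccp i)); slim; lra.
  have E1 : - (e * ((u ^+ 2 + rho i0 ^+ 2) / 2)) <= e * (u * rho i0).
    by rewrite -mulrN ler_pM2l //; move: ur; rewrite ler_norml => /andP[].
  have E2 : e * (u ^+ 2 / 2) <= u ^+ 2 / 4 by have := ler_wpM2r u0 e12; slim; lra.
  have E3 : e * (rho i0 ^+ 2 / 2) <= m1 / 4 * \sum_i rho i ^+ 2.
    have := ler_wpM2r r00 em; have := ler_wpM2l (ltW m10) T0; slim; lra.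
  have E4 := ler_wpM2r u0 k3; have E5 := ler_wpM2r TT k4.
  have E6 : e * ((u ^+ 2 + rho i0 ^+ 2) / 2) = e * (u ^+ 2 / 2) + e * (rho i0 ^+ 2 / 2) by ring.
  move: S1 E1 E2 E3 E4 E5 E6; slim; lra.
set s := \sum_i rho i.
rewrite /lyap_dot /lin_q a0 !mul0r oppr0 add0r -/s.
have HX : u * (al * s) + \sum_i c i * (rho i * lin_r u rho i) <=
    e * Ph / 4 * u ^+ 2 - m * \sum_i rho i ^+ 2.
  have -> : u * (al * s) = \sum_i al * (u * rho i) by rewrite -!mulr_sumr /s; ring.
  rewrite -big_split /= -lerBlDr opprK.
  apply: (@le_trans _ _ (\sum_(i < n) e * Ph / (4 * N1) * u ^+ 2)); last first.
    rewrite sumr_const card_ord -[_ *+ n]mulr_natr.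
    have -> : e * Ph / (4 * N1) * u ^+ 2 * n%:R = e * Ph / 4 * u ^+ 2 * (n%:R / N1).
      by field; rewrite gt_eqF.
    rewrite ler_piMr //; first by rewrite mulr_ge0 // divr_ge0 // ltW.
    by rewrite ler_pdivrMr // /N1; slim; lra.
  rewrite mulr_sumr -big_split /=; apply: ler_sum => i _.
  have mch := mc i.
  have r0 := sqr_ge0 (rho i).
  have mchr := ler_wpM2r r0 mch.
  have Q : al * (u * rho i) <= e * Ph / (4 * N1) * u ^+ 2 + G * rho i ^+ 2.
    have H : 0 <= e * Ph / (4 * N1) * (u - 2 * N1 * al / (e * Ph) * rho i) ^+ 2.
      by rewrite mulr_ge0 ?sqr_ge0 // divr_ge0 // ?(ltW ePh) // mulr_ge0 // ltW.
    have E : e * Ph / (4 * N1) * (u - 2 * N1 * al / (e * Ph) * rho i) ^+ 2 =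
       e * Ph / (4 * N1) * u ^+ 2 + G * rho i ^+ 2 - al * (u * rho i).
      by rewrite /G; field; rewrite !gt_eqF.
    move: H; rewrite E; slim; lra.
  have cE : c i * (rho i * lin_r u rho i) =
    - (c i * phi i * Rs i) * (u * rho i) - c i * h i * rho i ^+ 2.
    by rewrite /lin_r a0 /h; ring.
  rewrite cE /c; move: mchr; rewrite /cp; case: eqVneq => [->|pn] mchr.
    have -> : (1 + (G + m) / h i) * h i * rho i ^+ 2 = h i * rho i ^+ 2 + (G + m) * rho i ^+ 2.
      by field; rewrite gt_eqF.
    have := mulr_ge0 (ltW (h0 i)) r0.
    have -> : (G + m) * rho i ^+ 2 = G * rho i ^+ 2 + m * rho i ^+ 2 by ring.
    rewrite mulr0 mul0r; move: Q; slim; lra.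
  have -> : al / (phi i * Rs i) * phi i * Rs i = al by field; rewrite pn gt_eqF.
  have : 0 <= e * Ph / (4 * N1) * u ^+ 2 by rewrite mulr_ge0 // divr_ge0 // ?(ltW ePh) //
    mulr_ge0 // ltW.
  move: mchr; slim; lra.
(* Of the damping e Ph u^2, a quarter pays for the mixed terms here, a quarter for [HX], and k takes
   at most a quarter. *)
have HY : e * ((al * s + p) * rho i0 + u * lin_r u rho i0) <=
    - (3 / 4 * (e * Ph)) * u ^+ 2 + e * MM * \sum_i rho i ^+ 2.
  have -> : - (3 / 4 * (e * Ph)) * u ^+ 2 + e * MM * \sum_i rho i ^+ 2 =
    e * (- (3 / 4 * Ph) * u ^+ 2 + MM * \sum_i rho i ^+ 2) by ring.
  rewrite ler_pM2l //.
  have B1 : s * rho i0 <= N1 * \sum_i rho i ^+ 2.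
    have := sqr_sum_le rho; rewrite -/s => H1.
    have := sqr_ge0 (s - rho i0).
    have -> : (s - rho i0) ^+ 2 = s ^+ 2 + rho i0 ^+ 2 - 2 * (s * rho i0) by ring.
    have : N1 * \sum_i rho i ^+ 2 = n%:R * \sum_i rho i ^+ 2 +
      \sum_i rho i ^+ 2 by rewrite /N1; ring.
    have := mulr_ge0 nn TT.
    move: H1 T0 TT; slim; lra.
  have B1' := ler_wpM2l (ltW al0) B1.
  have B2 : p * rho i0 <= L * `|u * rho i0|.
    apply: (le_trans (ler_norm _)); rewrite !normrM mulrA; exact: ler_wpM2r.
  have B3 : - (h i0 * (u * rho i0)) <= h i0 * `|u * rho i0|.
    rewrite -mulrN ler_pM2l // -normrN; exact: ler_norm.
  have B4 : (L + h i0) * `|u * rho i0| <= Ph / 4 * u ^+ 2 + (L + h i0) ^+ 2 / Ph * rho i0 ^+ 2.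
    have H : 0 <= Ph / 4 * (`|u| - 2 * (L + h i0) / Ph * `|rho i0|) ^+ 2.
      by rewrite mulr_ge0 ?sqr_ge0 // divr_ge0 // ltW.
    have E : Ph / 4 * (`|u| - 2 * (L + h i0) / Ph * `|rho i0|) ^+ 2 =
      Ph / 4 * `|u| ^+ 2 + (L + h i0) ^+ 2 / Ph * `|rho i0| ^+ 2 - (L +
        h i0) * (`|u| * `|rho i0|).
      by field; rewrite gt_eqF.
    move: H; rewrite E !real_normK ?num_real // normrM; slim; lra.
  have B5 : (L + h i0) ^+ 2 / Ph * rho i0 ^+ 2 <= (L + h i0) ^+ 2 / Ph * \sum_i rho i ^+ 2.
    by apply: ler_wpM2l => //; rewrite divr_ge0 ?sqr_ge0 // ltW.
  have -> : (al * s + p) * rho i0 + u * lin_r u rho i0 =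
    al * (s * rho i0) + p * rho i0 - (h i0 * (u * rho i0)) - Ph * u ^+ 2.
    by rewrite /lin_r a0 /h /Ph; ring.
  have -> : MM * \sum_i rho i ^+ 2 = (L + h i0) ^+ 2 / Ph * \sum_i rho i ^+ 2 +
    al * (N1 * \sum_i rho i ^+ 2).
    by rewrite /MM; ring.
  have E4 : (L + h i0) * `|u * rho i0| = L * `|u * rho i0| + h i0 * `|u * rho i0| by ring.
  move: B1' B2 B3 B4 B5 E4; slim; lra.
have HZ := ler_wpM2r TT eM.
have HK := ler_wpM2r u0 k1; have HK2 := ler_wpM2r TT k2.
rewrite /sqnorm mulrDr mulrDr.
have ePu := mulr_ge0 (ltW ePh) u0.
have E1 : e * Ph / 4 * u ^+ 2 = e * Ph * u ^+ 2 / 4 by ring.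
have E2 : - (3 / 4 * (e * Ph)) * u ^+ 2 = - (3 / 4) * (e * Ph * u ^+ 2) by ring.
move: up HX HY HZ HK HK2 ePu E1 E2; slim; lra.
Qed.

Lemma lyap_exists : exists c e k, lyap_good c e k.
Proof.
have [a0|a0] := eqVneq a 0; first exact: lyap_zero_slope.
by apply: lyap_pos_slope; rewrite lt_neqAle eq_sym a0.
Qed.

End LyapunovForm.

(** * Sums and products of absolutely continuous functions *)

Section AbsoluteContinuityAlgebra.
Variables (R : realType) (a b : R).
Implicit Types h k : R -> R.
Local Notation AC := (@absolutely_continuous R a b).

Lemma ac_cst (c : R) : AC (fun=> c).
Proof. by apply: (@lipschitz_ac R _ a b 0) => *; rewrite subrr normr0 mul0r. Qed.

Lemma acD h k : AC h -> AC k -> AC (fun s => h s + k s).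
Proof.
move=> ach ack; apply: (@ac_dominated R bool (fun i => if i then h else k) _ a b 1).
  by case.
move=> u v _ _ _; rewrite big_bool /= mul1r.
have -> : h v + k v - (h u + k u) = (h v - h u) + (k v - k u) by ring.
exact: ler_normD.
Qed.

Lemma acM h k (B : R) : AC h -> AC k ->
  (forall s, a <= s <= b -> `|h s| <= B /\ `|k s| <= B) -> AC (fun s => h s * k s).
Proof.
move=> ach ack hB; apply: (@ac_dominated R bool (fun i => if i then h else k) _ a b B).
  by case.
move=> u v au uv vb; rewrite big_bool /=.
have -> : h v * k v - h u * k u = k v * (h v - h u) + h u * (k v - k u) by ring.
apply: (le_trans (ler_normD _ _)); rewrite !normrM mulrDr.
have [_ kv] := hB v ltac:(lra); have [hu _] := hB u ltac:(lra).
by apply: lerD; apply: ler_wpM2r.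
Qed.

Lemma acZ (c : R) h : AC h -> AC (fun s => c * h s).
Proof.
move=> ach; apply: (@ac_dominated R unit (fun _ => h) _ a b `|c|) => // u v _ _ _.
by rewrite big_const card_unit /= addr0 -mulrBr normrM.
Qed.

Lemma ac_sum (I : Type) (r : seq I) (h : I -> R -> R) : (forall i, AC (h i)) ->
  AC (fun s => \sum_(i <- r) h i s).
Proof.
move=> ach; elim: r => [|i r IH].
  by under eq_fun do rewrite big_nil; exact: ac_cst.
by under eq_fun do rewrite big_cons; exact: (acD (ach i) IH).
Qed.

End AbsoluteContinuityAlgebra.

(** * The Lyapunov form along a path, and its sensitivity to errors in the field *)

Section LyapunovAlongPaths.
Variables (R : realType) (n : nat) (c : 'I_n -> R) (e : R) (i0 : 'I_n).

Lemma lyap_ac (a b B : R) (u : R -> R) (rho : 'I_n -> R -> R) :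
  absolutely_continuous a b u -> (forall i, absolutely_continuous a b (rho i)) ->
  (forall s, a <= s <= b -> `|u s| <= B /\ forall i, `|rho i s| <= B) ->
  absolutely_continuous a b (fun s => lyap i0 c e (u s) (fun i => rho i s)).
Proof.
move=> acu acr H; rewrite /lyap.
have ac2 : absolutely_continuous a b (fun s => 2^-1 * (u s * u s)).
  by apply: acZ; apply: (@acM R a b _ _ B) => // s sab; have [] := H s sab.
have acr2 : absolutely_continuous a b (fun s => \sum_i c i / 2 * (rho i s * rho i s)).
  apply: ac_sum => i; apply: acZ; apply: (@acM R a b _ _ B) => // s sab.
  by have [_ Hr] := H s sab; split; apply: Hr.
have acx : absolutely_continuous a b (fun s => e * (u s * rho i0 s)).
  by apply: acZ; apply: (@acM R a b _ _ B) => // s sab; have [Hu Hr] := H s sab; split.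
have E : (fun s => u s ^+ 2 / 2 + \sum_i c i * rho i s ^+ 2 / 2 + e * (u s * rho i0 s)) =
  (fun s => 2^-1 * (u s * u s) + \sum_i c i / 2 * (rho i s * rho i s) + e * (u s * rho i0 s)).
  apply/funext => s; congr (_ + _ + _); first by ring.
  by apply: eq_bigr => i _; ring.
by rewrite E; apply: acD => //; exact: acD.
Qed.

Lemma lyap_is_derive (u : R -> R) (rho : 'I_n -> R -> R) (t y : R) (v : 'I_n -> R) :
  is_derive t 1 u y -> (forall i, is_derive t 1 (rho i) (v i)) ->
  is_derive t 1 (fun s => lyap i0 c e (u s) (fun i => rho i s))
    (lyap_dot i0 c e (u t) (fun i => rho i t) y v).
Proof.
move=> du dr; rewrite /lyap.
have E : (fun s => u s ^+ 2 / 2 + \sum_i c i * rho i s ^+ 2 / 2 + e * (u s * rho i0 s)) =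
  2^-1 \*: (u * u) + \sum_i ((c i / 2) \*: (rho i * rho i)) + e \*: (u * rho i0).
  apply/funext => s; rewrite -[RHS]/(2^-1 * (u s * u s) +
    (\sum_i ((c i / 2) \*: (rho i * rho i))) s + e * (u s * rho i0 s)) fct_sumE.
  congr (_ + _ + _); first by ring.
  by apply: eq_bigr => i _; rewrite -[RHS]/(c i / 2 * (rho i s * rho i s)); ring.
rewrite E.
have d1 := is_deriveZ 2^-1 (is_deriveM du du).
have d2 := is_derive_sum (fun i => is_deriveZ (c i / 2) (is_deriveM (dr i) (dr i))).
have d3 := is_deriveZ e (is_deriveM du (dr i0)).
apply: is_derive_eq (is_deriveD (is_deriveD d1 d2) d3) _.
rewrite /lyap_dot /GRing.scale /=; congr (_ + _ + _); first by field.
  by apply: eq_bigr => i _; field.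
by ring.
Qed.

Hypotheses (c0 : forall i, 0 < c i) (e0 : 0 <= e).

Lemma sqr_le_sqnorm (u : R) (rho : 'I_n -> R) :
  u ^+ 2 <= sqnorm u rho /\ forall i, rho i ^+ 2 <= sqnorm u rho.
Proof.
have T0 : 0 <= \sum_i rho i ^+ 2 by apply: sumr_ge0 => j _; exact: sqr_ge0.
split=> [|i]; rewrite /sqnorm; first by rewrite lerDl.
rewrite (bigD1 i) //= addrCA lerDl addr_ge0 ?sqr_ge0 // sumr_ge0 // => j _.
exact: sqr_ge0.
Qed.

Lemma mul_le_sqnorm (u : R) (rho : 'I_n -> R) i : `|u| * `|rho i| <= sqnorm u rho.
Proof.
have [H1 H2] := sqr_le_sqnorm u rho; have := H2 i; have := sqr_ge0 (`|u| - `|rho i|).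
have -> : (`|u| - `|rho i|) ^+ 2 = `|u| ^+ 2 + `|rho i| ^+ 2 - 2 * (`|u| * `|rho i|) by ring.
rewrite !real_normK ?num_real //; lra.
Qed.

Lemma lyap_le (u : R) (rho : 'I_n -> R) :
  lyap i0 c e u rho <= (1 + \sum_i c i + e) * sqnorm u rho.
Proof.
have [H1 H2] := sqr_le_sqnorm u rho; have N0 := sqnorm_ge0 u rho.
have e0' := e0.
rewrite /lyap !mulrDl mul1r; apply: lerD; first apply: lerD.
- by have := sqr_ge0 u; lra.
- rewrite mulr_suml; apply: ler_sum => i _.
  have := ler_wpM2l (ltW (c0 i)) (H2 i); have := mulr_ge0 (ltW (c0 i)) (sqr_ge0 (rho i)); lra.
- apply: ler_wpM2l => //; apply: (le_trans (ler_norm _)); rewrite normrM; exact: mul_le_sqnorm.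
Qed.

(** Errors proportional to |u| cost a multiple of eta times the squared norm, which the strict decay
    can absorb. *)
Lemma lyap_dot_perturb (u eta y y' : R) (rho v v' : 'I_n -> R) : 0 <= eta ->
  `|y - y'| <= eta * `|u| -> (forall i, `|v i - v' i| <= eta * `|u|) ->
  lyap_dot i0 c e u rho y v <= lyap_dot i0 c e u rho y' v' + eta * (1 + \sum_i c i +
    2 * e) * sqnorm u rho.
Proof.
move=> eta0 Hy Hv; have [H1 H2] := sqr_le_sqnorm u rho; have N0 := sqnorm_ge0 u rho.
rewrite -lerBlDl.
have -> : lyap_dot i0 c e u rho y v - lyap_dot i0 c e u rho y' v' =
  u * (y - y') + \sum_i c i * (rho i * (v i - v' i)) + e * ((y - y') * rho i0 +
    u * (v i0 - v' i0)).
  rewrite /lyap_dot.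
  have -> : \sum_i c i * (rho i * (v i - v' i)) =
    \sum_i c i * (rho i * v i) - \sum_i c i * (rho i * v' i).
    by rewrite -sumrB; apply: eq_bigr => i _; ring.
  ring.
have uu : `|u| * `|u| <= sqnorm u rho by rewrite -normrM -expr2 ger0_norm ?sqr_ge0.
have t1 : u * (y - y') <= eta * sqnorm u rho.
  apply: (le_trans (ler_norm _)); rewrite normrM.
  apply: (@le_trans _ _ (`|u| * (eta * `|u|))); first exact: ler_wpM2l.
  by rewrite mulrCA; apply: ler_wpM2l.
have t2 i (d : R) : `|d| <= eta * `|u| -> rho i * d <= eta * sqnorm u rho.
  move=> Hd; apply: (le_trans (ler_norm _)); rewrite normrM.
  apply: (@le_trans _ _ (`|rho i| * (eta * `|u|))); first exact: ler_wpM2l.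
  by rewrite mulrCA; apply: ler_wpM2l => //; rewrite mulrC; exact: mul_le_sqnorm.
have t3 : u * (v i0 - v' i0) <= eta * sqnorm u rho.
  apply: (le_trans (ler_norm _)); rewrite normrM.
  apply: (@le_trans _ _ (`|u| * (eta * `|u|))); first exact: ler_wpM2l.
  by rewrite mulrCA; apply: ler_wpM2l.
have t4 : \sum_i c i * (rho i * (v i - v' i)) <= (\sum_i c i) * (eta * sqnorm u rho).
  by rewrite mulr_suml; apply: ler_sum => i _; apply: ler_wpM2l; [exact: ltW|exact: t2].
have t5 : e * ((y - y') * rho i0 + u * (v i0 - v' i0)) <= e * (2 * (eta * sqnorm u rho)).
  by apply: ler_wpM2l => //; have := t2 i0 _ Hy; rewrite mulrC; lra.
have -> : eta * (1 + \sum_i c i + 2 * e) * sqnorm u rho = eta * sqnorm u rho +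
  (\sum_i c i) * (eta * sqnorm u rho) + e * (2 * (eta * sqnorm u rho)) by ring.
lra.
Qed.

End LyapunovAlongPaths.

(** * Asymptotic stability of the equilibrium *)

Section LocalStability.
Variables (R : realType) (n : nat) (M : model R n) (b L qs qad a : R) (phi : 'I_n ->
  R) (i0 : 'I_n).
Hypothesis tm : tame M b L.
Hypotheses (qs0 : 0 < qs) (qsa : qs < qad) (qadb : qad <= b).
Hypothesis mu_sat_ge : forall q : R, qs <= q -> mu M q = mumax M.
Hypotheses (dalpha : is_derive qs 1 (alpha M) (- a)) (a0 : 0 <= a).
Hypothesis drate : forall i, is_derive qs 1 (price_rate M i) (phi i).
Hypotheses (phi0 : forall i, 0 <= phi i) (phi_gt0 : 0 < phi i0).
Hypothesis balance : alpha M qs * \sum_i Rhat M qs 0 i = mumax M.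
Hypothesis bounded : forall x, caratheodory_solution (field_ad M qad) x -> X_ad qad (x 0) ->
  exists B, forall t, 0 <= t -> in_range qad B (x t).
Ltac slim := clear - R n M b L qs qad a phi i0 tm qs0 qsa qadb mu_sat_ge dalpha a0 drate phi0
  phi_gt0
  balance bounded.

Local Notation xs := (Rhat M qs, qs).
Local Notation Rs i := (Rhat M qs 0 i).
Local Notation dq x := (x.2 - qs).
Local Notation dr x := (fun i => x.1 0 i - Rs i).

Lemma qs_in : 0 <= qs <= b.
Proof. by have h1 := qs0; have h2 := qsa; have h3 := qadb; lra. Qed.

Lemma Rs_gt0 i : 0 < Rs i /\ K M i = exit_rate M i qs * Rs i.
Proof.
have /andP[al0 _] := tame_alpha tm qs_in; have /andP[h0 _] := tame_rate tm i qs_in.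
have e0 : 0 < exit_rate M i qs by rewrite exit_rateE; lra.
have /andP[K0 _] := tame_K tm i.
by split; rewrite mxE ?divr_gt0 // mulrC divfK // gt_eqF.
Qed.

Lemma equilibrium : fixed_point (field_ad M qad) xs.
Proof.
rewrite /fixed_point (@field_ad_free _ _ _ qad).
- rewrite [LHS]surjective_pairing; congr pair.
    apply/rowP => i; rewrite field0_1E [RHS]mxE /=.
    by have [_ ->] := Rs_gt0 i; rewrite subrr.
  by rewrite /= balance mu_sat_ge // subrr.
- by move=> i; apply: ltW; exact: (Rs_gt0 i).1.
- by rewrite /alpha_ad qsa.
Qed.

(** For fixed q the unmodified field is affine in the R_i, so every error carries a factor |u|: it
    is a first-order remainder of alpha or of f_i o p, or an increment of size L |u| times a
    deviation of size d. *)
Lemma local_estimate (eta : R) : 0 < eta -> exists2 d, 0 < d & forall x : state R n,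
  `|dq x| <= d -> (forall i, `|dr x i| <= d) ->
  [/\ 0 <= x.2 < qad,
    forall i, `|(field0 M x).1 0 i - lin_r a (alpha M qs) phi (fun i => price_rate M i qs) (fun
      i => Rs i) (dq x) (dr x) i| <= eta * `|dq x|
  & exists p, [/\ dq x * p <= 0, `|p| <= L * `|dq x| &
      `|(field0 M x).2 - lin_q a (alpha M qs) (fun i => Rs i) (dq x) p (dr x)| <= eta * `|dq x|]].
Proof.
move=> eta0; have L0 := tame_L_gt0 tm.
have h1 := qs0; have h2 := qsa; have h3 := qadb.
pose S := \sum_i Rs i.
have S0 : 0 <= S by apply: sumr_ge0 => i _; apply: ltW; exact: (Rs_gt0 i).1.
pose e1 := eta / (4 * (S + 1)).
have e10 : 0 < e1 by rewrite divr_gt0 // mulr_gt0 //; lra.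
have e1E : e1 * S <= eta / 4.
  have : e1 * (S + 1) = eta / 4 by rewrite /e1; field; rewrite gt_eqF //; lra.
  lra.
have /is_derive_slope /(_ e1 e10)[da da0 Ha] := dalpha.
have /choice[dH HH] : forall i, exists d : R, 0 < d /\ forall s, `|s - qs| < d ->
    `|price_rate M i s - price_rate M i qs - phi i * (s - qs)| <= e1 * `|s - qs|.
  move=> i; have /is_derive_slope /(_ e1 e10)[d d0 Hd] := drate i.
  by exists d; split => // s; exact: Hd.
have [d1 d10 d1H] := pos_lower_bound (fun i => (HH i).1).
pose nn := n%:R + 2 : R.
have nn0 : 0 < nn by rewrite /nn; have := ler0n R n; lra.
pose d2 := eta / (4 * (nn * L)).
have nL : 0 < nn * L by rewrite mulr_gt0.
have d20 : 0 < d2 by rewrite divr_gt0 // mulr_gt0.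
pose d := Num.min (Num.min (da / 2) (d1 / 2)) (Num.min d2 (Num.min (qs / 2) ((qad - qs) / 2))).
have qq : 0 < qad - qs by lra.
have d0 : 0 < d by rewrite !lt_min d20 (divr_gt0 da0) // (divr_gt0 d10) // (divr_gt0 h1) //
  (divr_gt0 qq).
have k1 : d <= da / 2 by rewrite !ge_min lexx.
have k2 : d <= d1 / 2 by rewrite !ge_min lexx !orbT.
have k3 : d <= d2 by rewrite !ge_min lexx !orbT.
have k4 : d <= qs / 2 by rewrite !ge_min lexx !orbT.
have k5 : d <= (qad - qs) / 2 by rewrite !ge_min lexx !orbT.
have nLd : nn * L * d <= eta / 4.
  have E : nn * L * d2 = eta / 4 by rewrite /d2; field; rewrite !gt_eqF.
  by rewrite -E ler_pM2l.
exists d => // x ud rd.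
set u := dq x in ud *.
have [u1 u2] : - d <= u /\ u <= d by move: ud; rewrite ler_norml => /andP[].
have uE : x.2 = qs + u by rewrite /u; ring.
have xb : 0 <= x.2 <= b by rewrite uE; move: u1 u2 k4 k5 h1 h2 h3; slim; lra.
have u0 := normr_ge0 u.
have qa : `|alpha M x.2 - alpha M qs + a * u| <= e1 * `|u|.
  have := Ha x.2 I; rewrite -/u => /(_ ltac:(move: ud k1 da0; slim; lra)).
  by rewrite mulNr opprK.
have qH i : `|price_rate M i x.2 - price_rate M i qs - phi i * u| <= e1 * `|u|.
  by apply: (HH i).2; rewrite -/u; have := d1H i; move: ud k2 d10; slim; lra.
have La : `|alpha M x.2 - alpha M qs| <= L * `|u| := tame_alpha_lip tm qs_in xb.
have LH i : `|price_rate M i x.2 - price_rate M i qs| <= L * `|u| := tame_rate_lip tm i qs_in xb.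
have Lm : `|mu M x.2 - mu M qs| <= L * `|u| := tame_mu_lip tm qs_in xb.
split.
- by rewrite uE; move: u1 u2 k4 k5 h1 h2; slim; lra.
- move=> i; have [R0 KE] := Rs_gt0 i.
  have RS : Rs i <= S.
    by rewrite /S (bigD1 i) //= lerDl sumr_ge0 // => j _; apply: ltW; exact: (Rs_gt0 j).1.
  rewrite field0_1E KE !exit_rateE /lin_r.
  set H := price_rate M i x.2 in qH LH *; set Hs := price_rate M i qs in qH LH *.
  set A := alpha M x.2 in qa La *; set As := alpha M qs in qa La *.
  have -> : (Hs + As) * Rs i - (H + A) * x.1 0 i - ((a - phi i) * Rs i * u - (Hs +
    As) * (x.1 0 i - Rs i)) =
    - (Rs i * ((H - Hs - phi i * u) + (A - As + a * u))) - ((H - Hs) +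
      (A - As)) * (x.1 0 i - Rs i) by ring.
  apply: (le_trans (ler_normB _ _)); rewrite normrN !normrM (gtr0_norm R0).
  have B1 : Rs i * `|H - Hs - phi i * u + (A - As + a * u)| <= S * (2 * (e1 * `|u|)).
    apply: ler_pM => //; first exact: ltW.
    by apply: (le_trans (ler_normD _ _)); have := qH i; rewrite -/H -/Hs; move: qa; slim; lra.
  have B2 : `|H - Hs + (A - As)| * `|x.1 0 i - Rs i| <= 2 * (L * `|u|) * d.
    apply: ler_pM => //; apply: (le_trans (ler_normD _ _)).
    by have := LH i; rewrite -/H -/Hs; move: La; slim; lra.
  have B3 : 2 * (L * `|u|) * d <= nn * L * d * `|u|.
    have -> : 2 * (L * `|u|) * d = 2 * (L * d * `|u|) by ring.
    have -> : nn * L * d * `|u| = nn * (L * d * `|u|) by ring.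
    apply: ler_wpM2r; first by rewrite mulr_ge0 // mulr_ge0 // ltW.
    by rewrite /nn; have := ler0n R n; slim; lra.
  have B4 := ler_wpM2r u0 nLd; have B5 := ler_wpM2r u0 e1E.
  have E5 : S * (2 * (e1 * `|u|)) = 2 * (e1 * S * `|u|) by ring.
  have := mulr_ge0 (ltW eta0) u0; move: B1 B2 B3 B4 B5 E5; slim; lra.
(* It vanishes for q >= q^s by saturation and is nonnegative below, which gives its sign against
   u. *)
- exists (mumax M - mu M x.2).
  have mus : mu M qs = mumax M by apply: mu_sat_ge.
  split.
  + have [q1|q1] := leP qs x.2.
      by rewrite mu_sat_ge // subrr mulr0.
    have /andP[_ m1] := tame_mu tm (proj1 (andP xb)).
    by apply: mulr_le0_ge0; [rewrite /u subr_le0 ltW|rewrite subr_ge0].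
  + by rewrite distrC -mus.
  + rewrite /lin_q /= -/S.
    set A := alpha M x.2 in qa La *; set As := alpha M qs in qa La *.
    set T := \sum_k x.1 0 k.
    have TS : \sum_i (x.1 0 i - Rs i) = T - S by rewrite sumrB.
    have bal : As * S = mumax M := balance.
    rewrite TS -bal.
    have -> : A * T - mu M x.2 - (- (a * S * u) + As * (T - S) + (As * S - mu M x.2)) =
      S * (A - As + a * u) + (A - As) * (T - S) by ring.
    apply: (le_trans (ler_normD _ _)); rewrite !normrM (ger0_norm S0).
    have TSd : `|T - S| <= n%:R * d.
      rewrite -TS; apply: (le_trans (ler_norm_sum _ _ _)).
      rewrite -[n in n%:R]card_ord mulr_natl -sumr_const; exact: ler_sum.
    have B1 : S * `|A - As + a * u| <= S * (e1 * `|u|) by apply: ler_wpM2l.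
    have B2 : `|A - As| * `|T - S| <= L * `|u| * (n%:R * d) by apply: ler_pM.
    have B3 : L * `|u| * (n%:R * d) <= nn * L * d * `|u|.
      have -> : L * `|u| * (n%:R * d) = n%:R * (L * d * `|u|) by ring.
      have -> : nn * L * d * `|u| = nn * (L * d * `|u|) by ring.
      apply: ler_wpM2r; first by rewrite mulr_ge0 // mulr_ge0 // ltW.
      by rewrite /nn; slim; lra.
    have B4 := ler_wpM2r u0 nLd; have B5 := ler_wpM2r u0 e1E.
    have E5 : S * (e1 * `|u|) = e1 * S * `|u| by ring.
    have := mulr_ge0 (ltW eta0) u0; move: B1 B2 B3 B4 B5 E5; slim; lra.
Qed.

Lemma euclidean_dist_sqnorm (x : state R n) :
  euclidean_dist x xs = Num.sqrt (sqnorm (dq x) (dr x)).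
Proof. by rewrite /euclidean_dist /sqnorm addrC. Qed.

Lemma equilibrium_stable : locally_asymptotically_stable (field_ad M qad) (X_ad qad) xs.
Proof.
have /andP[al0 _] := tame_alpha tm qs_in.
have L0 := tame_L_gt0 tm.
have fr0 i : 0 <= price_rate M i qs by have /andP[] := tame_rate tm i qs_in.
have [c [e [k [k0 c0 e0 Hk]]]] := lyap_exists a0 al0 (ltW L0) phi0 fr0 (fun i => (Rs_gt0 i).1)
  phi_gt0.
pose K1 := 1 + \sum_i c i + 2 * e.
have sc : 0 <= \sum_i c i by apply: sumr_ge0 => i _; exact: ltW.
have K10 : 0 < K1 by rewrite /K1; lra.
pose K2 := 1 + \sum_i c i + e.
have K20 : 0 < K2 by rewrite /K2; lra.
(* With this eta the nonlinear error consumes half of the decay k. *)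
have [d d0 Hd] := local_estimate (divr_gt0 k0 (mulr_gt0 (ltr0n R 2) K10) : 0 < k / (2%:R * K1)).
pose V (x : state R n) := lyap i0 c e (dq x) (dr x).
have NV (x : state R n) : k * sqnorm (dq x) (dr x) <= V x.
  by apply: (Hk (dq x) 0 (dr x) _ _).1; rewrite ?mulr0 ?normr0 // mulr_ge0 // ltW.
have VN (x : state R n) : V x <= K2 * sqnorm (dq x) (dr x) by apply: lyap_le.
(* By coercivity, V < v0 forces the deviation into the neighbourhood of size d where the local
   estimate holds. *)
pose v0 := k * d ^+ 2.
have v00 : 0 < v0 by rewrite mulr_gt0 // exprn_gt0.
(* The level w = 0 will give trapping in sublevel sets of V, and w > 0 a uniform decay down to V <=
   w. *)
have sol x : caratheodory_solution (field_ad M qad) x -> X_ad qad (x 0) ->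
  (forall T, 0 <= T -> absolutely_continuous 0 T (fun s => V (x s))) /\
  forall w, 0 <= w -> {ae (@lebesgue_measure R), forall t, 0 < t -> V (x t) < v0 ->
    w <= V (x t) ->
     straddle (- (k / (2 * K2) * w)) (fun s => V (x s)) t}.
  move=> xsol x0; have [xo xac xae] := xsol; split.
    move=> T T0; have [B HB] := bounded xsol x0; have [ac1 ac2] := xac T T0.
    have addc (h : R -> R) (m : R) : absolutely_continuous 0 T h ->
      absolutely_continuous 0 T (fun s => h s - m).
      by move=> ach; apply: (acD ach); exact: ac_cst.
    pose B' := `|B| + qad + \sum_i Rs i + qs.
    apply: (@lyap_ac R n c e i0 0 T B' (fun s => (x s).2 - qs) (fun i s => (x s).1 0 i - Rs i)).
    - exact: addc.
    - by move=> i; exact: addc.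
    - move=> s /andP[s0 _]; have [r0 /andP[q0 q1]] := HB s s0.
      have h1 := qs0; have h2 := qsa.
      have S0 : 0 <= \sum_i Rs i by apply: sumr_ge0 => i _; apply: ltW; exact: (Rs_gt0 i).1.
      have BB := ler_norm B; have BB0 := normr_ge0 B.
      split; first by rewrite ler_norml /B'; move: q0 q1 BB0 h1 h2 S0; slim; lra.
      move=> i; have /andP[ri0 riB] := r0 i; have [Ri0 _] := Rs_gt0 i.
      have RS : Rs i <= \sum_i Rs i.
        by rewrite (bigD1 i) //= lerDl sumr_ge0 // => j _; apply: ltW; exact: (Rs_gt0 j).1.
      by rewrite ler_norml /B'; move: ri0 riB BB BB0 Ri0 RS h1 h2; slim; lra.
  move=> w w0; apply: ae_imp xae => t Ht t0 Vt wV; have {Ht}[Hr Hq] := Ht t0.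
  have N0 := sqnorm_ge0 (dq (x t)) (dr (x t)).
  have Nd : sqnorm (dq (x t)) (dr (x t)) < d ^+ 2.
    by rewrite -(ltr_pM2l k0); apply: le_lt_trans (NV _) Vt.
  have [S1 S2] := sqr_le_sqnorm (dq (x t)) (dr (x t)).
  have sq (m : R) : m ^+ 2 <= sqnorm (dq (x t)) (dr (x t)) -> `|m| <= d.
    move=> H; rewrite -(ler_pXn2r (_ : (0 < 2)%N)) ?nnegrE ?(ltW d0) //.
    by rewrite real_normK ?num_real // ltW // (le_lt_trans H).
  have [/andP[qt0 qta] Er [p [up pL Eq]]] := Hd (x t) (sq _ S1) (fun i => sq _ (S2 i)).
  have FE : field_ad M qad (x t) = field0 M (x t).
    apply: field_ad_free; first exact: (xo t (ltW t0)).1.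
    by rewrite /alpha_ad qta.
  rewrite FE in Hr Hq.
  have du : is_derive t 1 (fun s => (x s).2 - qs) (field0 M (x t)).2.
    have := is_deriveB Hq (is_derive_cst qs t 1); rewrite subr0; apply.
  have dri i : is_derive t 1 (fun s => (x s).1 0 i - Rs i) ((field0 M (x t)).1 0 i).
    have := is_deriveB (Hr i) (is_derive_cst (Rs i) t 1); rewrite subr0; apply.
  have dV := lyap_is_derive c e i0 du dri.
  apply: (straddle_derive dV).
  have eta0 : 0 <= k / (2 * K1) by rewrite divr_ge0 // ltW // mulr_gt0.
  apply: (le_trans (@lyap_dot_perturb R n c e i0 c0 e0 _ _ _ _ (dr (x t)) _ _ eta0 Eq Er)).
  have [_ H2] := Hk _ p (dr (x t)) up pL.
  have -> : k / (2 * K1) * (1 + \sum_i c i + 2 * e) * sqnorm (dq (x t)) (dr (x t)) =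
     k / 2 * sqnorm (dq (x t)) (dr (x t)).
    by rewrite -/K1; field; rewrite gt_eqF.
  have H3 : k / (2 * K2) * w <= k / 2 * sqnorm (dq (x t)) (dr (x t)).
    have -> : k / 2 * sqnorm (dq (x t)) (dr (x t)) =
      k / (2 * K2) * (K2 * sqnorm (dq (x t)) (dr (x t))).
      by field; rewrite gt_eqF.
    apply: ler_wpM2l; first by rewrite divr_ge0 // ltW // mulr_gt0.
    exact: le_trans wV (VN _).
  move: H2 H3; slim; lra.
have trapped x v : caratheodory_solution (field_ad M qad) x -> X_ad qad (x 0) ->
    v <= v0 -> V (x 0) < v -> forall t, 0 <= t -> V (x t) < v.
  move=> xsol x0 vv0 V0 t t0; have [acV sV] := sol x xsol x0.
  apply: (le_lt_trans _ (V0)); apply: (ac_trapped acV _ V0) => //.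
  apply: ae_imp (sV 0 (lexx _)) => s Hs s0 Vs; rewrite mulr0 oppr0 in Hs.
  apply: Hs => //; first exact: lt_le_trans vv0.
  by apply: le_trans (NV _); rewrite mulr_ge0 ?sqnorm_ge0 // ltW.
have dist_lt (x : state R n) (r : R) : 0 < r -> V x < k * r ^+ 2 -> euclidean_dist x xs < r.
  move=> r0 Vr; rewrite euclidean_dist_sqnorm -[ltRHS](ger0_norm (ltW r0)) -sqrtr_sqr.
  rewrite ltr_sqrt ?exprn_gt0 // -(ltr_pM2l k0); exact: le_lt_trans (NV _) Vr.
have start (r : R) : 0 < r ->
  exists2 d', 0 < d' & forall x : state R n, euclidean_dist x xs < d' -> V x < k * r ^+ 2.
  (* From q <= 1 and q K2 <= k it follows that K2 (r q)^2 <= k r^2. *)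
  move=> r0; pose q := Num.min 1 (k / K2).
  have q0 : 0 < q by rewrite lt_min ltr01 divr_gt0.
  have q1 : q <= 1 by rewrite ge_min lexx.
  have qk : q * K2 <= k by rewrite -ler_pdivlMr // ge_min lexx orbT.
  exists (r * q); first by rewrite mulr_gt0.
  move=> x; rewrite euclidean_dist_sqnorm -[X in _ < X](ger0_norm (_ : 0 <= r * q)); last first.
    by rewrite mulr_ge0 // ltW.
  rewrite -sqrtr_sqr ltr_sqrt; last by rewrite exprn_gt0 // mulr_gt0.
  move=> H; apply: (le_lt_trans (VN x)).
  apply: (@lt_le_trans _ _ (K2 * (r * q) ^+ 2)); first by rewrite ltr_pM2l.
  have -> : K2 * (r * q) ^+ 2 = r ^+ 2 * q * (q * K2) by ring.
  rewrite [k * _]mulrC; apply: ler_pM => //.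
  - by rewrite mulr_ge0 ?sqr_ge0 // ltW.
  - by rewrite mulr_ge0 // ltW.
  - by rewrite ler_piMr ?sqr_ge0.
split.
  move=> r r0; pose r1 := Num.min r d.
  have r10 : 0 < r1 by rewrite lt_min r0.
  have [d' d'0 Hd'] := start r1 r10; exists d' => // x xsol x0 x0d t t0.
  have r1d : k * r1 ^+ 2 <= v0.
    by rewrite ler_pM2l // ler_pXn2r ?nnegrE ?(ltW r10) ?(ltW d0) // ge_min lexx orbT.
  apply: (@lt_le_trans _ _ r1); last by rewrite ge_min lexx.
  by apply: dist_lt => //; apply: (trapped x _ xsol x0 r1d) => //; exact: Hd'.
have [d' d'0 Hd'] := start d d0; exists d' => // x xsol x0 x0d.
have Vlt := trapped x _ xsol x0 (lexx _) (Hd' _ x0d).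
have [acV sV] := sol x xsol x0.
apply/cvgrPdist_lt => r r0.
pose w := k * r ^+ 2 / 2.
have w0 : 0 < w by rewrite divr_gt0 // mulr_gt0 // exprn_gt0.
have cc : 0 < k / (2 * K2) * w by rewrite mulr_gt0 // divr_gt0 // mulr_gt0.
have [|T T0 HT] := ac_decay (L := w) cc acV.
  apply: ae_imp (sV w (ltW w0)) => s Hs s0 ws; apply: Hs => //; last exact: ltW.
  by apply: Vlt; exact: ltW.
exists T; split; first exact: num_real.
move=> t Tt; rewrite sub0r normrN ger0_norm ?sqrtr_ge0 //.
apply: dist_lt => //; apply: (le_lt_trans (HT t (ltW Tt))).
by rewrite /w; have : 0 < k * r ^+ 2 by [rewrite mulr_gt0 // exprn_gt0]; slim; lra.
Qed.

End LocalStability.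

(** * Signs of derivatives, and the chain rule for the price response *)

Section Derivatives.
Variable R : realType.

Lemma slope_ge0_of_nondecreasing (h : R -> R) (t d r : R) : 0 < r -> is_derive t 1 h d ->
  (forall s, t <= s -> s <= t + r -> h t <= h s) -> 0 <= d.
Proof.
move=> r0 /is_derive_slope H mono; rewrite leNgt; apply/negP => d0.
have [r1 r10 Hr] := H (- d / 2) ltac:(lra).
pose s := t + Num.min r (r1 / 2).
have m0 : 0 < Num.min r (r1 / 2) by rewrite lt_min r0; lra.
have m1 : Num.min r (r1 / 2) <= r by rewrite ge_min lexx.
have m2 : Num.min r (r1 / 2) <= r1 / 2 by rewrite ge_min lexx orbT.
have st : s - t = Num.min r (r1 / 2) by rewrite /s; ring.
have := Hr s I; rewrite st gtr0_norm // => /(_ ltac:(lra)).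
rewrite ler_norml => /andP[_].
have := mono s ltac:(lra) ltac:(rewrite /s; lra).
have := mulr_gt0 (_ : 0 < - d) m0; rewrite oppr_gt0 => /(_ d0).
set m := Num.min _ _; have -> : - d / 2 * m = - d * m / 2 by ring.
have -> : d * m = - (- d * m) by ring.
lra.
Qed.

(** Near q < q_m the price is the linear map beta q, so the approximation of f_i is only rescaled;
    beta s stays nonnegative, as the derivative within the half-line demands. *)
Lemma price_rate_is_derive (n : nat) (M : model R n) (i : 'I_n) (q : R) :
  0 < beta M -> 0 < q -> q < qm M -> continuously_differentiable_ge0 (f M i) ->
  is_derive q 1 (price_rate M i) (beta M * derivative_ge0 (f M i) (beta M * q)).
Proof.
move=> b0 q0 qq [df _].
have p0 : 0 <= beta M * q by rewrite mulr_ge0 // ltW.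
apply/is_derive_slope => e e0.
have [r r0 Hr] := derivative_ge0_slope (df _ p0) (divr_gt0 e0 b0).
exists (Num.min (r / beta M) (Num.min q (qm M - q))).
  by rewrite !lt_min divr_gt0 //= q0; lra.
move=> s _; rewrite !lt_min => /and3P[s1 s2 s3].
have s0 : 0 <= s by move: s2; rewrite ltr_norml; lra.
have sm : s <= qm M by move: s3; rewrite ltr_norml; lra.
rewrite /price_rate /price sm (ltW qq).
have E : beta M * s - beta M * q = beta M * (s - q) by ring.
have /= := Hr (beta M * s) ltac:(rewrite /= mulr_ge0 ?(ltW b0); done).
rewrite E normrM (gtr0_norm b0) mulrC -ltr_pdivlMr // => /(_ s1).
have -> : e / beta M * (`|s - q| * beta M) = e * `|s - q| by field; rewrite gt_eqF.
have -> // : beta M * derivative_ge0 (f M i) (beta M * q) * (s - q) =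
  derivative_ge0 (f M i) (beta M * q) * (beta M * (s - q)) by ring.
Qed.

End Derivatives.

Ltac slim := clear.

Unset Implicit Arguments.
Set Strict Implicit.
Set Printing Implicit Defensive.

Theorem theorem4p9 (R : realType) (n : nat) (M : model R n)
    (qs qu qdag qad : R)
    (n_ge1 : (1 <= n)%N)
    (K_gt0 : forall i, 0 < K M i) (mumax_gt0 : 0 < mumax M)
    (qc_gt0 : 0 < qc M) (beta_gt0 : 0 < beta M)
    (qm_gt0 : 0 < qm M) (qmax_gt0 : 0 < qmax M)
    (qmax_ge : 2 * qm M <= qmax M)
    (alpha_C1 : continuously_differentiable_ge0 (alpha M))
    (alpha_gt0 : forall q : R, 0 <= q -> q < qmax M -> 0 < alpha M q)
    (alpha_decr : forall q q' : R, 0 <= q -> q < q' -> q' < qmax M ->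
       alpha M q' < alpha M q)
    (alpha_eq0 : forall q : R, qmax M <= q -> alpha M q = 0)
    (f_ge0 : forall i (p : R), 0 <= p -> 0 <= f M i p)
    (f_ndecr : forall i (p p' : R), 0 <= p -> p <= p' -> f M i p <= f M i p')
    (f_C1 : forall i, continuously_differentiable_ge0 (f M i))
    (f_deriv_gt0 : exists i, forall p : R, 0 <= p -> 0 < derivative_ge0 (f M i) p)
    (qs_gt0 : 0 < qs) (qs_lt : qs < qm M)
    (qu_gt : qm M < qu) (qu_lt : qu < 2 * qm M)
    (g_zeros : forall q : R, 0 <= q -> q < qmax M ->
       (g M q = 0 <-> q = qs \/ q = qu))
    (g_sign_qs : changes_sign_at (g M) qs)
    (g_sign_qu : changes_sign_at (g M) qu)
    (g_derivable_qu : derivable (g M) qu 1)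
    (g_deriv_qu : 0 < derive1 (g M) qu)
    (mu_qs : mu M qs = mumax M) (mu_qu : mu M qu = mumax M)
    (min_qu : forall i, minimal_at_right_end (exit_rate M i) qu)
    (qdag_in : qm M <= qdag <= qu)
    (qdag_min_on : minimal_on_upto M qu qdag)
    (qdag_least : forall q : R, qm M <= q <= qu -> minimal_on_upto M qu q ->
       qdag <= q)
    (qad_in : qdag < qad < qu) :
  let xs : state R n := (Rhat M qs, qs) in
  [/\ fixed_point (field_ad M qad) xs,
      locally_asymptotically_stable (field_ad M qad) (X_ad qad) xs
    & forall x0 : state R n, X_ad qad x0 ->
        (exists x, caratheodory_solution (field_ad M qad) x /\ x 0 = x0) /\
        forall x, caratheodory_solution (field_ad M qad) x -> x 0 = x0 ->
          dist_to_set (x t) (core M qdag) @[t --> +oo] --> 0%E].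
Proof.
move=> xs.
have qs_ge : qc M <= qs by apply/(mu_sat qs qc_gt0 mumax_gt0).
have mu_ge q : qs <= q -> mu M q = mumax M.
  by move=> qsq; apply/(mu_sat q qc_gt0 mumax_gt0); apply: le_trans qsq.
have /andP[qdag1 qdag2] := qdag_in; have /andP[qad1 qad2] := qad_in.
have qs_qdag : qs < qdag := lt_le_trans qs_lt qdag1.
have qs_qad : qs < qad := lt_trans qs_qdag qad1.
(* Strictly between q^u and q_max: alpha is positive on [0, b], and q^u is interior for the argument
   on the sign of g. *)
pose b := (qu + qmax M) / 2.
have qub : qu < b by move: qu_lt qmax_ge; rewrite /b; slim; lra.
have bq : b < qmax M by move: qu_lt qmax_ge; rewrite /b; slim; lra.
have qadb : qad <= b := ltW (lt_trans qad2 qub).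
have qad0 : 0 < qad := lt_trans qs_gt0 qs_qad.
have b0 : 0 <= b := le_trans (ltW qad0) qadb.
have [L L0 tm] := model_tame K_gt0 mumax_gt0 qc_gt0 beta_gt0 qm_gt0 alpha_C1 alpha_gt0
  alpha_decr f_ge0 f_C1 f_ndecr b0 bq.
have Sg q : 0 <= q -> q <= b -> 0 < alpha M q /\
    g M q * alpha M q = alpha M q * \sum_i Rhat M q 0 i - mu M q.
  move=> q0 qb; have qin : 0 <= q <= b by rewrite q0.
  have /andP[a0 _] := tame_alpha tm qin; split=> //.
  rewrite /g mulrBl divfK ?gt_eqF // mulrC; congr (_ * _ - _).
  by apply: eq_bigr => i _; rewrite mxE.
have below q : qdag <= q <= qad -> alpha M q * \sum_i Rhat M q 0 i < mumax M.
  move=> /andP[q1 q2]; have qsq := lt_le_trans qs_qdag q1.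
  have gq : g M q < 0.
    exact: (g_neg_between tm qs_gt0 qsq (le_lt_trans q2 qad2) qub (ltW bq) g_zeros).
  have [a0 E] := Sg q (ltW (lt_trans qs_gt0 qsq)) (le_trans q2 qadb).
  have : g M q * alpha M q < 0 by rewrite pmulr_llt0.
  by rewrite E mu_ge ?subr_lt0 // ltW.
have rate_min q : qdag <= q <= qad -> forall i, minimal_at_right_end (exit_rate M i) q.
  by move=> /andP[q1 q2]; apply: qdag_min_on; rewrite q1 (le_trans q2 (ltW qad2)).
have qsb : qs <= b := ltW (lt_le_trans qs_qad qadb).
have balance : alpha M qs * \sum_i Rhat M qs 0 i = mumax M.
  have gqs : g M qs = 0.
    by apply/g_zeros; [exact: ltW|exact: le_lt_trans qsb bq|left].
  have [_] := Sg qs (ltW qs_gt0) qsb.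
  by rewrite gqs mul0r mu_qs => /esym/eqP; rewrite subr_eq0 => /eqP.
have qadin : qdag <= qad <= qad by rewrite lexx ltW.
have mu_qad q : qad <= q -> mu M q = mumax M.
  by move=> qadq; apply: mu_ge; exact: le_trans (ltW qs_qad) qadq.
have bounded x : caratheodory_solution (field_ad M qad) x -> X_ad qad (x 0) ->
    exists B, forall t, 0 <= t -> in_range qad B (x t).
  move=> xsol x0.
  have [B _ HB] := r_bounded tm n_ge1 qad0 qadb mu_qad (rate_min _ qadin) (below _ qadin) xsol x0.
  by exists B.
pose a := - derivative_ge0 (alpha M) qs.
have dalpha : is_derive qs 1 (alpha M) (- a).
  rewrite opprK; apply: slope_ge0_interior => //.
  by apply: derivative_ge0_slope; apply: alpha_C1.1; exact: ltW.
(* Strict decrease of alpha still permits a = 0 at q^s. *)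
have a0 : 0 <= a.
  have := is_deriveN dalpha; rewrite opprK => da.
  have r0 : 0 < qad - qs by rewrite subr_gt0.
  apply: (slope_ge0_of_nondecreasing r0 da) => s qss sq.
  by rewrite -[leLHS]/(- alpha M qs) -[leRHS]/(- alpha M s) lerN2;
    apply: (tame_alpha_mono tm); [exact: ltW|exact: qss|move: sq qadb; slim; lra].
pose phi i := beta M * derivative_ge0 (f M i) (beta M * qs).
have drate i : is_derive qs 1 (price_rate M i) (phi i).
  exact: price_rate_is_derive.
have phi0 i : 0 <= phi i.
  have r0 : 0 < qm M - qs by rewrite subr_gt0.
  apply: (slope_ge0_of_nondecreasing r0 (drate i)) => s qss sq.
  have sm : s <= qm M by move: sq; slim; lra.
  rewrite /price_rate /price sm (ltW qs_lt); apply: f_ndecr.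
    by rewrite mulr_ge0 // ltW.
  by rewrite ler_pM2l.
have [i0 fi0] := f_deriv_gt0.
have phi_gt0 : 0 < phi i0.
  by apply: mulr_gt0 => //; apply: fi0; apply: mulr_ge0; exact: ltW.
split.
- exact: (equilibrium tm qs_gt0 qs_qad qadb mu_ge balance).
- exact: (equilibrium_stable tm qs_gt0 qs_qad qadb mu_ge dalpha a0 drate phi0 phi_gt0 balance
  bounded).
- move=> x0 x0X; split.
    exact: (caratheodory_exists tm (ltW qs_gt0) qs_qad qadb mu_ge x0X).
  move=> x xsol xE; rewrite -xE in x0X.
  exact: (dist_to_core_cvg tm n_ge1 (ltW qs_gt0) qs_qdag (ltW qad1) qadb mu_ge rate_min below
    xsol x0X).
Qed.
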